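(* Let $S \subset \mathrm{GL}_d(\mathbb{C})$ be a non-empty compact set and assume that the subgroup of $\mathrm{GL}_d(\mathbb{C})$ generated by $S$ acts irreducibly on $\mathbb{C}^d$. Then the sequence of compact sets $\frac{1}{n}\kappa(S^n)$, $n\geq 1$, converges in the Hausdorff metric, as $n\to+\infty$, to a compact subset of $\mathbb{R}^d$ (called the joint spectrum $J(S)$ of $S$).
   Context: For $g\in \mathrm{GL}_d(\mathbb{C})$, let $a_1(g)\geq \dots\geq a_d(g)>0$ be its singular values, i.e. the square roots of the eigenvalues of $g^*g$, and set $\kappa(g)=(\log a_1(g),\dots,\log a_d(g))\in\mathbb{R}^d$. For $n\geq 1$, $S^n:=\{g_1\cdots g_n : g_i\in S\}$ is the $n$-fold product set, $\kappa(S^n):=\{\kappa(g): g\in S^n\}$ and $\frac1n\kappa(S^n)=\{\frac1n\kappa(g):g\in S^n\}$. The Hausdorff metric is the usual one on non-empty compact subsets of $\mathbb{R}^d$. *)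

(* Defs.v *)
From HB Require Import structures.
From mathcomp Require Import all_boot all_order all_algebra.
From mathcomp Require Import all_classical all_reals all_analysis.
From mathcomp Require Import complex.
Set Implicit Arguments.
Unset Strict Implicit.
Unset Printing Implicit Defensive.
Import Order.TTheory GRing.Theory Num.Theory.
Import numFieldNormedType.Exports.

Local Open Scope classical_set_scope.
Local Open Scope ring_scope.
Local Open Scope complex_scope.
Local Open Scope sesquilinear_scope.

(* The topology of R[i] is the one given by the modulus; MathComp-Analysis then
   puts on 'M[R[i]]_d the entrywise (product) topology. *)
HB.instance Definition _ (R : realType) := NormedModule.copy R[i] R[i]^o.

Section JointSpectrum.
Variables (R : realType) (d : nat).
Implicit Types (g : 'M[R[i]]_d) (S G : set 'M[R[i]]_d).
Implicit Types (u v : 'rV[R]_d) (A B : set 'rV[R]_d).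

Definition GL : set 'M[R[i]]_d := [set g | g \in unitmx].

Definition is_subgroup G : Prop :=
  [/\ G `<=` GL,
      G 1%:M,
      forall g h, G g -> G h -> G (g *m h)
    & forall g, G g -> G (invmx g)].

Definition generated_subgroup S : set 'M[R[i]]_d := smallest is_subgroup S.

(* The action is the standard one on column vectors; the zero space is not
   considered irreducible. *)
Definition acts_irreducibly G : Prop :=
  (0 < d)%N /\
  forall U : {vspace 'cV[R[i]]_d},
    (forall g, G g -> forall v : 'cV[R[i]]_d, v \in U -> g *m v \in U) ->
    U = 0%VS \/ U = fullv.

Definition product_set S (n : nat) : set 'M[R[i]]_d :=
  [set \prod_(j < n) s j | s in [set s : 'I_n -> 'M[R[i]]_d | forall j, S (s j)]].

(* With algebraic multiplicities: char_poly g is the product of the 'X - z%:P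
   for z in this sequence. *)
Definition eigenvalues g : seq R[i] :=
  sval (closed_field_poly_normal (char_poly g)).

(* The eigenvalues of g^t* *m g are real and nonnegative, so that taking real
   parts only transports them from R[i] to R. *)
Definition singular_values g : seq R :=
  sort >=%R [seq Num.sqrt (complex.Re z) | z <- eigenvalues (g ^t* *m g)].

Definition kappa g : 'rV[R]_d := \row_(j < d) ln (singular_values g)`_j.

Definition scaled_kappa S (n : nat) : set 'rV[R]_d :=
  [set n%:R^-1 *: kappa g | g in product_set S n].

(* The norm of 'rV[R]_d in MathComp-Analysis is the sup norm, hence the explicit
   Euclidean distance. *)
Definition euclidean_dist u v : R :=
  Num.sqrt (\sum_(j < d) (u ord0 j - v ord0 j) ^+ 2).

Definition dist_to_set u A : R := inf [set euclidean_dist u v | v in A].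

(* Meaningful for nonempty compact sets, where all inf and sup are finite. *)
Definition hausdorff_dist A B : R :=
  Num.max (sup [set dist_to_set u B | u in A])
          (sup [set dist_to_set v A | v in B]).

End JointSpectrum.

(* Main.v *)
Require Import Defs.
From HB Require Import structures.
From mathcomp Require Import all_boot all_order all_algebra.
From mathcomp Require Import fingroup perm.
From mathcomp Require Import all_classical all_reals all_analysis.
From mathcomp Require Import complex ring lra.
Import Order.TTheory GRing.Theory Num.Theory.
Import numFieldNormedType.Exports.
Local Open Scope classical_set_scope.
Local Open Scope ring_scope.
Local Open Scope complex_scope.
Local Open Scope sesquilinear_scope.
Set Implicit Arguments.
Unset Strict Implicit.
Unset Printing Implicit Defensive.

(**
Write S^n for the n-fold product sets and T for the monoid generated by S.
The heart of the proof is a recurrence property, [kappa_recurrent]: there is a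
constant K such that for every n > 0 and all large m, each point of
kappa(S^n)/n is within K/n of some point of kappa(S^m)/m.  For uniformly
bounded sets this forces the lower and upper limits to agree, and with
compactness it gives convergence in the Hausdorff metric to the set of limit
points ([hausdorff_convergence]).

To prove the recurrence, one looks, given g in S^n, for an element t of T,
taken in a finite list independent of g, such that kappa((g t)^p) differs from
p kappa(g) by at most a constant times p ([kappa_sum_growth]).  A length m is
then reached by multiplying a power of g t by a short power of a fixed s in S.

The sum kappa_1 + ... + kappa_m is, up to a bounded error, the logarithm of the
norm of g on the m-th exterior power, hence it is subadditive up to a constant
([kappa_sum_submul]); this bounds the partial sums of kappa((g t)^p) from
above.  It is therefore enough to bound the total of all these partial sums
from below, and that total is the logarithm of the norm of g in a single
representation rho, the tensor product of all exterior powers ([tensor_size]).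
It is realised as the image of an antisymmetrising projection in a tensor
power.  So the spectral radius of rho(g t) should be of the order of the norm
of rho(g), and for this it is enough that some trace tr rho(g t) is of that
order ([trace_controls_size], [kappa_total_pow]).

The traces control the norm as soon as the trace form is nondegenerate on the
linear span of rho(T).  This is true for a monoid of matrices all of whose
invariant subspaces are also invariant under the adjoints
([trace_form_nondegenerate]).  That property is reached after a conjugation,
by a variational argument instead of the structure theory of reductive groups.
Take a finite family gamma_i in S that is rich enough, and minimise the sum of
the |kappa(h gamma_i h^-1)|^2 over all invertible h.  By irreducibility the
minimum is attained ([conj_energy_min]).  At a minimum the first variation
([kappa_sq_variation]) vanishes, which says that the family is [balanced]: the
sums of the logarithms of the positive parts of the gamma_i, taken on the left
and on the right, are equal.  Balanced families stay balanced in tensor powers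
([balanced_tensor]), and Jensen's inequality for the logarithm shows that a
subspace invariant under a balanced family is invariant under the adjoints
([balanced_stable_adj]).

Matrices act on row vectors from the right, so a subspace is the row space of
a matrix W, and it is invariant under g when (W *m g <= W)%MS.
*)

(** * Linear spans and traces of idempotents *)

Section Spans.
Variable F : fieldType.

(** Take a matrix of maximal rank among those whose rows lie in X: appending
    one more vector of X cannot raise its rank. *)
Lemma rows_spanning n (X : set 'rV[F]_n) :
  exists r (B : 'M[F]_(r, n)),
    (forall i, X (row i B)) /\ forall v, X v -> (v <= B)%MS.
Proof.
pose P k := `[< exists r (B : 'M[F]_(r, n)),
  (forall i, X (row i B)) /\ \rank B = k >].
have exP : exists k, P k.
  exists 0%N; apply/asboolP; exists 0%N, (0 : 'M[F]_(0, n)).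
  by split; [case | rewrite mxrank0].
have ubP k : P k -> (k <= n)%N.
  by move=> /asboolP[r [B [_ <-]]]; exact: rank_leq_col.
case: (ex_maxnP exP ubP) => k /asboolP[r [B [BX rB]]] kmax.
exists r, B; split => // v Xv.
have : P (\rank (col_mx v B)).
  apply/asboolP; exists (1 + r)%N, (col_mx v B); split => // i.
  by case: (splitP i) => j ij;
    [have -> : i = lshift r j by exact: val_inj
    |have -> : i = rshift 1 j by exact: val_inj];
    rewrite ?rowKu ?rowKd // ?ord1 ?row_id.
move=> /kmax; rewrite -rB => le_rank.
have sub : (B <= col_mx v B)%MS by rewrite -addsmxE addsmxSr.
have := mxrank_leqif_sup sub; move/leqifP; case: ifP.
  by rewrite -addsmxE addsmx_sub => /andP[].
by move=> _; rewrite ltnNge le_rank.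
Qed.

Lemma finite_spanning_family (I : Type) (X : set I) n (f : I -> 'rV[F]_n) :
  exists r (t : 'I_r -> I),
    (forall i, X (t i)) /\ forall x, X x -> (f x <= \matrix_i f (t i))%MS.
Proof.
have [r [B [BX spB]]] := rows_spanning (f @` X).
have /choice[t tP] : forall i, exists x, X x /\ f x = row i B.
  by move=> i; have [x Xx fx] := BX i; exists x.
exists r, t; split => [i|x Xx]; first by case: (tP i).
have -> : \matrix_i f (t i) = B.
  by apply/row_matrixP => i; rewrite rowK; case: (tP i).
by apply: spB; exists x.
Qed.

Lemma finite_spanning_matrices (I : Type) (X : set I) m n (f : I -> 'M[F]_(m, n)) :
  exists r (t : 'I_r -> I), (forall i, X (t i)) /\
    forall x, X x -> exists c : 'I_r -> F, f x = \sum_i c i *: f (t i).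
Proof.
have [r [t [Xt tP]]] := finite_spanning_family X (fun x => mxvec (f x)).
exists r, t; split => // x /tP/submxP[u uE]; exists (u 0).
apply: (can_inj mxvecK); rewrite uE mulmx_sum_row linear_sum.
by apply: eq_bigr => i _; rewrite rowK linearZ.
Qed.

Definition linear_set (V : lmodType F) (Y : set V) :=
  Y 0 /\ forall c u v, Y u -> Y v -> Y (c *: u + v).

(** Stated through all linear sets that contain X, so that a property of the
    elements of the span is proved by checking that it defines a linear set.
    *)
Definition linear_span (V : lmodType F) (X : set V) : set V :=
  [set a | forall Y, linear_set Y -> X `<=` Y -> Y a].

Lemma linear_set_linear_span (V : lmodType F) (X : set V) :
  linear_set (linear_span X).
Proof.
split=> [Y [] //|c u v Xu Xv Y lY XY].
by case: (lY) => _; apply; [exact: Xu | exact: Xv].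
Qed.

Lemma sub_linear_span (V : lmodType F) (X : set V) : X `<=` linear_span X.
Proof. by move=> a Xa Y _; apply. Qed.

Lemma linear_set_matrix n (Y : set 'rV[F]_n) : linear_set Y ->
  exists A : 'M[F]_n, forall v, (v <= A)%MS <-> Y v.
Proof.
move=> [Y0 YD]; have [r [B [BY spB]]] := rows_spanning Y.
exists <<B>>%MS => v; rewrite genmxE; split; last exact: spB.
move=> /submxP[w ->]; rewrite mulmx_sum_row.
apply: (big_ind Y) => // [x y Yx Yy|i _]; first by rewrite -[x]scale1r; exact: YD.
by rewrite -[_ *: _]addr0; apply: YD.
Qed.

Lemma linear_span_mulmx n (X : set 'M[F]_n) (a b : 'M[F]_n) :
  (forall a b, X a -> X b -> X (a *m b)) ->
  linear_span X a -> linear_span X b -> linear_span X (a *m b).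
Proof.
move=> XM Xa Xb.
have [X0 XD] := linear_set_linear_span X.
apply: (Xa (fun a => linear_span X (a *m b))) => [|x Xx].
  by split=> [|c u v ? ?]; rewrite ?mul0mx // mulmxDl -scalemxAl; exact: XD.
apply: (Xb (fun b => linear_span X (x *m b))) => [|y Xy].
  by split=> [|c u v ? ?]; rewrite ?mulmx0 // mulmxDr -scalemxAr; exact: XD.
by apply: sub_linear_span; exact: XM.
Qed.

Lemma linear_span_stable n (X : set 'M[F]_n) m (W : 'M[F]_(m, n)) :
  (forall a, X a -> (W *m a <= W)%MS) ->
  forall a, linear_span X a -> (W *m a <= W)%MS.
Proof.
move=> WX a Xa; apply: (Xa (fun a => (W *m a <= W)%MS)) => // {a Xa}.
split=> [|c u v Wu Wv]; first by rewrite mulmx0 sub0mx.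
by rewrite mulmxDr -scalemxAr addmx_sub // scalemx_sub.
Qed.

(** In the factorisation of A through its row and column bases, A *m A = A
    forces row_base A *m col_base A = 1, and the trace is invariant under
    exchanging the factors. *)
Lemma mxtrace_idempotent n (A : 'M[F]_n) : A *m A = A -> \tr A = (\rank A)%:R.
Proof.
move=> AA; rewrite -{1}(mulmx_base A) mxtrace_mulC.
suff -> : row_base A *m col_base A = 1%:M by rewrite mxtrace1.
move: (row_base A) (col_base A) (mulmx_base A) (row_base_free A) (col_base_full A).
move=> r c crA rfree cfull.
apply: (row_full_inj cfull); rewrite mulmx1; apply: (row_free_inj rfree).
by rewrite mulmxA -mulmxA crA.
Qed.

End Spans.

(** * Nondegeneracy of the trace form *)

Section TraceForm.
Variable C : numClosedFieldType.

Lemma adjM m n p (A : 'M[C]_(m, n)) (B : 'M[C]_(n, p)) :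
  (A *m B) ^t* = B ^t* *m A ^t*.
Proof. by rewrite trmx_mul map_mxM. Qed.

Lemma adjE m n (A : 'M[C]_(m, n)) i j : (A ^t*) i j = ((A j i)^*)%R.
Proof. by rewrite !mxE. Qed.

Lemma mulmx_adj_eq0 m n (A : 'M[C]_(m, n)) : A *m A ^t* = 0 -> A = 0.
Proof.
move=> AA; apply/matrixP => i j; rewrite mxE.
have /eqP := congr1 (fun M : 'M[C]_(m, m) => M i i) AA; rewrite !mxE psumr_eq0.
  move=> /allP/(_ j); rewrite mem_index_enum => /(_ isT).
  by rewrite !mxE mul_conjC_eq0 => /eqP.
by move=> k _; rewrite !mxE mul_conjC_ge0.
Qed.

(** Fitting's lemma. Write the characteristic polynomial as r * 'X^l with r
    not vanishing at 0, and 1 = a * 'X^(l+1) + b * r. The value e of a *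
    'X^(l+1) at j is idempotent by Cayley-Hamilton. It fixes u, because the
    eigenvalue 1 is a root of the characteristic polynomial and so of r; hence
    e is not 0. *)
Lemma eigenvalue1_idempotent n (j : 'M[C]_n.+1) (u : 'rV[C]_n.+1) :
  u != 0 -> u *m j = u ->
  exists q : {poly C}, let e := j *m horner_mx j q in e *m e = e /\ e != 0.
Proof.
move=> u0 uj; have p0 : char_poly j != 0 by exact/monic_neq0/char_poly_monic.
have [[l r] rE pE] : exists2 lr : nat * {poly C}, ~~ root lr.2 0 &
    char_poly j = lr.2 * 'X ^+ lr.1.
  have [l [r r0 pE]] := multiplicity_XsubC (char_poly j) 0.
  by exists (l, r); [exact: implyP r0 p0 | rewrite pE subr0].
have rX : coprimep 'X^(l.+1) r.
  by rewrite coprimep_expl // coprimep_sym -['X]subr0 -polyC0 coprimep_XsubC.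
have [[a b] /= abE] := Bezout_eq1_coprimepP _ _ rX.
have uh q : u *m horner_mx j q = q.[1] *: u.
  elim/poly_ind: q => [|q c IH]; first by rewrite rmorph0 mulmx0 horner0 scale0r.
  rewrite rmorphD rmorphM /= horner_mx_X horner_mx_C mulmxDr mulmxA IH.
  by rewrite -scalemxAl uj mul_mx_scalar -scalerDl !hornerE.
have p1 : (char_poly j).[1] = 0.
  have := uh (char_poly j); rewrite (Cayley_Hamilton j) mulmx0 => /esym/eqP.
  by rewrite scaler_eq0 (negbTE u0) orbF => /eqP.
have r1 : r.[1] = 0 by move: p1; rewrite pE !hornerE expr1n mulr1.
exists (a * 'X^l).
have -> : j *m horner_mx j (a * 'X^l) = horner_mx j (a * 'X^(l.+1)).
  by rewrite exprS mulrCA [RHS]rmorphM /= horner_mx_X.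
set e := horner_mx _ _; split; last first.
  apply/eqP => e0; have := uh (a * 'X^(l.+1)); rewrite -/e e0 mulmx0.
  have := congr1 (fun p => p.[1]) abE; rewrite hornerD [(b * r).[1]]hornerM r1.
  rewrite mulr0 addr0 hornerC => ->; rewrite scale1r => /esym/eqP.
  by rewrite (negbTE u0).
apply/eqP; rewrite -subr_eq0 -{3}[e]mulmx1 -mulmxBr; apply/eqP.
have -> : e - 1%:M = - horner_mx j (b * r).
  have := congr1 (horner_mx j) abE; rewrite rmorphD rmorph1 -/e => abh.
  by rewrite -[1%:M]abh opprD addNKr.
rewrite mulmxN -[_ *m _]rmorphM.
have -> : a * 'X^(l.+1) * (b * r) = a * 'X * b * char_poly j.
  by rewrite pE /= exprS; ring.
by rewrite rmorphM /= Cayley_Hamilton mulr0 oppr0.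
Qed.

(** The radical J of the trace form is an ideal. The common kernel K of J is
    invariant, hence so is its orthogonal complement O, by the hypothesis on
    adjoints. If O were not 0, take a minimal nonzero invariant subspace U of
    O and a vector u of U that J does not kill: u J is all of U by minimality,
    so u e = u for some e in J. An idempotent polynomial in e without constant
    term lies in J, where all traces vanish, but its trace is its rank, which
    is not 0. So O = 0, J kills everything, and J = 0. *)
Lemma trace_form_nondegenerate n (X : set 'M[C]_n) : X 1%:M ->
  (forall a b, X a -> X b -> X (a *m b)) ->
  (forall W : 'M[C]_n, (forall a, X a -> (W *m a <= W)%MS) ->
     forall a, X a -> (W *m a^t* <= W)%MS) ->
  forall a, linear_span X a -> (forall b, X b -> \tr (a *m b) = 0) -> a = 0.
Proof.
case: n X => [X _ _ _ a0 _ _|n X X1 XM Xadj a0 Xa0 tra0]; first exact: thinmx0.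
pose J := [set j | linear_span X j /\ forall b, X b -> \tr (j *m b) = 0].
have lJ : linear_set J.
  have [X0 XD] := linear_set_linear_span X; split.
    by split => // b _; rewrite mul0mx mxtrace0.
  move=> c u v [Xu tu] [Xv tv]; split=> [|b Xb]; first exact: XD.
  by rewrite mulmxDl -scalemxAl mxtraceD mxtraceZ tu // tv // mulr0 addr0.
have [J0 JD] := lJ.
have JMr j a : J j -> linear_span X a -> J (j *m a).
  move=> [Xj tj] Xa; apply: (Xa (fun a => J (j *m a))).
    by split=> [|c u v Ju Jv]; rewrite ?mulmx0 // mulmxDr -scalemxAr; exact: JD.
  move=> x Xx; split; first by apply: linear_span_mulmx => //; exact: sub_linear_span.
  by move=> b Xb; rewrite -mulmxA tj //; exact: XM.
have JMl j t : J j -> X t -> J (t *m j).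
  move=> [Xj tj] Xt; split.
    by apply: linear_span_mulmx => //; exact: sub_linear_span.
  by move=> b Xb; rewrite -mulmxA mxtrace_mulC -mulmxA tj //; exact: XM.
have Jtr j a : J j -> linear_span X a -> \tr (j *m a) = 0.
  move=> Jj Xa; have [_ /(_ 1%:M X1)] := JMr _ _ Jj Xa.
  by rewrite mulmx1.
have [K KP] : exists K : 'M[C]_n.+1, forall v : 'rV[C]_n.+1,
    (v <= K)%MS <-> forall j, J j -> v *m j = 0.
  apply: (@linear_set_matrix _ _ (fun v => forall j, J j -> v *m j = 0)).
  split=> [j _|c u v Ku Kv j Jj]; first exact: mul0mx.
  by rewrite mulmxDl -scalemxAl Ku // Kv // scaler0 addr0.
have KX a : X a -> (K *m a <= K)%MS.
  move=> Xa; apply/row_subP => i; apply/KP => j Jj.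
  rewrite row_mul -mulmxA; have /KP : (row i K <= K)%MS by exact: row_sub.
  by apply; exact: JMl.
(* the orthogonal complement of K *)
pose O := kermx (K ^t*).
have OP m (v : 'M[C]_(m, n.+1)) : (v <= O)%MS = (v *m K ^t* == 0) by apply/sub_kermxP/eqP.
have OX a : X a -> (O *m a <= O)%MS.
  move=> Xa; rewrite OP -mulmxA.
  have /submxP[Z KZ] := Xadj _ KX _ Xa.
  have -> : a *m K ^t* = K ^t* *m Z ^t*.
    by rewrite -[in LHS](trmxCK a) -!map_mxM -!trmx_mul KZ.
  by rewrite mulmxA mulmx_ker mul0mx.
have KO v : (v <= K)%MS -> (v <= O)%MS -> v = 0.
  move=> /submxP[w vE]; rewrite OP => /eqP vK; apply: mulmx_adj_eq0.
  by rewrite {2}vE trmx_mul map_mxM mulmxA vK mul0mx.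
suff O0 : O = 0.
  have Kfull : row_full K.
    have := mxrank_ker (K ^t*); rewrite -/O O0 mxrank0 mxrank_map mxrank_tr.
    by move/esym/eqP; rewrite subn_eq0 /row_full eqn_leq rank_leq_col.
  apply/row_matrixP => i; rewrite row0 rowE.
  by apply: (KP _).1 => //; exact: submx_full.
apply/eqP/negP => O0.
(* the dimensions of the nonzero invariant subspaces of O *)
pose P k := `[< exists U : 'M[C]_n.+1, [/\ U != 0, (U <= O)%MS,
  forall a, X a -> (U *m a <= U)%MS & \rank U = k] >].
have exP : exists k, P k.
  by exists (\rank O); apply/asboolP; exists O; split=> //; exact/negP.
case: (ex_minnP exP) => k /asboolP[U [U0 UO UX rU]] kmin.
have /rowV0Pn[u uU u0] := U0.
have [j Jj uj] : exists2 j, J j & u *m j != 0.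
  apply: contrapT => noj; case/negP: u0; apply/eqP; apply: KO.
    apply/KP => j Jj; apply/eqP/negP => uj; apply: noj; exists j => //.
    exact/negP.
  exact: submx_trans uU UO.
(* U' is the subspace u J *)
have [U' U'P] : exists U' : 'M[C]_n.+1, forall v : 'rV[C]_n.+1,
    (v <= U')%MS <-> exists2 j, J j & v = u *m j.
  apply: (@linear_set_matrix _ _ (fun v => exists2 j, J j & v = u *m j)).
  split; first by exists 0; rewrite ?mulmx0.
  move=> c _ _ [j1 J1 ->] [j2 J2 ->]; exists (c *: j1 + j2); first exact: JD.
  by rewrite mulmxDr scalemxAr.
have U'U : (U' <= U)%MS.
  apply/row_subP => i; have /U'P[j' [Xj' _] ->] := row_sub i U'.
  exact: submx_trans (submxMr _ uU) (linear_span_stable UX Xj').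
have uU' : (u <= U')%MS.
  apply: submx_trans uU _; rewrite -(mxrank_leqif_sup U'U) eqn_leq mxrankS //=.
  rewrite rU; apply: kmin; apply/asboolP; exists U'; split => //.
  - apply/negP => /eqP U'0; have /U'P : exists2 j', J j' & u *m j = u *m j'.
      by exists j.
    by rewrite U'0 submx0 (negbTE uj).
  - exact: submx_trans U'U UO.
  - move=> a Xa; apply/row_subP => i; rewrite row_mul; apply/U'P.
    have /U'P[j' Jj' ->] := row_sub i U'.
    exists (j' *m a); last by rewrite mulmxA.
    by apply: JMr => //; exact: sub_linear_span.
have /U'P[e Je ue] := uU'.
have [q [eqq qn0]] := eigenvalue1_idempotent u0 (esym ue).
move: eqq qn0; set p := _ *m _ => pp pn0.
have Xq : linear_span X (horner_mx e q).
  have [X0 XD] := linear_set_linear_span X.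
  elim/poly_ind: q {p pp pn0} => [|q c IH]; first by rewrite rmorph0.
  rewrite rmorphD rmorphM /= horner_mx_X horner_mx_C addrC.
  have -> : c%:M = c *: (1%:M : 'M[C]_n.+1) by rewrite scalemx1.
  apply: XD; first exact: sub_linear_span.
  by apply: linear_span_mulmx => //; case: Je.
have := Jtr _ _ Je Xq; rewrite -/p mxtrace_idempotent // => /eqP.
by rewrite pnatr_eq0 mxrank_eq0 (negbTE pn0).
Qed.

End TraceForm.

(** * Complex matrices: size and singular values *)

(** The properties of the complex numbers over R that the argument uses. The
    singular values are specified through the characteristic polynomial of g^*
    g, which determines them as a sorted sequence; R[i] is such a structure,
    see standard_complex. *)
Record complexModel (R : realType) := ComplexModel {
  model_sort :> numClosedFieldType;
  model_cplx : {rmorphism R -> model_sort};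
  model_re : {additive model_sort -> R};
  model_sv : forall n, 'M[model_sort]_n -> seq R;
  model_cplx_le : forall x y, (model_cplx x <= model_cplx y) = (x <= y);
  model_reE : forall z, model_cplx (model_re z) = 'Re z;
  model_svE : forall n (g : 'M[model_sort]_n) (s : seq R),
    char_poly (g ^t* *m g) = \prod_(x <- s) ('X - (model_cplx x)%:P) ->
    model_sv g = sort >=%R [seq Num.sqrt x | x <- s] }.

Section Norm.
Variables (R : realType) (C : complexModel R).
Local Notation "x %:C" := (model_cplx C x).
Local Notation re := (model_re C).
Local Notation sv := (@model_sv R C _).

Definition kappaC n (g : 'M[C]_n) : 'rV[R]_n := \row_j ln (sv g)`_j.

Lemma cplx_inj : injective (model_cplx C).
Proof. by move=> x y xy; apply/eqP; rewrite eq_le -!(model_cplx_le C) xy lexx. Qed.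

Lemma cplx_lt (x y : R) : (x%:C < y%:C) = (x < y).
Proof. by rewrite !lt_def model_cplx_le (inj_eq cplx_inj). Qed.

Lemma cplx_real (x : R) : x%:C \is Num.real.
Proof. by rewrite realE -(rmorph0 (model_cplx C)) !model_cplx_le le_total. Qed.

Lemma conj_cplx (x : R) : ((x%:C)^*)%R = x%:C.
Proof. exact/CrealP/cplx_real. Qed.

Lemma re_real (z : C) : z \is Num.real -> (re z)%:C = z.
Proof. by move=> zr; rewrite model_reE; apply/Creal_ReP. Qed.

Lemma cplxK : cancel (model_cplx C) re.
Proof. by move=> x; apply: cplx_inj; rewrite re_real // cplx_real. Qed.

Lemma re_cplxM (x : R) (z : C) : re (x%:C * z) = x * re z.
Proof. by apply: cplx_inj; rewrite rmorphM /= !model_reE ReMl // cplx_real. Qed.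

Lemma norm_cplx (x : R) : `|x%:C| = `|x|%:C.
Proof.
have [x0|x0] := leP 0 x; first by rewrite (ger0_norm x0) ger0_norm // -(rmorph0 (model_cplx C)) model_cplx_le.
by rewrite (ltr0_norm x0) ltr0_norm ?rmorphN // -(rmorph0 (model_cplx C)) cplx_lt.
Qed.

Lemma cplx_re_le (z : C) : `|re z|%:C <= `|z|.
Proof. by rewrite -norm_cplx model_reE (leif_normC_Re_Creal z). Qed.

Definition cabs (z : C) : R := re `|z|.

Lemma cabsE z : (cabs z)%:C = `|z|.
Proof. by rewrite /cabs re_real // normr_real. Qed.

Lemma cabs_ge0 z : 0 <= cabs z.
Proof. by rewrite -(model_cplx_le C) cabsE rmorph0. Qed.

Lemma cabsD x y : cabs (x + y) <= cabs x + cabs y.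
Proof. by rewrite -(model_cplx_le C) rmorphD /= !cabsE ler_normD. Qed.

Lemma cabsM x y : cabs (x * y) = cabs x * cabs y.
Proof. by apply: cplx_inj; rewrite rmorphM /= !cabsE normrM. Qed.

Lemma cabsX x n : cabs (x ^+ n) = cabs x ^+ n.
Proof. by apply: cplx_inj; rewrite rmorphXn /= !cabsE normrX. Qed.

Lemma cabs0 : cabs 0 = 0. Proof. by rewrite /cabs normr0 raddf0. Qed.

Lemma cabs_real (x : R) : cabs x%:C = `|x|.
Proof. by rewrite /cabs norm_cplx cplxK. Qed.

Lemma cabs1 : cabs 1 = 1. Proof. by rewrite -(rmorph1 (model_cplx C)) cabs_real normr1. Qed.

Lemma cabsN x : cabs (- x) = cabs x. Proof. by rewrite /cabs normrN. Qed.

Lemma cabs_eq0 z : (cabs z == 0) = (z == 0).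
Proof. by rewrite -(inj_eq cplx_inj) cabsE rmorph0 normr_eq0. Qed.

Lemma cabs_conj z : cabs (z^*)%R = cabs z.
Proof. by rewrite /cabs norm_conjC. Qed.

Lemma normr_re_le z : `|re z| <= cabs z.
Proof. by rewrite -(model_cplx_le C) cabsE cplx_re_le. Qed.

Lemma cabs_sum I (r : seq I) (P : pred I) (F : I -> C) :
  cabs (\sum_(i <- r | P i) F i) <= \sum_(i <- r | P i) cabs (F i).
Proof.
elim/big_rec2: _ => [|i y x _ le]; first by rewrite cabs0.
by rewrite (le_trans (cabsD _ _)) // lerD2l.
Qed.

(** The entrywise l1 norm, chosen among all equivalent norms because it is
    submultiplicative without a constant. *)
Definition mxsize m n (A : 'M[C]_(m, n)) : R := \sum_i \sum_j cabs (A i j).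

Lemma mxsize_ge0 m n (A : 'M[C]_(m, n)) : 0 <= mxsize A.
Proof. by apply: sumr_ge0 => i _; apply: sumr_ge0 => j _; exact: cabs_ge0. Qed.

Lemma cabs_le_mxsize m n (A : 'M[C]_(m, n)) i j : cabs (A i j) <= mxsize A.
Proof.
rewrite /mxsize (bigD1 i) //= (bigD1 j) //= -addrA lerDl addr_ge0 //.
  by apply: sumr_ge0 => k _; exact: cabs_ge0.
by apply: sumr_ge0 => k _; apply: sumr_ge0 => l _; exact: cabs_ge0.
Qed.

Lemma mxsize_eq0 m n (A : 'M[C]_(m, n)) : mxsize A = 0 -> A = 0.
Proof.
move=> A0; apply/matrixP => i j; rewrite mxE; apply/eqP; rewrite -cabs_eq0.
by rewrite eq_le cabs_ge0 -A0 cabs_le_mxsize.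
Qed.

Lemma mxsizeD m n (A B : 'M[C]_(m, n)) : mxsize (A + B) <= mxsize A + mxsize B.
Proof.
rewrite /mxsize -big_split; apply: ler_sum => i _; rewrite -big_split.
by apply: ler_sum => j _; rewrite mxE cabsD.
Qed.

Lemma mxsizeZ m n c (A : 'M[C]_(m, n)) : mxsize (c *: A) = cabs c * mxsize A.
Proof.
rewrite /mxsize mulr_sumr; apply: eq_bigr => i _; rewrite mulr_sumr.
by apply: eq_bigr => j _; rewrite mxE cabsM.
Qed.

Lemma mxsizeN m n (A : 'M[C]_(m, n)) : mxsize (- A) = mxsize A.
Proof.
by apply: eq_bigr => i _; apply: eq_bigr => j _; rewrite mxE cabsN.
Qed.

Lemma mxsizeB m n (A B : 'M[C]_(m, n)) : mxsize (A - B) <= mxsize A + mxsize B.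
Proof. by rewrite (le_trans (mxsizeD _ _)) // mxsizeN. Qed.

Lemma mxsize_sum m n I (r : seq I) (F : I -> 'M[C]_(m, n)) :
  mxsize (\sum_(i <- r) F i) <= \sum_(i <- r) mxsize (F i).
Proof.
elim/big_rec2: _ => [|i y x _ le].
  by rewrite /mxsize big1 // => i _; rewrite big1 // => j _; rewrite mxE cabs0.
by rewrite (le_trans (mxsizeD _ _)) // lerD2l.
Qed.

Lemma mxsizeM m n p (A : 'M[C]_(m, n)) (B : 'M[C]_(n, p)) :
  mxsize (A *m B) <= mxsize A * mxsize B.
Proof.
rewrite /mxsize mulr_suml; apply: ler_sum => i _.
rewrite (@le_trans _ _ (\sum_k \sum_j cabs (A i j) * cabs (B j k))) //.
  apply: ler_sum => k _; rewrite mxE (le_trans (cabs_sum _ _ _)) //.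
  by apply: ler_sum => j _; rewrite cabsM.
rewrite exchange_big mulr_suml; apply: ler_sum => j _ /=.
rewrite -mulr_sumr ler_wpM2l ?cabs_ge0 //.
rewrite [leRHS](bigD1 j) //= lerDl.
by apply: sumr_ge0 => k _; apply: sumr_ge0 => l _; exact: cabs_ge0.
Qed.

Lemma mxsize_adj m n (A : 'M[C]_(m, n)) : mxsize (A ^t*) = mxsize A.
Proof.
rewrite /mxsize exchange_big; apply: eq_bigr => i _; apply: eq_bigr => j _.
by rewrite !mxE cabs_conj.
Qed.

Lemma cabs_mxtrace_le n (A : 'M[C]_n) : cabs (\tr A) <= mxsize A.
Proof.
rewrite (le_trans (cabs_sum _ _ _)) // ler_sum // => i _.
by rewrite (bigD1 i) //= lerDl sumr_ge0 // => j _; exact: cabs_ge0.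
Qed.

Lemma mxsize_le m n (A : 'M[C]_(m, n)) c : (forall i j, cabs (A i j) <= c) ->
  mxsize A <= c *+ (m * n).
Proof.
move=> Ac; rewrite (@le_trans _ _ (\sum_(i < m) \sum_(j < n) c)) //.
  by apply: ler_sum => i _; apply: ler_sum => j _; exact: Ac.
by rewrite !sumr_const !card_ord -mulrnA mulnC.
Qed.

Lemma unitarymx_row_sum m n (U : 'M[C]_(m, n)) i : U \is unitarymx ->
  \sum_j cabs (U i j) ^+ 2 = 1.
Proof.
move=> /unitarymxP/(congr1 (fun M : 'M[C]_(m, m) => M i i)).
rewrite !mxE eqxx => UU; apply: cplx_inj; rewrite rmorph_sum rmorph1; apply: etrans UU.
by apply: eq_bigr => j _; rewrite rmorphXn /= cabsE normCK !mxE.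
Qed.

Lemma unitarymx_cabs_le1 m n (U : 'M[C]_(m, n)) i j : U \is unitarymx ->
  cabs (U i j) <= 1.
Proof.
move=> /(unitarymx_row_sum i) U1; rewrite -(@ler_pXn2r _ 2) ?nnegrE ?cabs_ge0 //.
rewrite expr1n -U1 (bigD1 j) //= lerDl sumr_ge0 // => k _; exact: sqr_ge0.
Qed.

Lemma mxsize_unitary m n (U : 'M[C]_(m, n)) : U \is unitarymx ->
  mxsize U <= (m * n)%:R.
Proof.
by move=> UU; apply: mxsize_le => i j; exact: unitarymx_cabs_le1.
Qed.

Lemma unitarymx_mulVmx n (U : 'M[C]_n) : U \is unitarymx -> U ^t* *m U = 1%:M.
Proof. by move=> UU; rewrite -invmx_unitary // mulVmx // unitarymx_unit. Qed.

Definition rdiag n (a : 'rV[R]_n) : 'M[C]_n := diag_mx (map_mx (model_cplx C) a).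

Lemma rdiagE n (a : 'rV[R]_n) i j : rdiag a i j = (a 0 i)%:C *+ (i == j).
Proof. by rewrite !mxE. Qed.

Lemma rdiag_adj n (a : 'rV[R]_n) : (rdiag a) ^t* = rdiag a.
Proof.
apply/matrixP => i j; rewrite !mxE eq_sym rmorphMn /=.
by rewrite conj_cplx; case: eqP => [->|].
Qed.

Lemma rdiagM n (a b : 'rV[R]_n) :
  rdiag a *m rdiag b = rdiag (\row_j (a 0 j * b 0 j)).
Proof.
rewrite mulmx_diag; congr diag_mx; apply/rowP => j.
by rewrite !mxE rmorphM.
Qed.

Lemma rdiag1 n : rdiag (\row_(j < n) 1) = 1%:M.
Proof. by apply/matrixP => i j; rewrite !mxE rmorph1. Qed.

Lemma conj_rdiagE m n (U : 'M[C]_(m, n)) (a : 'rV[R]_n) i :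
  (U *m rdiag a *m U ^t*) i i = (\sum_k a 0 k * cabs (U i k) ^+ 2)%:C.
Proof.
rewrite mxE rmorph_sum; apply: eq_bigr => k _.
rewrite mul_mx_diag !mxE rmorphM rmorphXn /= cabsE normCK.
by rewrite [_ * (a _ _)%:C]mulrC mulrA.
Qed.

Lemma spectral_posdef n (B : 'M[C]_n) : B \in unitmx ->
  exists Q (a : 'rV[R]_n), [/\ Q \is unitarymx, (forall j, 0 < a 0 j) &
    B *m B ^t* = Q ^t* *m rdiag a *m Q].
Proof.
move=> Bu; set A := _ *m _.
have nA : A \is normalmx.
  apply/normalmxP; suff -> : A ^t* = A by [].
  by rewrite /A trmx_mul map_mxM /= trmxCK.
have := orthomx_spectralP nA; have := spectral_unitarymx A.
set Q := spectralmx A; set s := spectral_diag A => UQ AE.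
have sE : diag_mx s = Q *m B *m (Q *m B) ^t*.
  have Qu := unitarymx_unit UQ.
  rewrite trmx_mul map_mxM !mulmxA -(mulmxA Q) -/A AE -invmx_unitary //.
  by rewrite !mulmxA mulmxK // mulmxV // mul1mx.
have s_pos j : 0 < s 0 j.
  have := congr1 (fun M : 'M[C]_(n, n) => M j j) sE.
  rewrite !mxE eqxx mulr1n => ->.
  rewrite lt_def sumr_ge0 ?andbT; last by move=> k _; rewrite !mxE mul_conjC_ge0.
  rewrite psumr_eq0; last by move=> k _; rewrite !mxE mul_conjC_ge0.
  apply/negP => /allP QB0.
  have : row j (Q *m B) = 0.
    apply/rowP => k; have := QB0 k; rewrite mem_index_enum => /(_ isT).
    by rewrite !mxE mul_conjC_eq0 => /eqP.
  have QBu : Q *m B \in unitmx by rewrite unitmx_mul unitarymx_unit.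
  rewrite rowE => QBj; have := mulmxK QBu (delta_mx 0 j : 'rV_n).
  rewrite QBj mul0mx => /matrixP/(_ 0 j)/eqP; rewrite eq_sym.
  by rewrite !mxE !eqxx oner_eq0.
exists Q, (\row_j re (s 0 j)); split => // [j|].
  by rewrite mxE -cplx_lt rmorph0 re_real ?gtr0_real.
apply: etrans AE _; rewrite (invmx_unitary UQ); congr (_ *m diag_mx _ *m _).
by apply/rowP => j; rewrite !mxE re_real // gtr0_real.
Qed.

Lemma char_poly_conj n (Q A : 'M[C]_n) : Q \is unitarymx ->
  char_poly (Q ^t* *m A *m Q) = char_poly A.
Proof.
move=> UQ; rewrite /char_poly /char_poly_mx.
pose q := map_mx polyC Q; pose q' := map_mx polyC (Q ^t*).
have q'q : q' *m q = 1%:M by rewrite -map_mxM unitarymx_mulVmx // map_mx1.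
have -> : 'X%:M - map_mx polyC (Q ^t* *m A *m Q)
    = q' *m ('X%:M - map_mx polyC A) *m q.
  rewrite !map_mxM mulmxBr mulmxBl; congr (_ - _).
  by rewrite -mulmxA mul_scalar_mx -scalemxAr q'q scalemx1.
rewrite !det_mulmx mulrAC -det_mulmx q'q det1 mul1r //.
Qed.

Lemma singular_valuesE n (g Q : 'M[C]_n) (a : 'rV[R]_n) : Q \is unitarymx ->
  g ^t* *m g = Q ^t* *m rdiag a *m Q ->
  sv g = sort >=%R [seq Num.sqrt (a 0 j) | j <- enum 'I_n].
Proof.
move=> UQ gE; rewrite (@model_svE _ C _ _ [seq a 0 j | j <- enum 'I_n]).
  by rewrite -map_comp.
rewrite gE char_poly_conj // char_poly_trig; last exact: diag_mx_is_trig.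
by rewrite big_map big_enum; apply: eq_bigr => j _; rewrite rdiagE eqxx.
Qed.

(** Let the rows of Q be eigenvectors of g^* g, permuted into the order in
    which the singular values are sorted, and a the singular values; then P =
    g Q^* diag(1/a) is unitary. *)
Lemma singular_value_decomposition n (g : 'M[C]_n) : g \in unitmx ->
  exists P Q (a : 'rV[R]_n), [/\ P \is unitarymx, Q \is unitarymx,
    g = P *m rdiag a *m Q,
    (forall j, 0 < a 0 j) /\ (forall i j : 'I_n, (i <= j)%N -> a 0 j <= a 0 i) &
    forall j, kappaC g 0 j = ln (a 0 j)].
Proof.
move=> gu; have g'u : g ^t* \in unitmx by rewrite map_unitmx unitmx_tr.
have [Q0 [b [UQ0 b0]]] := spectral_posdef g'u; rewrite trmxCK => gE.
have sE := singular_valuesE UQ0 gE.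
set s := [seq _ | j <- _] in sE.
have szs : size s == n by rewrite size_map size_enum_ord.
have szg : size (sv g) == n by rewrite sE size_sort.
have /tuple_permP[p pE] : perm_eq (Tuple szg) (Tuple szs).
  by rewrite /= sE perm_sort.
pose a := \row_(j < n) (sv g)`_j.
have aE j : a 0 j = Num.sqrt (b 0 (p j)).
  rewrite mxE; have /= -> := pE; rewrite (nth_map j) ?size_enum_ord //.
  rewrite nth_ord_enum (tnth_nth 0) /= (nth_map j) ?size_enum_ord //.
  by rewrite nth_ord_enum.
have a_gt0 j : 0 < a 0 j by rewrite aE sqrtr_gt0.
have akappa j : kappaC g 0 j = ln (a 0 j) by rewrite !mxE.
have a_sorted (i j : 'I_n) : (i <= j)%N -> a 0 j <= a 0 i.
  move=> ij; rewrite !mxE; apply: (sorted_leq_nth ge_trans lexx) => //.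
  - by rewrite sE sort_sorted //; exact: ge_total.
  - by rewrite inE (eqP szg).
  - by rewrite inE (eqP szg).
clearbody a.
pose Q := perm_mx p *m Q0.
have UQ : Q \is unitarymx.
  apply: mul_unitarymx; [apply/unitarymxP|exact: UQ0].
  by rewrite tr_perm_mx map_perm_mx -perm_mxM mulgV perm_mx1.
have QgQ : Q *m (g ^t* *m g) *m Q ^t* = rdiag (\row_j (a 0 j * a 0 j)).
  rewrite gE /Q trmx_mul map_mxM !mulmxA.
  rewrite -(mulmxA (perm_mx p)) (unitarymxP UQ0) mulmx1.
  rewrite -(mulmxA _ Q0) (unitarymxP UQ0) mulmx1.
  rewrite tr_perm_mx map_perm_mx -row_permE -[p]invgK -col_permE.
  apply/matrixP => i j; rewrite !mxE !invgK (inj_eq perm_inj).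
  case: eqP => [->|] //; rewrite !mulr1n aE.
  by rewrite -expr2 sqr_sqrtr // ltW.
clearbody Q; pose P := g *m Q ^t* *m rdiag (\row_j (a 0 j)^-1).
have PP : P ^t* *m P = 1%:M.
  rewrite /P !adjM rdiag_adj trmxCK; rewrite -!mulmxA (mulmxA (g ^t*)) (mulmxA _ (Q ^t*)) (mulmxA Q).
  rewrite (mulmxA Q) QgQ !rdiagM -rdiag1; congr rdiag; apply/rowP => j; rewrite !mxE.
  by field; rewrite gt_eqF.
have a'a : rdiag (\row_j (a 0 j)^-1) *m rdiag a = 1%:M.
  rewrite rdiagM -rdiag1; congr rdiag; apply/rowP => j.
  by rewrite !mxE mulVf // gt_eqF.
exists P, Q, a; split.
- by apply/unitarymxP; exact: mulmx1C.
- exact: UQ.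
- by rewrite /P -(mulmxA (g *m _)) a'a mulmx1 -mulmxA unitarymx_mulVmx // mulmx1.
- by split.
- exact: akappa.
Qed.

Lemma re_mxtraceB n (A B : 'M[C]_n) : re (\tr (A - B)) = re (\tr A) - re (\tr B).
Proof. by rewrite [\tr _]raddfB raddfB. Qed.

End Norm.

(** * Jensen inequality and balanced families *)

Section Jensen.
Variables (R : realType) (C : complexModel R).
Local Notation "x %:C" := (model_cplx C x).
Local Notation re := (model_re C).
Local Notation rdiag := (@rdiag R C _).

Lemma ln_le_subr1 (x : R) : 0 < x -> ln x <= x - 1.
Proof.
by move=> x0; have := expR_ge1Dx (ln x); rewrite lnK // addrC lerBrDr.
Qed.

Lemma ln_eq_subr1 (x : R) : 0 < x -> x - 1 <= ln x -> x = 1.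
Proof.
move=> x0; rewrite lerBlDl => le; apply/eqP; rewrite -ln_eq0 //.
apply: contraTT le => lnx; rewrite -ltNge.
by have := expR_gt1Dx lnx; rewrite lnK.
Qed.

Lemma ln_prod (I : finType) (P : pred I) (F : I -> R) : (forall i, 0 < F i) ->
  ln (\prod_(i | P i) F i) = \sum_(i | P i) ln (F i).
Proof.
move=> F0; suff [] : 0 < \prod_(i | P i) F i /\
  ln (\prod_(i | P i) F i) = \sum_(i | P i) ln (F i) by [].
elim/big_rec2: _ => [|i y x _ [x0 xE]]; first by rewrite ln1.
by rewrite mulr_gt0 // lnM ?posrE // xE.
Qed.

(** Apply ln x <= x - 1 to x = a k / c and average; equality at x holds only
    for x = 1. *)
Lemma ln_sum_jensen n (w a : 'I_n -> R) : (forall k, 0 <= w k) ->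
  \sum_k w k = 1 -> (forall k, 0 < a k) ->
  let c := \sum_k a k * w k in
  [/\ 0 < c, \sum_k ln (a k) * w k <= ln c &
    ln c <= \sum_k ln (a k) * w k -> forall k, w k != 0 -> a k = c].
Proof.
move=> w0 w1 a0 c.
have c0 : 0 < c.
  rewrite lt_def sumr_ge0 ?andbT; last by move=> k _; rewrite mulr_ge0 // ltW.
  rewrite psumr_eq0; last by move=> k _; rewrite mulr_ge0 // ltW.
  apply/negP => /allP aw; move: w1; rewrite big1 => [/eqP|k _].
    by rewrite eq_sym oner_eq0.
  have := aw k; rewrite mem_index_enum => /(_ isT); rewrite mulf_eq0 gt_eqF //=.
  by move/eqP.
have sE : \sum_k ln (a k / c) * w k = \sum_k ln (a k) * w k - ln c.
  rewrite -[ln c]mulr1 -w1 mulr_sumr -sumrB; apply: eq_bigr => k _.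
  by rewrite ln_div ?posrE // mulrBl.
have s0 : \sum_k (a k / c - 1) * w k = 0.
  rewrite (eq_bigr (fun k => (a k * w k) / c - w k)) => [|k _]; last by ring.
  by rewrite sumrB -mulr_suml -/c divff ?gt_eqF // w1 subrr.
have le k : ln (a k / c) * w k <= (a k / c - 1) * w k.
  by rewrite ler_wpM2r // ln_le_subr1 // divr_gt0.
split => //; first by rewrite -subr_le0 -sE -[leRHS]s0 ler_sum.
rewrite -subr_ge0 -sE => sum_ge0 k wk.
have : \sum_k ((a k / c - 1) * w k - ln (a k / c) * w k) = 0.
  apply/eqP; rewrite eq_le sumr_ge0 ?andbT; last by move=> l _; rewrite subr_ge0.
  by rewrite sumrB s0 sub0r oppr_le0.
move/eqP; rewrite psumr_eq0 => [/allP/(_ k)|l _]; last by rewrite subr_ge0.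
rewrite mem_index_enum => /(_ isT); rewrite -mulrBl mulf_eq0 (negbTE wk) orbF.
rewrite subr_eq0 => /eqP eqk; have : a k / c = 1.
  by apply: ln_eq_subr1; [exact: divr_gt0 | rewrite eqk].
by move/(congr1 ( *%R^~ c)); rewrite mul1r divfK // gt_eqF.
Qed.

(** If Z diagonalises the compression of G = V diag(a) V^* to the orthonormal
    rows Y into diag(c), each c i is an average of the a k with the weights |U
    i k|^2 for U = Z Y V. So the Jensen inequalities of the rows of U add up
    to a bound of the trace t of the compressed logarithm by the ln det of the
    compression. When it is an equality, U intertwines diag(a) with diag(c),
    which makes the span of Y invariant under G. *)
Lemma ln_compression r n (Y : 'M[C]_(r, n)) (V : 'M[C]_n) (X : 'M[C]_r)
    (a : 'rV[R]_n) :
  Y \is unitarymx -> V \is unitarymx -> X \in unitmx -> (forall k, 0 < a 0 k) ->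
  Y *m (V *m rdiag a *m V ^t*) *m Y ^t* = X *m X ^t* ->
  let t := re (\tr (Y *m (V *m rdiag (map_mx (@ln R) a) *m V ^t*) *m Y ^t*)) in
  t <= 2 * ln (cabs (\det X)) /\
  (2 * ln (cabs (\det X)) <= t -> (Y *m (V *m rdiag a *m V ^t*) <= Y)%MS).
Proof.
move=> UY UV Xu a0 YX t.
have [Z [c [UZ c0 XX]]] := spectral_posdef Xu.
pose U := Z *m Y *m V.
have UU : U \is unitarymx.
  by apply: mul_unitarymx; [apply: mul_unitarymx; [exact: UZ|exact: UY]|exact: UV].
have UcU (b : 'rV[R]_n) :
    U *m rdiag b *m U ^t* = Z *m (Y *m (V *m rdiag b *m V ^t*) *m Y ^t*) *m Z ^t*.
  by rewrite /U !adjM !mulmxA.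
have UaU : U *m rdiag a *m U ^t* = rdiag c.
  rewrite UcU YX XX !mulmxA (unitarymxP UZ) mul1mx -mulmxA (unitarymxP UZ).
  by rewrite mulmx1.
have cE i : c 0 i = \sum_k a 0 k * cabs (U i k) ^+ 2.
  apply: (@cplx_inj R C); rewrite -(conj_rdiagE U) UaU rdiagE eqxx //.
have tE : t = \sum_i \sum_k ln (a 0 k) * cabs (U i k) ^+ 2.
  rewrite /t.
  have -> (A : 'M[C]_r) : \tr A = \tr (Z *m A *m Z ^t*).
    by rewrite -mulmxA mxtrace_mulC -mulmxA unitarymx_mulVmx // mulmx1.
  rewrite -UcU /mxtrace raddf_sum; apply: eq_bigr => i _.
  by rewrite conj_rdiagE /= cplxK; apply: eq_bigr => k _; rewrite mxE.
(* X *m X^* and diag(c) are unitarily equivalent *)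
have detE : 2 * ln (cabs (\det X)) = \sum_i ln (c 0 i).
  have detX : \det X != 0 by rewrite -unitfE -unitmxE.
  have cd0 : 0 < cabs (\det X) by rewrite lt_def cabs_eq0 detX cabs_ge0.
  rewrite mulr_natl -lnXn //.
  have -> : cabs (\det X) ^+ 2 = \prod_i c 0 i.
    apply: (@cplx_inj R C); rewrite rmorph_prod rmorphXn /= cabsE normCK.
    have -> : \det X * (\det X)^*%R = \det (X *m X ^t*).
      by rewrite det_mulmx det_map_mx det_tr.
    rewrite XX !det_mulmx mulrAC -det_mulmx unitarymx_mulVmx // det1 mul1r.
    by rewrite det_diag; apply: eq_bigr => i _; rewrite mxE.
  by rewrite ln_prod // => i _; exact: c0.
have jensen i := ln_sum_jensen (fun k => sqr_ge0 (cabs (U i k)))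
  (unitarymx_row_sum i UU) a0.
have le i : \sum_k ln (a 0 k) * cabs (U i k) ^+ 2 <= ln (c 0 i).
  by have [_ + _] := jensen i; rewrite -cE.
rewrite detE tE; split; first exact: ler_sum.
move=> ge; have Ua : U *m rdiag a = rdiag c *m U.
  apply/matrixP => i k; rewrite mul_mx_diag mul_diag_mx [LHS]mxE [RHS]mxE ![map_mx _ _ _ _]mxE mulrC.
  have [->|Uik] := eqVneq (U i k) 0; first by rewrite !mulr0.
  congr (_%:C * _); have [_ _ ] := jensen i; rewrite -cE; apply; last first.
    by rewrite sqrf_eq0 cabs_eq0.
  have /eqP : \sum_j (ln (c 0 j) - \sum_k ln (a 0 k) * cabs (U j k) ^+ 2) = 0.
    apply/eqP; rewrite eq_le sumr_ge0 ?andbT; last by move=> j _; rewrite subr_ge0.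
    by rewrite sumrB subr_le0.
  rewrite psumr_eq0 => [/allP/(_ i)|j _]; last by rewrite subr_ge0.
  by rewrite mem_index_enum => /(_ isT); rewrite subr_eq0 => /eqP ->.
have -> : Y *m (V *m rdiag a *m V ^t*) = Z ^t* *m (U *m rdiag a) *m V ^t*.
  by rewrite /U !mulmxA (unitarymx_mulVmx UZ) mul1mx.
have -> : Z ^t* *m (U *m rdiag a) *m V ^t* = Z ^t* *m rdiag c *m Z *m Y.
  by rewrite Ua /U !mulmxA -(mulmxA _ V) (unitarymxP UV) mulmx1.
exact: submxMl.
Qed.

(** For matrices P i diag(a i) Q i in singular value form, the last equation
    is the vanishing of a moment map: the left-hand side is the sum of the ln
    |g^*|, and the right-hand side the sum of the ln |g|, where |x| is the
    positive square root of x^* x. *)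
Definition balanced (I : finType) n (P Q : I -> 'M[C]_n) (a : I -> 'rV[R]_n) :=
  [/\ forall i, P i \is unitarymx, forall i, Q i \is unitarymx,
    forall i k, 0 < a i 0 k &
    \sum_i P i *m rdiag (map_mx (@ln R) (a i)) *m (P i) ^t* =
    \sum_i (Q i) ^t* *m rdiag (map_mx (@ln R) (a i)) *m Q i].

(** Let the rows of Y be an orthonormal basis of W, and X i the matrix of M i
    on W. The bound of ln_compression for M i (M i)^* is D i = ln |det X i|^2,
    and for N i (N i)^*, where N i is the inverse of M i, it is - D i.
    Balancedness says that the left-hand sides of all these inequalities add
    up to 0, as do the right-hand sides, so each is an equality. Hence W is
    invariant under M i (M i)^*, and, M i being invertible on W, under (M
    i)^*. *)
Lemma balanced_stable_adj (I : finType) n (P Q : I -> 'M[C]_n) (a : I -> 'rV[R]_n)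
    (W : 'M[C]_n) (M := fun i => P i *m rdiag (a i) *m Q i) :
  balanced P Q a ->
  (forall i, (W *m M i <= W)%MS) -> forall i, (W *m (M i) ^t* <= W)%MS.
Proof.
move=> [UP UQ a0 bal] WM.
pose Y := schmidt (row_base W).
have UY : Y \is unitarymx by apply: schmidt_unitarymx; exact: rank_leq_col.
have YW : (Y :=: W)%MS.
  by apply: eqmx_trans (eq_row_base _); exact/eqmx_schmidt_free/row_base_free.
have Yfree : row_free Y by rewrite /row_free mxrank_unitary.
clearbody Y; move: (\rank W) Y UY YW Yfree => r Y UY YW Yfree.
have /choice[X XE] : forall i, exists X, Y *m M i = X *m Y.
  by move=> i; apply/submxP; rewrite (eqmxMr _ YW) YW.
pose b i := \row_k (a i 0 k)^-1.
pose N i := (Q i) ^t* *m rdiag (b i) *m (P i) ^t*.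
have ab i : rdiag (a i) *m rdiag (b i) = 1%:M.
  rewrite rdiagM -rdiag1; congr rdiag; apply/rowP => k.
  by rewrite !mxE mulfV // gt_eqF.
have MN i : M i *m N i = 1%:M.
  rewrite /M /N -!mulmxA (mulmxA (Q i)) (unitarymxP (UQ i)) mul1mx.
  by rewrite (mulmxA (rdiag _)) ab mul1mx (unitarymxP (UP i)).
pose sq (c : 'rV[R]_n) := \row_k (c 0 k ^+ 2).
have sq_gt0 (c : 'rV[R]_n) : (forall k, 0 < c 0 k) -> forall k, 0 < sq c 0 k.
  by move=> c0 k; rewrite mxE exprn_gt0.
have rsq c : rdiag c *m rdiag c = rdiag (sq c).
  by rewrite rdiagM; congr rdiag; apply/rowP => k; rewrite !mxE expr2.
have b0 i k : 0 < b i 0 k by rewrite mxE invr_gt0.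
have MM i : M i *m (M i) ^t* = P i *m rdiag (sq (a i)) *m (P i) ^t*.
  rewrite /M !adjM rdiag_adj -!mulmxA (mulmxA (Q i)) (unitarymxP (UQ i)) mul1mx.
  by rewrite (mulmxA (rdiag _)) rsq.
have NN i : N i *m (N i) ^t* = (Q i) ^t* *m rdiag (sq (b i)) *m ((Q i) ^t*) ^t*.
  rewrite /N !adjM rdiag_adj trmxCK -!mulmxA (mulmxA ((P i) ^t*)).
  by rewrite (unitarymx_mulVmx (UP i)) mul1mx (mulmxA (rdiag _)) rsq.
clearbody M N.
have Xu i : X i \in unitmx.
  rewrite -row_free_unit; apply/row_freeP; exists (Y *m N i *m Y ^t*).
  by rewrite !mulmxA -XE -(mulmxA Y) MN mulmx1 (unitarymxP UY).
have XN i : Y *m N i = invmx (X i) *m Y.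
  by apply: (can_inj (mulKmx (Xu i))); rewrite mulKVmx // mulmxA -XE -mulmxA MN mulmx1.
have XX i : Y *m (M i *m (M i) ^t*) *m Y ^t* = X i *m (X i) ^t*.
  have -> : Y *m (M i *m (M i) ^t*) *m Y ^t* = (Y *m M i) *m (Y *m M i) ^t*.
    by rewrite adjM !mulmxA.
  by rewrite XE adjM !mulmxA -(mulmxA (X i)) (unitarymxP UY) mulmx1.
have XNX i : Y *m (N i *m (N i) ^t*) *m Y ^t* = invmx (X i) *m (invmx (X i)) ^t*.
  have -> : Y *m (N i *m (N i) ^t*) *m Y ^t* = (Y *m N i) *m (Y *m N i) ^t*.
    by rewrite adjM !mulmxA.
  by rewrite XN adjM !mulmxA -(mulmxA (invmx (X i))) (unitarymxP UY) mulmx1.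
pose D i := 2 * ln (cabs (\det (X i))).
pose tP i := re (\tr (Y *m (P i *m rdiag (map_mx (@ln R) (sq (a i))) *m (P i) ^t*) *m Y ^t*)).
pose tQ i := re (\tr (Y *m ((Q i) ^t* *m rdiag (map_mx (@ln R) (sq (b i))) *m ((Q i) ^t*) ^t*) *m Y ^t*)).
have jM i : tP i <= D i /\ (D i <= tP i -> (Y *m (M i *m (M i) ^t*) <= Y)%MS).
  have XXi := XX i; rewrite MM in XXi *.
  exact: (ln_compression UY (UP i) (Xu i) (sq_gt0 _ (a0 i)) XXi).
have jN i : tQ i <= - D i.
  have UQ' : (Q i) ^t* \is unitarymx by rewrite trmxC_unitary.
  have Xu' : invmx (X i) \in unitmx by rewrite unitmx_inv.
  have XXi := XNX i; rewrite NN in XXi.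
  have [+ _] := ln_compression UY UQ' Xu' (sq_gt0 _ (b0 i)) XXi.
  have detX : 0 < cabs (\det (X i)).
    by rewrite lt_def cabs_eq0 cabs_ge0 -unitfE -unitmxE Xu.
  suff -> : cabs (\det (invmx (X i))) = (cabs (\det (X i)))^-1.
    by rewrite lnV ?posrE // mulrN.
  apply: (mulIf (lt0r_neq0 detX)); rewrite mulVf ?gt_eqF // -cabsM -det_mulmx.
  by rewrite mulVmx // det1 cabs1.
(* the logarithms of the squares of a i and of its inverse b i are 2 ln (a i)
   and - 2 ln (a i), so this is twice the equation of balancedness *)
have sum0 : \sum_i (tP i + tQ i) = 0.
  pose phi (A : 'M[C]_n) := re (\tr (Y *m A *m Y ^t*)).
  have phi_sum (F : I -> 'M[C]_n) : \sum_i phi (F i) = phi (\sum_i F i).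
    by rewrite /phi mulmx_sumr mulmx_suml (raddf_sum (@mxtrace C r)) (raddf_sum re).
  have phiZ (x : R) A : phi (x%:C *: A) = x * phi A.
    by rewrite /phi -scalemxAr -scalemxAl mxtraceZ re_cplxM.
  have rdiagZ (x : R) (c : 'rV[R]_n) : rdiag (x *: c) = x%:C *: rdiag c.
    by apply/matrixP => k l; rewrite rdiagE [RHS]mxE rdiagE mxE rmorphM mulrnAr.
  have tPE i : tP i = 2 * phi (P i *m rdiag (map_mx (@ln R) (a i)) *m (P i) ^t*).
    rewrite -phiZ /tP -/(phi _); congr phi.
    have -> : map_mx (@ln R) (sq (a i)) = 2 *: map_mx (@ln R) (a i).
      by apply/rowP => k; rewrite !mxE lnXn // mulr_natl.
    by rewrite rdiagZ -scalemxAr -scalemxAl.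
  have tQE i : tQ i = - 2 * phi ((Q i) ^t* *m rdiag (map_mx (@ln R) (a i)) *m Q i).
    rewrite -phiZ /tQ -/(phi _); congr phi.
    have -> : map_mx (@ln R) (sq (b i)) = - 2 *: map_mx (@ln R) (a i).
      apply/rowP => k; rewrite !mxE exprVn lnV ?posrE ?exprn_gt0 //.
      by rewrite lnXn // mulNr mulr_natl.
    by rewrite rdiagZ trmxCK -scalemxAr -scalemxAl.
  clear - bal phi_sum tPE tQE; clearbody tP tQ phi.
  have -> : \sum_i (tP i + tQ i) = \sum_i tP i + \sum_i tQ i by exact: big_split.
  rewrite (eq_bigr _ (fun i _ => tPE i)) (eq_bigr _ (fun i _ => tQE i)).
  by rewrite -!mulr_sumr !phi_sum bal mulNr subrr.
clearbody D tP tQ.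
have tE i : D i <= tP i.
  have /eqP : \sum_i (- (tP i + tQ i)) = 0 by rewrite sumrN sum0 oppr0.
  have le i' : tP i' + tQ i' <= 0.
    by rewrite -(subrr (D i')) lerD //; case: (jM i').
  rewrite psumr_eq0 => [/allP/(_ i)|j _]; last by rewrite oppr_ge0.
  rewrite mem_index_enum => /(_ isT); rewrite oppr_eq0 addr_eq0 => /eqP ->.
  by rewrite lerNr.
move=> i; have /submxP[Z ZE] := (jM i).2 (tE i).
rewrite -(eqmxMr _ YW) -YW.
have -> : Y *m (M i) ^t* = invmx (X i) *m Z *m Y.
  by rewrite -[RHS]mulmxA -ZE (mulmxA Y) XE !mulmxA (mulVmx (Xu i)) mul1mx.
exact: submxMl.
Qed.
End Jensen.

(** * First variation of the singular values under conjugation *)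

Section Variation.
Variables (R : realType) (C : complexModel R).
Local Notation "x %:C" := (model_cplx C x).
Local Notation re := (model_re C).
Local Notation rdiag := (@rdiag R C _).

(** With x = ln a - ln b one has ln a ^ 2 = ln b ^ 2 + 2 x ln b + x ^ 2, where
    x lies below (a - b) / b, within (a - b)^2 / (b e) of it. So ln^2 lies
    below its tangent at b plus a quadratic term, uniformly for a >= e. *)
Lemma sqr_ln_semiconcave (e a b : R) : 0 < e -> 0 < b -> e <= a ->
  ln a ^+ 2 <= ln b ^+ 2 + 2 * ln b / b * (a - b)
    + (e ^- 2 + b ^- 2 + 2 * `|ln b| / (b * e)) * (a - b) ^+ 2.
Proof.
move=> e0 b0 ea; have a0 : 0 < a by exact: lt_le_trans ea.
pose x := ln a - ln b.
have xle : x <= (a - b) / b.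
  rewrite /x -ln_div ?posrE // (le_trans (ln_le_subr1 _)) ?divr_gt0 //.
  by rewrite mulrBl divff ?gt_eqF.
have xge : - x <= (b - a) / a.
  rewrite /x opprB -ln_div ?posrE // (le_trans (ln_le_subr1 _)) ?divr_gt0 //.
  by rewrite mulrBl divff ?gt_eqF.
have x2 : x ^+ 2 <= (e ^- 2 + b ^- 2) * (a - b) ^+ 2.
  have [x0|x0] := leP 0 x.
    apply: (@le_trans _ _ (((a - b) / b) ^+ 2)).
      by rewrite ler_pXn2r // nnegrE // (le_trans x0).
    rewrite expr_div_n mulrC ler_wpM2r ?sqr_ge0 // lerDr.
    by rewrite invr_ge0 sqr_ge0.
  apply: (@le_trans _ _ (((b - a) / a) ^+ 2)).
    by rewrite -sqrrN ler_pXn2r // nnegrE ?oppr_ge0 ?(ltW x0) // (le_trans _ xge) // oppr_ge0 ltW.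
  rewrite expr_div_n -sqrrN opprB mulrC ler_wpM2r ?sqr_ge0 //.
  rewrite (@le_trans _ _ (e ^- 2)) // ?lerDl ?invr_ge0 ?sqr_ge0 //.
  by rewrite lef_pV2 ?posrE ?exprn_gt0 // ler_pXn2r ?nnegrE ?(ltW e0) ?(ltW a0).
have y0 : 0 <= (a - b) / b - x by rewrite subr_ge0.
have y1 : (a - b) / b - x <= (a - b) ^+ 2 / (b * e).
  apply: (@le_trans _ _ ((a - b) ^+ 2 / (b * a))).
    have -> : (a - b) ^+ 2 / (b * a) = (a - b) / b + (b - a) / a.
      by field; rewrite !gt_eqF.
    by rewrite lerD2l.
  rewrite ler_wpM2l ?sqr_ge0 // lef_pV2 ?posrE ?mulr_gt0 //.
  by rewrite ler_wpM2l // ltW.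
have := ler_norm (- ln b); rewrite normrN => lnb.
have step : - ln b * ((a - b) / b - x) <= `|ln b| * ((a - b) ^+ 2 / (b * e)).
  apply: le_trans (ler_wpM2r y0 lnb) _; exact: ler_wpM2l.
set z := (a - b) / b in y0 y1 step; set w := (_ + _) * _ in x2.
set v := (b * e)^-1 in y1 step.
have -> : ln b ^+ 2 + 2 * ln b / b * (a - b)
    + (e ^- 2 + b ^- 2 + 2 * `|ln b| / (b * e)) * (a - b) ^+ 2
  = ln b ^+ 2 + 2 * ln b * z + w + 2 * (`|ln b| * ((a - b) ^+ 2 * v)).
  by rewrite /z /w /v; ring.
have -> : ln a = ln b + x by rewrite /x; ring.
move: x2 step; clear; clearbody w v z x; rewrite mulrBr !mulNr opprK.
have -> : (ln b + x) ^+ 2 = ln b ^+ 2 + 2 * (ln b * x) + x ^+ 2 by ring.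
rewrite -[2 * ln b * z]mulrA; move: (ln b * z) (ln b * x) => p q; lra.
Qed.

Lemma mxtrace_rdiag2 n (U V : 'M[C]_n) (p q : 'rV[R]_n) :
  \tr ((U ^t* *m rdiag p *m U) *m (V ^t* *m rdiag q *m V)) =
  (\sum_i \sum_k p 0 i * q 0 k * cabs ((U *m V ^t*) i k) ^+ 2)%:C.
Proof.
rewrite [RHS](_ : _ = \tr (rdiag p *m (U *m V ^t* *m rdiag q *m (U *m V ^t*) ^t*))).
  rewrite adjM trmxCK; move: (rdiag p) (rdiag q) (U ^t*) (V ^t*) => D E U' V'.
  by rewrite -!mulmxA mxtrace_mulC !mulmxA.
rewrite /mxtrace rmorph_sum; apply: eq_bigr => i _.
rewrite mul_diag_mx [RHS]mxE conj_rdiagE mxE -rmorphM mulr_sumr.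
by congr (_%:C); apply: eq_bigr => k _; rewrite mulrA.
Qed.

(** The scalar inequality of sqr_ln_semiconcave is averaged with the doubly
    stochastic weights given by the squared moduli of the entries of U V^*:
    all traces of products of A', A and X become sums with these weights, and
    no perturbation theory of eigenvalues is needed. *)
Lemma spectral_sqr_ln_le n (U V : 'M[C]_n) (b c : 'rV[R]_n) (e K : R)
  (A := V ^t* *m rdiag b *m V) (A' := U ^t* *m rdiag c *m U)
  (X := V ^t* *m rdiag (\row_k (2 * ln (b 0 k) / b 0 k)) *m V) :
  U \is unitarymx -> V \is unitarymx -> 0 < e ->
  (forall k, 0 < b 0 k) -> (forall i, e <= c 0 i) ->
  (forall k, e ^- 2 + b 0 k ^- 2 + 2 * `|ln (b 0 k)| / (b 0 k * e) <= K) ->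
  \sum_i ln (c 0 i) ^+ 2 <= \sum_k ln (b 0 k) ^+ 2
    + re (\tr ((A' - A) *m X))
    + K * re (\tr ((A' - A) *m (A' - A))).
Proof.
move=> UU UV e0 b0 ce bK.
pose w i k := cabs ((U *m V ^t*) i k) ^+ 2.
have UVU : U *m V ^t* \is unitarymx by rewrite mul_unitarymx // trmxC_unitary.
have w0 i k : 0 <= w i k by exact: sqr_ge0.
have wr i : \sum_k w i k = 1 by exact: unitarymx_row_sum.
have wc k : \sum_i w i k = 1.
  have : (U *m V ^t*) ^t* \is unitarymx by rewrite trmxC_unitary.
  move=> /(unitarymx_row_sum k) <-; apply: eq_bigr => i _.
  by rewrite adjE cabs_conj.
have trE p q (B := U ^t* *m rdiag p *m U) (B' := V ^t* *m rdiag q *m V) :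
    re (\tr (B *m B')) = \sum_i \sum_k p 0 i * q 0 k * w i k.
  by rewrite /B /B' mxtrace_rdiag2 cplxK.
have trV p q (B := V ^t* *m rdiag p *m V) (B' := V ^t* *m rdiag q *m V) :
    re (\tr (B *m B')) = \sum_i \sum_k p 0 k * q 0 k * w i k.
  have -> : B *m B' = V ^t* *m rdiag (\row_k (p 0 k * q 0 k)) *m V.
    by rewrite -rdiagM /B /B' -!mulmxA (mulmxA V) (unitarymxP UV) mul1mx.
  rewrite exchange_big mxtrace_mulC mulmxA (unitarymxP UV) mul1mx raddf_sum.
  apply: eq_bigr => k _; rewrite rdiagE eqxx mxE mulr1n cplxK /= -mulr_sumr wc mulr1 //.
have trU p q (B := U ^t* *m rdiag p *m U) (B' := U ^t* *m rdiag q *m U) :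
    re (\tr (B *m B')) = \sum_i \sum_k p 0 i * q 0 i * w i k.
  have -> : B *m B' = U ^t* *m rdiag (\row_k (p 0 k * q 0 k)) *m U.
    by rewrite -rdiagM /B /B' -!mulmxA (mulmxA U) (unitarymxP UU) mul1mx.
  rewrite mxtrace_mulC mulmxA (unitarymxP UU) mul1mx raddf_sum.
  by apply: eq_bigr => i _; rewrite rdiagE eqxx mxE mulr1n cplxK -mulr_sumr wr mulr1.
have -> : re (\tr ((A' - A) *m X)) =
    \sum_i \sum_k (c 0 i - b 0 k) * (2 * ln (b 0 k) / b 0 k) * w i k.
  rewrite mulmxBl re_mxtraceB trE trV -sumrB; apply: eq_bigr => i _.
  by rewrite -sumrB; apply: eq_bigr => k _; rewrite mxE; ring.
have -> : re (\tr ((A' - A) *m (A' - A))) =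
    \sum_i \sum_k (c 0 i - b 0 k) ^+ 2 * w i k.
  have AA' : \tr (A *m A') = \tr (A' *m A) by exact: mxtrace_mulC.
  rewrite mulmxBl !mulmxBr !re_mxtraceB AA' trU trE trV.
  rewrite -!sumrB; apply: eq_bigr => i _.
  by rewrite -!sumrB; apply: eq_bigr => k _; ring.
have -> : \sum_i ln (c 0 i) ^+ 2 = \sum_i \sum_k ln (c 0 i) ^+ 2 * w i k.
  by apply: eq_bigr => i _; rewrite -mulr_sumr wr mulr1.
have -> : \sum_k ln (b 0 k) ^+ 2 = \sum_i \sum_k ln (b 0 k) ^+ 2 * w i k.
  by rewrite exchange_big; apply: eq_bigr => i _; rewrite -mulr_sumr wc mulr1.
rewrite mulr_sumr -!big_split; apply: ler_sum => i _ /=.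
rewrite mulr_sumr -!big_split; apply: ler_sum => k _ /=.
have -> : ln (b 0 k) ^+ 2 * w i k + (c 0 i - b 0 k) * (2 * ln (b 0 k) / b 0 k) * w i k
    + K * ((c 0 i - b 0 k) ^+ 2 * w i k) = (ln (b 0 k) ^+ 2
    + 2 * ln (b 0 k) / b 0 k * (c 0 i - b 0 k) + K * (c 0 i - b 0 k) ^+ 2) * w i k.
  by ring.
rewrite ler_wpM2r //; apply: le_trans (sqr_ln_semiconcave e0 (b0 k) (ce i)) _.
by rewrite lerD2l ler_wpM2r // sqr_ge0.
Qed.

Definition mxbounded (T : set R) m n (F : R -> 'M[C]_(m, n)) :=
  exists B, forall t, T t -> mxsize (F t) <= B.

Lemma mxbounded_cst T m n (A : 'M[C]_(m, n)) : mxbounded T (fun=> A).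
Proof. by exists (mxsize A). Qed.

Lemma mxboundedD T m n (F G : R -> 'M[C]_(m, n)) :
  mxbounded T F -> mxbounded T G -> mxbounded T (fun t => F t + G t).
Proof.
move=> [B FB] [B' GB]; exists (B + B') => t Tt.
by rewrite (le_trans (mxsizeD _ _)) // lerD ?FB ?GB.
Qed.

Lemma mxboundedN T m n (F : R -> 'M[C]_(m, n)) :
  mxbounded T F -> mxbounded T (fun t => - F t).
Proof. by move=> [B FB]; exists B => t Tt; rewrite mxsizeN FB. Qed.

Lemma mxboundedM T m n p (F : R -> 'M[C]_(m, n)) (G : R -> 'M[C]_(n, p)) :
  mxbounded T F -> mxbounded T G -> mxbounded T (fun t => F t *m G t).
Proof.
move=> [B FB] [B' GB]; exists (B * B') => t Tt.
by rewrite (le_trans (mxsizeM _ _)) // ler_pM ?mxsize_ge0 ?FB ?GB.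
Qed.

(** For |t| small, v |-> t v s at least halves the size. So v + t v s = 0 only
    for v = 0, and the inverse k, which satisfies k = 1 - t k s, has at most
    twice the size of 1. *)
Lemma resolvent_bounded n (s : 'M[C]_n) : exists t0 : R, [/\ 0 < t0, t0 <= 1,
  forall t, `|t| <= t0 -> 1%:M + t%:C *: s \in unitmx &
  mxbounded [set t | `|t| <= t0] (fun t => invmx (1%:M + t%:C *: s))].
Proof.
have S0 := mxsize_ge0 s; pose t0 := (2 * (1 + mxsize s))^-1.
have t0_gt0 : 0 < t0 by rewrite invr_gt0; lra.
have t0s : t0 * mxsize s <= 2^-1.
  by rewrite /t0 ler_pdivrMl; lra.
have half t m (v : 'M[C]_(m, n)) : `|t| <= t0 ->
    mxsize (t%:C *: (v *m s)) <= 2^-1 * mxsize v.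
  move=> tt0; rewrite mxsizeZ cabs_real.
  apply: (@le_trans _ _ (t0 * (mxsize v * mxsize s))).
    by rewrite ler_pM ?mxsize_ge0 // mxsizeM.
  by rewrite mulrCA mulrC ler_wpM2r // mxsize_ge0.
have hu t : `|t| <= t0 -> 1%:M + t%:C *: s \in unitmx.
  move=> tt0; rewrite -row_free_unit -kermx_eq0; set K := kermx _.
  have : K *m (1%:M + t%:C *: s) = 0 by exact: mulmx_ker.
  rewrite mulmxDr mulmx1 -scalemxAr => /eqP; rewrite addr_eq0 => /eqP KE.
  have := half t _ K tt0; rewrite -mxsizeN -KE => le.
  apply/eqP/mxsize_eq0/eqP; rewrite eq_le mxsize_ge0 andbT; lra.
exists t0; split => //; first by rewrite invf_le1; lra.
exists (2 * mxsize (1%:M : 'M[C]_n)) => t /= tt0.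
have := half t _ (invmx (1%:M + t%:C *: s)) tt0; set k := invmx _ => le.
have kE : k = 1%:M - t%:C *: (k *m s).
  rewrite -(mulVmx (hu t tt0)) -/k mulmxDr mulmx1 -scalemxAr addrK //.
have := mxsizeB 1%:M (t%:C *: (k *m s)); rewrite -kE; lra.
Qed.

Lemma adj1D n (s : 'M[C]_n) (t : R) : s ^t* = s ->
  (1%:M + t%:C *: s) ^t* = 1%:M + t%:C *: s.
Proof.
move=> sH; rewrite -[in RHS]sH; apply/matrixP => i j; rewrite !mxE rmorphD rmorphM /=.
by rewrite rmorph_nat eq_sym conj_cplx.
Qed.

(** For hermitian h = 1 + u s with inverse k, the left-hand side is (h g k)^*
    (h g k) - g^* g. This is its Taylor expansion at u = 0 with an exact
    second order remainder, a polynomial in k that resolvent_bounded keeps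
    bounded. *)
Lemma conj_expansion n (g s k : 'M[C]_n) (u : C) (h := 1%:M + u *: s) :
  h *m k = 1%:M ->
  let A := g ^t* *m g in
  let B := g ^t* *m s *m g in
  k *m g ^t* *m h *m h *m g *m k - A =
  u *: (B + B - s *m A - A *m s
   + u *: (s *m (s *m k *m A *m k + A *m s *m k) + A *m s *m (s *m k)
     - (s *m k *m (B + B) *m k + (B + B) *m s *m k)
     + k *m (g ^t* *m s *m s *m g) *m k)).
Proof.
move=> hk A B.
have kE : k = 1%:M - u *: (s *m k).
  by rewrite -hk mulmxDl mul1mx -scalemxAl addrK.
have conjE Y : k *m Y *m k = Y - u *: (s *m k *m Y *m k + Y *m s *m k).
  rewrite {1}kE !mulmxBl mul1mx -!scalemxAl scalerDr opprD addrCA addrC.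
  congr (_ - _); rewrite {1}kE mulmxBr mulmx1 -scalemxAr mulmxA //.
have hh : k *m g ^t* *m h *m h *m g *m k =
    k *m A *m k + u *: (k *m (B + B) *m k)
    + u *: (u *: (k *m (g ^t* *m s *m s *m g) *m k)).
  have mulh (Y : 'M[C]_n) : Y *m h = Y + u *: (Y *m s).
    by rewrite /h mulmxDr mulmx1 -scalemxAr.
  have -> : k *m g ^t* *m h *m h *m g *m k = k *m (g ^t* *m h *m h *m g) *m k.
    by rewrite !mulmxA.
  have -> : g ^t* *m h *m h *m g = A + u *: (B + B) + u *: (u *: (g ^t* *m s *m s *m g)).
    rewrite !mulh !(mulmxDl, scalerDr, =^~ scalemxAl) -!addrA.
    by congr (_ + _); rewrite addrA.
  by rewrite !(mulmxDl, mulmxDr, =^~ scalemxAl, =^~ scalemxAr).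
have F1 : k *m A *m k = A - u *: (s *m (k *m A *m k) + A *m s *m k).
  by rewrite [LHS]conjE !mulmxA.
have F2 : s *m (k *m A *m k) = s *m A - u *: (s *m (s *m k *m A *m k + A *m s *m k)).
  by rewrite [in LHS]conjE mulmxBr -scalemxAr.
have F3 : A *m s *m k = A *m s - u *: (A *m s *m (s *m k)).
  by rewrite [in LHS]kE mulmxBr mulmx1 -scalemxAr.
rewrite hh F1 F2 (conjE (B + B)).
set r1 := s *m (_ + _); rewrite F3; set r2 := A *m s *m (s *m k).
set r3 := s *m k *m (B + B) *m k + _; set r4 := k *m _ *m k.
clearbody r1 r2 r3 r4 A B; clear.
by apply/matrixP => i j; rewrite !mxE; ring.
Qed.

(** The squares of the singular values are the eigenvalues of A = g^* g, and
    the sum of the squares of their logarithms is four times the sum of the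
    squares of kappa. So spectral_sqr_ln_le, applied to the expansion of A in
    conj_expansion, gives an upper bound with an error of order t^2, which is
    all that a minimum needs. The linear term is the trace of the first order
    part M0 of the expansion against X = 2 A^-1 ln A. *)
Lemma kappa_sq_variation n (g s P Q : 'M[C]_n) (a : 'rV[R]_n) :
  P \is unitarymx -> Q \is unitarymx -> (forall k, 0 < a 0 k) ->
  g = P *m rdiag a *m Q -> (forall k, kappaC g 0 k = ln (a 0 k)) ->
  s ^t* = s ->
  exists K t0 : R, 0 < t0 /\ forall t, `|t| <= t0 ->
    let h := 1%:M + t%:C *: s in
    h \in unitmx /\
    \sum_k kappaC (h *m g *m invmx h) 0 k ^+ 2 <= \sum_k kappaC g 0 k ^+ 2
      + 2 * t * re (\tr (s *m (P *m rdiag (map_mx (@ln R) a) *m P ^t*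
                                 - Q ^t* *m rdiag (map_mx (@ln R) a) *m Q)))
      + K * t ^+ 2.
Proof.
move=> UP UQ a0 gE ka sH.
have gu : g \in unitmx.
  suff ru : rdiag a \in unitmx by rewrite gE !unitmx_mul ru !unitarymx_unit.
  rewrite unitmxE det_diag unitfE; apply/prodf_neq0 => k _.
  by rewrite mxE -(rmorph0 (model_cplx C)) (inj_eq (@cplx_inj R C)) gt_eqF.
have [t0 [t0_gt0 t0_le1 hu kB]] := resolvent_bounded s.
pose T : set R := [set t | `|t| <= t0].
pose h t := 1%:M + t%:C *: s; pose k t := invmx (h t).
have TB (F : 'M[C]_n) : mxbounded T (fun=> F) by exact: mxbounded_cst.
have uB : mxbounded T (fun t => t%:C *: (1%:M : 'M[C]_n)).
  exists (mxsize (1%:M : 'M[C]_n)) => t Tt; rewrite mxsizeZ cabs_real.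
  by rewrite ler_piMl ?mxsize_ge0 // (le_trans Tt).
have hB : mxbounded T h.
  have hE : h = (fun t => 1%:M + (t%:C *: 1%:M) *m s).
    by apply: funext => t; rewrite -scalemxAl mul1mx.
  by rewrite hE; apply: mxboundedD => //; apply: mxboundedM.
have [Bi gtiB] : mxbounded T (fun t => h t *m invmx g *m k t).
  by apply: mxboundedM => //; apply: mxboundedM.
pose A := g ^t* *m g; pose B := g ^t* *m s *m g.
(* M0 and N t are the first order part and the remainder of conj_expansion *)
pose M0 := B + B - s *m A - A *m s.
pose N t := s *m (s *m k t *m A *m k t + A *m s *m k t) + A *m s *m (s *m k t)
     - (s *m k t *m (B + B) *m k t + (B + B) *m s *m k t)
     + k t *m (g ^t* *m s *m s *m g) *m k t.
have NB : mxbounded T N.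
  have skB := mxboundedM (TB s) kB.
  have kYkB Y := mxboundedM (mxboundedM skB (TB Y)) kB.
  have YskB Y := mxboundedM (TB (Y *m s)) kB.
  have r1B := mxboundedM (TB s) (mxboundedD (kYkB A) (YskB A)).
  have r2B := mxboundedM (TB (A *m s)) skB.
  have r3B := mxboundedD (kYkB (B + B)) (YskB (B + B)).
  have r4B := mxboundedM (mxboundedM kB (TB (g ^t* *m s *m s *m g))) kB.
  exact: mxboundedD (mxboundedD (mxboundedD r1B r2B) (mxboundedN r3B)) r4B.
pose b := \row_j (a 0 j ^+ 2); have b0 j : 0 < b 0 j by rewrite mxE exprn_gt0.
have AE : A = Q ^t* *m rdiag b *m Q.
  rewrite /A gE !adjM rdiag_adj -!mulmxA (mulmxA (P ^t*)) (unitarymx_mulVmx UP).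
  rewrite mul1mx (mulmxA (rdiag a)) rdiagM. have -> : \row_j (a 0 j * a 0 j) = b; last by [].
  by apply/rowP => j; rewrite /b !mxE.
pose X := Q ^t* *m rdiag (\row_j (2 * ln (b 0 j) / b 0 j)) *m Q.
pose L := rdiag (map_mx (@ln R) a).
have LE (c : 'rV[R]_n) : (forall j, c 0 j = 2 * ln (b 0 j)) -> rdiag c = 4%:R *: L.
  move=> cE; apply/matrixP => i j; rewrite rdiagE [RHS]mxE rdiagE cE.
  case: eqP => _; last by rewrite !mulr0n mulr0.
  rewrite !mulr1n /b !mxE lnXn // -(rmorph_nat (model_cplx C) 4) -rmorphM.
  by congr (_%:C); ring.
have QX : Q *m X *m Q ^t* = rdiag (\row_j (2 * ln (b 0 j) / b 0 j)).
  rewrite /X !mulmxA (unitarymxP UQ) mul1mx -mulmxA (unitarymxP UQ) mulmx1 //.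
have gXg : g *m X *m g ^t* = 4%:R *: (P *m L *m P ^t*).
  rewrite {1}gE [X in _ *m X ^t*]gE !adjM rdiag_adj.
  have -> : P *m rdiag a *m Q *m X *m (Q ^t* *m (rdiag a *m P ^t*)) =
     P *m (rdiag a *m (Q *m X *m Q ^t*) *m rdiag a) *m P ^t* by rewrite !mulmxA.
  rewrite QX !rdiagM (LE (\row_j _)) => [|j]; first by rewrite -scalemxAr -scalemxAl.
  by rewrite !mxE; field; rewrite gt_eqF.
have AX : A *m X = 4%:R *: (Q ^t* *m L *m Q).
  rewrite AE /X -!mulmxA (mulmxA Q) (unitarymxP UQ) mul1mx (mulmxA (rdiag _)) rdiagM.
  rewrite (LE (\row_j _)) => [|j]; first by rewrite -scalemxAl -scalemxAr.
  by rewrite !mxE; field; rewrite gt_eqF.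
have XA : X *m A = 4%:R *: (Q ^t* *m L *m Q).
  rewrite AE /X -!mulmxA (mulmxA Q) (unitarymxP UQ) mul1mx (mulmxA (rdiag _)) rdiagM.
  rewrite (LE (\row_j _)) => [|j]; first by rewrite -scalemxAl -scalemxAr.
  by rewrite !mxE; field; rewrite gt_eqF.
have XE : X = Q ^t* *m rdiag (\row_j (2 * ln (b 0 j) / b 0 j)) *m Q by [].
clearbody X; set tau := re (\tr (s *m (P *m _ *m _ - _))).
have M0X : re (\tr (M0 *m X)) = 8 * tau.
  have -> : \tr (M0 *m X) = (8%:R : R)%:C * \tr (s *m (P *m L *m P ^t* - Q ^t* *m L *m Q)).
    have tr3 (Y Z W : 'M[C]_n) : \tr (Y *m Z *m W) = \tr (Z *m (W *m Y)).
      by rewrite -mulmxA mxtrace_mulC mulmxA.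
    have trB : \tr (B *m X) = \tr (s *m (g *m X *m g ^t*)).
      have -> : B *m X = g ^t* *m s *m (g *m X) by rewrite mulmxA.
      exact: tr3.
    have trA : \tr (A *m s *m X) = \tr (s *m (X *m A)) by exact: tr3.
    have trD (Y Z : 'M[C]_n) : \tr (Y - Z) = \tr Y - \tr Z by exact: raddfB.
    rewrite /M0 !mulmxBl mulmxDl !trD mxtraceD trB trA -(mulmxA s) AX XA gXg.
    rewrite mulmxBr trD -!scalemxAr !mxtraceZ rmorph_nat.
    move: (\tr (s *m (P *m L *m P ^t*))) (\tr (s *m (Q ^t* *m L *m Q))) => x y.
    by ring.
  by rewrite re_cplxM.
have Bi0 : 0 <= Bi.
  apply: le_trans (gtiB 0 _); first exact: mxsize_ge0.
  by rewrite /T /= normr0 ltW.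
(* e1 bounds the singular values of all the conjugates from below, through the
   bound Bi on the sizes of their inverses *)
pose e1 := (1 + (n * n)%:R * Bi * (n * n)%:R)^-1.
have e1_gt0 : 0 < e1 by rewrite invr_gt0 ltr_pwDl // !mulr_ge0.
have e_gt0 : 0 < e1 ^+ 2 by rewrite exprn_gt0.
pose K1 := \sum_j (e1 ^+ 2 ^- 2 + b 0 j ^- 2 + 2 * `|ln (b 0 j)| / (b 0 j * e1 ^+ 2)).
have K1_ge0 j : 0 <= e1 ^+ 2 ^- 2 + b 0 j ^- 2 + 2 * `|ln (b 0 j)| / (b 0 j * e1 ^+ 2).
  by rewrite !addr_ge0 ?invr_ge0 ?sqr_ge0 // divr_ge0 ?mulr_ge0 // ltW.
have K1P j : e1 ^+ 2 ^- 2 + b 0 j ^- 2 + 2 * `|ln (b 0 j)| / (b 0 j * e1 ^+ 2) <= K1.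
  by rewrite /K1 (bigD1 j) //= lerDl sumr_ge0.
have [BN NBP] := NB.
have [BM MBP] : mxbounded T (fun t => (M0 + t%:C *: N t) *m (M0 + t%:C *: N t)).
  have MB : mxbounded T (fun t => M0 + t%:C *: N t).
    have -> : (fun t => M0 + t%:C *: N t) = (fun t => M0 + (t%:C *: 1%:M) *m N t).
      by apply: funext => t; rewrite -scalemxAl mul1mx.
    by apply: mxboundedD => //; exact: mxboundedM.
  exact: mxboundedM.
have NX t : T t -> `|re (\tr (N t *m X))| <= BN * mxsize X.
  move=> Tt; apply: le_trans (normr_re_le _) _; apply: le_trans (cabs_mxtrace_le _) _.
  by apply: le_trans (mxsizeM _ _) _; rewrite ler_wpM2r ?mxsize_ge0 // NBP.
have MM t : T t ->
    re (\tr ((M0 + t%:C *: N t) *m (M0 + t%:C *: N t))) <= BM.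
  move=> Tt; apply: le_trans (ler_norm _) _; apply: le_trans (normr_re_le _) _.
  by apply: le_trans (cabs_mxtrace_le _) _; exact: MBP.
have K1_ge0' : 0 <= K1 by exact: sumr_ge0.
exists ((BN * mxsize X + K1 * BM) / 4), t0; split=> // t Tt.
have htu := hu t Tt; split; first exact: htu.
pose gt := h t *m g *m k t.
have gtu : gt \in unitmx by rewrite /gt !unitmx_mul htu gu unitmx_inv.
have [P1 [Q1 [c [UP1 UQ1 gtE [c0 _] kc]]]] := singular_value_decomposition gtu.
have cge i : e1 <= c 0 i.
  have ci : 0 < c 0 i := c0 i.
  rewrite /e1 -[leRHS]invrK lef_pV2 ?posrE ?invr_gt0 //; last first.
    by rewrite ltr_pwDl // !mulr_ge0.
  have QP : Q1 *m (h t *m invmx g *m k t) *m P1 = rdiag (\row_j (c 0 j)^-1).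
    have gtV : gt *m (h t *m invmx g *m k t) = 1%:M.
      rewrite /gt !mulmxA -(mulmxA _ (k t)) (mulVmx htu) mulmx1 -(mulmxA _ g).
      by rewrite (mulmxV gu) mulmx1 (mulmxV htu).
    have cc : rdiag (\row_j (c 0 j)^-1) *m rdiag c = 1%:M.
      rewrite rdiagM -[RHS](rdiag1 C n); congr (rdiag _); apply/rowP => j.
      by rewrite !mxE mulVf // gt_eqF.
    have : rdiag c *m (Q1 *m (h t *m invmx g *m k t) *m P1) = 1%:M.
      move: (h t *m _ *m k t) gtV => Y gtV.
      transitivity (P1 ^t* *m (P1 *m rdiag c *m Q1 *m Y) *m P1).
        by rewrite !mulmxA (unitarymx_mulVmx UP1) mul1mx.
      by rewrite -gtE gtV mulmx1 (unitarymx_mulVmx UP1).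
    move/(congr1 (mulmx (rdiag (\row_j (c 0 j)^-1)))).
    by rewrite mulmxA cc mul1mx mulmx1.
  have := cabs_le_mxsize (Q1 *m (h t *m invmx g *m k t) *m P1) i i.
  rewrite {1}QP rdiagE eqxx mxE mulr1n cabs_real ger0_norm ?invr_ge0 ?(ltW ci) // => le.
  apply: le_trans le _; rewrite ler_wpDl //.
  apply: le_trans (mxsizeM _ _) _; rewrite ler_pM ?mxsize_ge0 ?mxsize_unitary //.
  apply: le_trans (mxsizeM _ _) _; rewrite ler_pM ?mxsize_ge0 ?mxsize_unitary //.
  exact: gtiB.
pose c2 := \row_j (c 0 j ^+ 2).
have c2ge i : e1 ^+ 2 <= c2 0 i.
  by rewrite mxE ler_pXn2r ?nnegrE ?(ltW e1_gt0) // ltW.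
have At : gt ^t* *m gt = Q1 ^t* *m rdiag c2 *m Q1.
  rewrite gtE !adjM rdiag_adj -!mulmxA (mulmxA (P1 ^t*)) (unitarymx_mulVmx UP1).
  rewrite mul1mx (mulmxA (rdiag c)) rdiagM.
  have -> : \row_j (c 0 j * c 0 j) = c2; last by [].
  by apply/rowP => j; rewrite /c2 !mxE.
have := spectral_sqr_ln_le UQ1 UQ e_gt0 b0 c2ge K1P.
rewrite -At -AE -XE.
have hk : h t *m k t = 1%:M by rewrite /k mulmxV.
have hH : (h t) ^t* = h t by exact: adj1D.
have kH : (k t) ^t* = k t.
  apply: (can_inj (mulKmx htu)); rewrite -/(h t) hk -[X in X *m _]hH -adjM.
  by rewrite /k mulVmx // trmx1 map_mx1.
have -> : gt ^t* *m gt - A = t%:C *: (M0 + t%:C *: N t).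
  rewrite /gt !adjM hH kH -(conj_expansion g hk) !mulmxA.
  by [].
have sum4 (c' : 'rV[R]_n) (f : 'I_n -> R) : (forall j, 0 < c' 0 j) ->
    (forall j, f j = ln (c' 0 j)) ->
    \sum_j ln ((\row_j (c' 0 j ^+ 2)) 0 j) ^+ 2 = 4 * \sum_j f j ^+ 2.
  move=> c'0 fE; rewrite mulr_sumr; apply: eq_bigr => j _.
  by rewrite mxE lnXn // fE; ring.
rewrite (sum4 c _ c0 kc) (sum4 a _ a0 ka) -!scalemxAl -scalemxAr !mxtraceZ.
rewrite !re_cplxM mulmxDl mxtraceD raddfD -scalemxAl mxtraceZ re_cplxM M0X.
have := NX t Tt; have := MM t Tt.
set x := \sum_k _; set y := \sum_k _; set m := re _; set p := re _ => mB.
rewrite ler_norml => /andP[_ pB] le.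
have t2 : 0 <= t ^+ 2 by exact: sqr_ge0.
have K1m : K1 * (t * (t * m)) <= K1 * BM * t ^+ 2.
  rewrite -[leLHS]/(K1 * (t * (t * m))) (_ : t * (t * m) = m * t ^+ 2); last by ring.
  by rewrite mulrA ler_wpM2r // ler_wpM2l.
have pt : t * (t * p) <= BN * mxsize X * t ^+ 2.
  by rewrite (_ : t * (t * p) = p * t ^+ 2) ?ler_wpM2r //; ring.
lra.
Qed.

End Variation.

(** * Continuity of the singular values *)

Section Continuity.
Variables (R : realType) (C : complexModel R).
Local Notation "x %:C" := (model_cplx C x).
Local Notation re := (model_re C).
Local Notation rdiag := (@rdiag R C _).

(** The constant c separates the entries in D, which are larger, from the
    others, so moving weight into D can only increase the sum. *)
Lemma weighted_sum_le n (a w : 'I_n -> R) (c : R) (D : pred 'I_n) :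
  (forall l, 0 <= w l <= 1) -> \sum_l w l = \sum_(l | D l) 1 ->
  (forall l, D l -> c <= a l) -> (forall l, ~~ D l -> a l <= c) ->
  \sum_l a l * w l <= \sum_(l | D l) a l.
Proof.
move=> w01 wsum Dge Dle.
have : 0 <= \sum_l ((D l)%:R - w l) * (a l - c).
  apply: sumr_ge0 => l _; have /andP[w0 w1] := w01 l.
  have [Dl|Dl] := boolP (D l); first by rewrite mulr_ge0 // subr_ge0 // Dge.
  by rewrite sub0r mulNr -mulrN opprB mulr_ge0 // subr_ge0 Dle.
have -> : \sum_l ((D l)%:R - w l) * (a l - c) =
    \sum_l (D l)%:R * a l - \sum_l a l * w l - c * (\sum_l (D l)%:R - \sum_l w l).
  rewrite mulrBr !mulr_sumr -!sumrB; apply: eq_bigr => l _; ring.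
have bigD (F : 'I_n -> R) : \sum_l (D l)%:R * F l = \sum_(l | D l) F l.
  by rewrite [RHS]big_mkcond; apply: eq_bigr => l _; case: (D l); rewrite ?mul1r ?mul0r.
rewrite bigD wsum -[\sum_l (D l)%:R](eq_bigr _ (fun l _ => mulr1 _)) bigD subrr.
by rewrite mulr0 subr0 subr_ge0.
Qed.

(** Ky Fan's principle. Compress both matrices to the rows of V with index in
    D, which are eigenvectors for b: the trace of the compression is the sum
    of the b j for the matrix of b, and a weighted sum of the a l for the
    matrix of a, which weighted_sum_le bounds by the sum over D. *)
Lemma sum_spectrum_le n (U V : 'M[C]_n) (a b : 'rV[R]_n) (c : R) (D : pred 'I_n) :
  U \is unitarymx -> V \is unitarymx ->
  (forall l, D l -> c <= a 0 l) -> (forall l, ~~ D l -> a 0 l <= c) ->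
  \sum_(j | D j) b 0 j - \sum_(j | D j) a 0 j <=
  ((n * n) ^ 2)%:R * mxsize (V ^t* *m rdiag b *m V - U ^t* *m rdiag a *m U).
Proof.
move=> UU UV Dge Dle; set A := U ^t* *m _ *m U; set B := V ^t* *m _ *m V.
pose w j l := cabs ((V *m U ^t*) j l) ^+ 2.
have VUU : V *m U ^t* \is unitarymx by rewrite mul_unitarymx // trmxC_unitary.
have w0 j l : 0 <= w j l by exact: sqr_ge0.
have wr j : \sum_l w j l = 1 by exact: unitarymx_row_sum.
have wc l : \sum_j w j l = 1.
  have : (V *m U ^t*) ^t* \is unitarymx by rewrite trmxC_unitary.
  by move=> /(unitarymx_row_sum l) <-; apply: eq_bigr => j _; rewrite adjE cabs_conj.
have VAV j : re ((V *m A *m V ^t*) j j) = \sum_l a 0 l * w j l.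
  have -> : V *m A *m V ^t* = (V *m U ^t*) *m rdiag a *m (V *m U ^t*) ^t*.
    by rewrite adjM trmxCK /A !mulmxA.
  by rewrite conj_rdiagE cplxK.
have VBV j : re ((V *m B *m V ^t*) j j) = b 0 j.
  have -> : V *m B *m V ^t* = rdiag b.
    rewrite /B !mulmxA (unitarymxP UV) mul1mx -mulmxA (unitarymxP UV) mulmx1 //.
  by rewrite rdiagE eqxx mulr1n cplxK.
clearbody A B.
pose p l := \sum_(j | D j) w j l.
have p01 l : 0 <= p l <= 1.
  rewrite sumr_ge0 //= -(wc l) [leRHS](bigID D) /= lerDl.
  by apply: sumr_ge0.
have psum : \sum_l p l = \sum_(l | D l) 1.
  by rewrite exchange_big; apply: eq_bigr => j _; exact: wr.
have key := weighted_sum_le p01 psum Dge Dle.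
apply: (@le_trans _ _ (\sum_(j | D j) re ((V *m (B - A) *m V ^t*) j j))).
  rewrite [leRHS](eq_bigr (fun j => b 0 j - \sum_l a 0 l * w j l)) => [|j _]; last first.
    rewrite mulmxBr mulmxBl -VAV -VBV -raddfB; congr (re _); rewrite [LHS]mxE.
    by congr (_ + _); rewrite mxE.
  rewrite sumrB lerD2l lerN2; apply: le_trans key; rewrite exchange_big.
  by apply: ler_sum => l _; rewrite mulr_sumr.
apply: (@le_trans _ _ (mxsize (V *m (B - A) *m V ^t*))).
  apply: (@le_trans _ _ (\sum_(j | D j) cabs ((V *m (B - A) *m V ^t*) j j))).
    by apply: ler_sum => j _; apply: le_trans (ler_norm _) (normr_re_le _).
  rewrite /mxsize [leRHS](bigID D) /= -[leLHS]addr0 lerD //.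
    apply: ler_sum => j _; rewrite [leRHS](bigD1 j) //= lerDl.
    by apply: sumr_ge0 => i _; exact: cabs_ge0.
  by apply: sumr_ge0 => j _; apply: sumr_ge0 => i _; exact: cabs_ge0.
apply: le_trans (mxsizeM _ _) _.
have Vn : mxsize V <= (n * n)%:R by exact: mxsize_unitary.
rewrite mxsize_adj natrX expr2 -mulrA [leRHS]mulrCA mulrC.
rewrite ler_pM ?mxsize_ge0 // (le_trans (mxsizeM _ _)) // ler_wpM2r ?mxsize_ge0 //.
Qed.

(** An ordered eigenvalue is a difference of two consecutive sums as in
    sum_spectrum_le, which are bounded in both directions by exchanging the
    two matrices. *)
Lemma spectrum_lipschitz n (U V : 'M[C]_n) (a b : 'rV[R]_n) k :
  U \is unitarymx -> V \is unitarymx ->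
  (forall i j : 'I_n, (i <= j)%N -> a 0 j <= a 0 i) ->
  (forall i j : 'I_n, (i <= j)%N -> b 0 j <= b 0 i) ->
  `|b 0 k - a 0 k| <= 2 * ((n * n) ^ 2)%:R *
  mxsize (V ^t* *m rdiag b *m V - U ^t* *m rdiag a *m U).
Proof.
move=> UU UV amon bmon.
pose lek := [pred l : 'I_n | (l <= k)%N]; pose ltk := [pred l : 'I_n | (l < k)%N].
have split (c : 'rV[R]_n) : \sum_(l | lek l) c 0 l = \sum_(l | ltk l) c 0 l + c 0 k.
  rewrite (bigD1 k) //= addrC; congr (_ + _); apply: eq_bigl => l.
  by rewrite ltn_neqAle andbC.
have lekP (c : 'rV[R]_n) : (forall i j : 'I_n, (i <= j)%N -> c 0 j <= c 0 i) ->
    (forall l, lek l -> c 0 k <= c 0 l) /\ (forall l, ~~ lek l -> c 0 l <= c 0 k).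
  by move=> cmon; split=> l /= lk; apply: cmon => //; rewrite ltnW // ltnNge.
have ltkP (c : 'rV[R]_n) : (forall i j : 'I_n, (i <= j)%N -> c 0 j <= c 0 i) ->
    (forall l, ltk l -> c 0 k <= c 0 l) /\ (forall l, ~~ ltk l -> c 0 l <= c 0 k).
  by move=> cmon; split=> l /= lk; apply: cmon; rewrite ?(ltnW lk) // leqNgt.
have [a1 a2] := lekP _ amon; have [a3 a4] := ltkP _ amon.
have [b1 b2] := lekP _ bmon; have [b3 b4] := ltkP _ bmon.
have h1 := sum_spectrum_le b UU UV a1 a2.
have h2 := sum_spectrum_le b UU UV a3 a4.
have h3 := sum_spectrum_le a UV UU b1 b2.
have h4 := sum_spectrum_le a UV UU b3 b4.
rewrite -mxsizeN opprB in h3; rewrite -mxsizeN opprB in h4.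
move: h1 h2 h3 h4; rewrite !split => h1 h2 h3 h4.
rewrite -mulrA; move: (_ * mxsize _) h1 h2 h3 h4 => x h1 h2 h3 h4.
by rewrite ler_norml; apply/andP; split; lra.
Qed.

Lemma kappa_eps_delta n (g : 'M[C]_n) (e : R) : g \in unitmx -> 0 < e ->
  exists d, 0 < d /\ forall g', g' \in unitmx -> mxsize (g' - g) <= d ->
    forall k, `|kappaC g' 0 k - kappaC g 0 k| <= e.
Proof.
move=> gu e0.
have [P [Q [a [UP UQ gE [a0 amon] ka]]]] := singular_value_decomposition gu.
pose K : R := 2 * ((n * n) ^ 2)%:R; have K0 : 0 <= K by rewrite mulr_ge0.
pose G := mxsize g; have G0 : 0 <= G by exact: mxsize_ge0.
pose m := \sum_k (a 0 k ^+ 2)^-1.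
have mP k : (a 0 k ^+ 2)^-1 <= m.
  by rewrite /m (bigD1 k) //= lerDl sumr_ge0 // => l _; rewrite invr_ge0 sqr_ge0.
have m0 : 0 <= m by apply: sumr_ge0 => l _; rewrite invr_ge0 sqr_ge0.
(* |g' - g| = D changes the squared singular values by at most K (2 G + 1) D,
   and relatively by at most L D; the bound L D <= 1/2 keeps the ratio x of the
   new to the old ones away from 0 *)
pose L := 1 + K * (2 * G + 1) * m.
have L0 : 0 < L by rewrite ltr_pwDl // !mulr_ge0 // addr_ge0 // mulr_ge0.
pose d := Num.min 1 (Num.min (2^-1 / L) (e / L)).
have d0 : 0 < d by rewrite !lt_min ltr01 !divr_gt0 // invr_gt0.
exists d; split => // g' g'u gd k.
have [P' [Q' [b [UP' UQ' g'E [b0 bmon] kb]]]] := singular_value_decomposition g'u.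
have sqmon (c : 'rV[R]_n) : (forall k, 0 < c 0 k) ->
    (forall i j : 'I_n, (i <= j)%N -> c 0 j <= c 0 i) ->
    forall i j : 'I_n, (i <= j)%N ->
      (\row_k (c 0 k ^+ 2)) 0 j <= (\row_k (c 0 k ^+ 2)) 0 i.
  move=> c0 cmon i j ij; rewrite !mxE ler_pXn2r ?nnegrE ?(ltW (c0 _)) //.
  exact: cmon.
have gg (f U V : 'M[C]_n) (c : 'rV[R]_n) : U \is unitarymx -> f = U *m rdiag c *m V ->
    V ^t* *m rdiag (\row_k (c 0 k ^+ 2)) *m V = f ^t* *m f.
  move=> UU ->; rewrite !adjM rdiag_adj -!mulmxA (mulmxA (U ^t*)).
  rewrite (unitarymx_mulVmx UU) mul1mx (mulmxA (rdiag _)) rdiagM.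
  by have -> : \row_k (c 0 k ^+ 2) = \row_k (c 0 k * c 0 k) by apply/rowP => l; rewrite !mxE.
have sl := spectrum_lipschitz k UQ UQ' (sqmon _ a0 amon) (sqmon _ b0 bmon).
rewrite (gg _ _ _ _ UP gE) (gg _ _ _ _ UP' g'E) -/K !mxE in sl.
have ggE : g' ^t* *m g' - g ^t* *m g = g' ^t* *m (g' - g) + (g' - g) ^t* *m g.
  have -> : (g' - g) ^t* = g' ^t* - g ^t* by rewrite !raddfB.
  by rewrite mulmxBr mulmxBl addrA subrK.
rewrite ggE in sl; move: sl; set y := mxsize (_ + _) => le; pose D := mxsize (g' - g).
have D0 : 0 <= D by exact: mxsize_ge0.
have dle1 : D <= 1 by apply: le_trans gd _; rewrite ge_min lexx.
have dle2 : D <= 2^-1 / L by apply: le_trans gd _; rewrite !ge_min lexx orbT.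
have dle3 : D <= e / L by apply: le_trans gd _; rewrite !ge_min lexx !orbT.
have G' : mxsize g' <= G + 1.
  rewrite -(subrK g g') addrC (le_trans (mxsizeD _ _)) // lerD2l //.
have yle : y <= (2 * G + 1) * D.
  apply: le_trans (mxsizeD _ _) _; have := mxsizeM (g' ^t*) (g' - g).
  have := mxsizeM ((g' - g) ^t*) g; rewrite !mxsize_adj -/G -/D.
  have : mxsize g' * D <= (G + 1) * D by rewrite ler_wpM2r.
  lra.
have ak0 : 0 < a 0 k ^+ 2 by rewrite exprn_gt0.
have bk0 : 0 < b 0 k ^+ 2 by rewrite exprn_gt0.
have rel : `|b 0 k ^+ 2 - a 0 k ^+ 2| / a 0 k ^+ 2 <= L * D.
  apply: (@le_trans _ _ (K * ((2 * G + 1) * D) * m)).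
    rewrite ler_pM ?invr_ge0 ?sqr_ge0 // (le_trans le) // ler_wpM2l //.
  have -> : K * ((2 * G + 1) * D) * m = K * (2 * G + 1) * m * D by ring.
  by rewrite ler_wpM2r // /L lerDr.
have LD2 : L * D <= 2^-1 by rewrite mulrC -ler_pdivlMr.
have LDe : L * D <= e by rewrite mulrC -ler_pdivlMr.
pose x := b 0 k ^+ 2 / a 0 k ^+ 2.
have x0 : 0 < x by rewrite divr_gt0.
have xr : `|x - 1| <= L * D.
  apply: le_trans rel; rewrite -[X in _ / X]gtr0_norm // -normf_div.
  by rewrite mulrBl divff ?gt_eqF.
have -> : kappaC g' 0 k - kappaC g 0 k = ln x / 2.
  rewrite /x ln_div ?posrE // !lnXn // kb ka; by field.
have xl : 2^-1 <= x by move: xr; rewrite ler_norml => /andP[]; lra.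
have lx1 : ln x <= x - 1 by exact: ln_le_subr1.
have lx2 : - ln x <= x^-1 - 1 by rewrite -lnV ?posrE // ln_le_subr1 ?invr_gt0.
have : x^-1 - 1 <= 2 * (L * D).
  have -> : x^-1 - 1 = (1 - x) * x^-1 by rewrite mulrBl mul1r divff ?gt_eqF.
  have xi : x^-1 <= 2 by rewrite -[2]invrK lef_pV2 ?posrE // invr_gt0.
  apply: (@le_trans _ _ ((L * D) * x^-1)).
    by rewrite ler_wpM2r ?invr_ge0 ?(ltW x0) //; move: xr; rewrite ler_norml => /andP[]; lra.
  by rewrite mulrC ler_wpM2r // mulr_ge0 // (ltW L0).
move: xr; rewrite !ler_norml => /andP[xr1 xr2] lx3.
by apply/andP; split; lra.
Qed.
End Continuity.

(** * Continuity by estimates *)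

Section EpsDelta.
Variable R : realType.

Lemma within_continuous_eps_delta (V : normedModType R) (A : set V) (f : V -> R) :
  (forall x, A x -> forall e, 0 < e ->
     exists d, 0 < d /\ forall y, A y -> `|x - y| <= d -> `|f x - f y| <= e) ->
  {within A, continuous f}.
Proof.
move=> fP; apply/subspace_continuousP => x Ax; apply/cvgrPdist_le => e e0.
have [d [d0 dP]] := fP x Ax e e0.
apply/nbhs_normP; exists d => // y /= yd Ay.
by apply: dP => //; rewrite ltW.
Qed.

Lemma continuous_lipschitz (V : normedModType R) (f : V -> R) (K : R) :
  (forall x y, `|f x - f y| <= K * `|x - y|) -> continuous f.
Proof.
move=> fK x; apply/cvgrPdist_le => e e0.
have K1 : 0 < 1 + `|K| by rewrite ltr_pwDl.
apply/nbhs_normP; exists (e / (1 + `|K|)); first exact: divr_gt0.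
move=> y /= /ltW yd; apply: le_trans (fK _ _) _.
apply: (@le_trans _ _ ((1 + `|K|) * `|x - y|)).
  by rewrite ler_wpM2r // (le_trans (ler_norm _)) // lerDr.
by rewrite mulrC -ler_pdivlMr.
Qed.

Lemma rV_entry_le n (x : 'rV[R]_n) k : `|x 0 k| <= `|x|.
Proof.
rewrite [`|x|]mx_normrE.
exact: (le_bigmax 0 (fun ij : 'I_1 * 'I_n => `|x ij.1 ij.2|) (0, k)).
Qed.

End EpsDelta.

(** * The minimum of the energy over conjugations *)

Section Minimiser.
Variables (R : realType) (C : complexModel R).
Local Notation "x %:C" := (model_cplx C x).
Local Notation re := (model_re C).

(** Complex matrices in real coordinates, real parts first; compactness and
    the extreme value theorem are applied to these coordinates. *)
Definition mx_of_rV n (x : 'rV[R]_(n * n + n * n)) : 'M[C]_n :=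
  map_mx (model_cplx C) (vec_mx (lsubmx x)) +
  'i *: map_mx (model_cplx C) (vec_mx (rsubmx x)).

Lemma mx_of_rVB n (x y : 'rV[R]_(n * n + n * n)) :
  mx_of_rV x - mx_of_rV y = mx_of_rV (x - y).
Proof.
by apply/matrixP => i j; rewrite !mxE !rmorphB; ring.
Qed.

Lemma mxsize_mx_of_rV n (x : 'rV[R]_(n * n + n * n)) :
  mxsize (mx_of_rV x) <= (2 * (n * n)%:R) * `|x|.
Proof.
have -> : 2 * (n * n)%:R * `|x| = (2 * `|x|) *+ (n * n).
  by rewrite -mulr_natr; ring.
apply: mxsize_le => i j; rewrite !mxE; apply: le_trans (cabsD _ _) _.
have i1 : cabs ('i : C) = 1.
  by apply: (@cplx_inj R C); rewrite cabsE rmorph1 normCi.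
rewrite cabsM i1 mul1r !cabs_real mulr2n mulrDl mul1r.
by rewrite lerD // rV_entry_le.
Qed.

Lemma mx_of_rV_surj n (h : 'M[C]_n) : exists x : 'rV[R]_(n * n + n * n),
  mx_of_rV x = h /\ forall k, `|x 0 k| <= mxsize h.
Proof.
pose A := \matrix_(i, j) re (h i j); pose B := \matrix_(i, j) re ('Im (h i j)).
exists (row_mx (mxvec A) (mxvec B)); split.
  rewrite /mx_of_rV row_mxKl row_mxKr !mxvecK; apply/matrixP => i j; rewrite !mxE.
  by rewrite model_reE re_real ?Creal_Im // -Crect.
move=> k; case: (splitP k) => l kl.
  have -> : k = lshift _ l by exact: val_inj.
  rewrite row_mxEl; case/mxvec_indexP: l {kl} => i j; rewrite mxvecE mxE.
  by apply: le_trans (normr_re_le _) _; exact: cabs_le_mxsize.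
have -> : k = rshift _ l by exact: val_inj.
rewrite row_mxEr; case/mxvec_indexP: l {kl} => i j; rewrite mxvecE mxE.
apply: le_trans (cabs_le_mxsize h i j).
rewrite -(model_cplx_le C) -norm_cplx re_real ?Creal_Im // cabsE.
have [le _] := leif_normC_Re_Creal ('i * h i j).
by move: le; rewrite ReMil normrN normrM normCi mul1r.
Qed.

(** If h' = (1 + s) h, the two conjugates M of g by h and M' of g by h' are
    related by M' (1 + s) = (1 + s) M, so that M' - M = s M - M' s. *)
Lemma conj_perturbation n (g h h' : 'M[C]_n) : h \in unitmx -> h' \in unitmx ->
  mxsize (h' - h) * mxsize (invmx h) <= 2^-1 ->
  mxsize (h' *m g *m invmx h' - h *m g *m invmx h) <=
  4 * (mxsize (h' - h) * mxsize (invmx h)) * mxsize (h *m g *m invmx h).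
Proof.
move=> hu h'u small; pose s := (h' - h) *m invmx h.
set M := h *m g *m invmx h; set M' := h' *m g *m invmx h'.
have hE : h' = h + s *m h by rewrite /s mulmxKV // addrC subrK.
have Mh : M *m h = h *m g by rewrite /M mulmxKV.
have Mh' : M' *m h' = h' *m g by rewrite /M' mulmxKV.
have sE : mxsize s <= mxsize (h' - h) * mxsize (invmx h) by exact: mxsizeM.
clearbody M M' s.
have MM' : M' - M = s *m M - M' *m s.
  have : (M' + M' *m s) *m h = (M + s *m M) *m h.
    rewrite !mulmxDl -!mulmxA Mh -mulmxDr -hE Mh' {1}hE mulmxDl -mulmxA //.
  move/(can_inj (mulmxK hu)); move: (s *m M) (M' *m s) => X Y eqXY.
  by rewrite -[M'](addrK Y) eqXY; apply/matrixP => i j; rewrite !mxE; ring.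
have D0 := mxsize_ge0 s; have M0 := mxsize_ge0 M; have M'0 := mxsize_ge0 M'.
set D := _ * mxsize (invmx h) in small sE *.
have le1 : mxsize (M' - M) <= mxsize s * mxsize M + mxsize M' * mxsize s.
  by rewrite MM' (le_trans (mxsizeB _ _)) // lerD // mxsizeM.
have le2 : mxsize M' <= mxsize M + mxsize (M' - M).
  by rewrite -{1}(subrK M M') addrC mxsizeD.
have s2 : mxsize s <= 2^-1 by exact: le_trans small.
have le3 : mxsize M' <= 3 * mxsize M by nra.
nra.
Qed.

Definition conj_energy (I : finType) n (f : I -> 'M[C]_n) (h : 'M[C]_n) : R :=
  \sum_i \sum_k kappaC (h *m f i *m invmx h) 0 k ^+ 2.

Lemma conj_energyZ (I : finType) n (f : I -> 'M[C]_n) c h : c != 0 -> h \in unitmx ->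
  conj_energy f (c *: h) = conj_energy f h.
Proof.
move=> c0 hu; apply: eq_bigr => i _; apply: eq_bigr => k _; congr (kappaC _ _ _ ^+ _).
have cu : c *: h \in unitmx by rewrite unitmxZ ?unitfE.
by rewrite invmxZ // -!scalemxAl -scalemxAr scalerA mulfV // scale1r.
Qed.

Lemma mxsize_le_kappa n (g : 'M[C]_n) (B : R) : g \in unitmx ->
  (forall k, kappaC g 0 k <= B) -> mxsize g <= (n * n)%:R * (n%:R * expR B) * (n * n)%:R.
Proof.
move=> gu gB.
have [P [Q [a [UP UQ gE [a0 _] ka]]]] := singular_value_decomposition gu.
rewrite gE; apply: le_trans (mxsizeM _ _) _.
rewrite ler_pM ?mxsize_ge0 ?mxsize_unitary // (le_trans (mxsizeM _ _)) //.
rewrite ler_pM ?mxsize_ge0 ?mxsize_unitary //.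
rewrite /mxsize mulr_natl -[X in _ *+ X]card_ord -sumr_const; apply: ler_sum => i _.
rewrite (bigD1 i) //= big1 => [|j ji]; last by rewrite rdiagE eq_sym (negbTE ji) cabs0.
rewrite addr0 rdiagE eqxx mulr1n cabs_real gtr0_norm // -[a 0 i]lnK ?posrE //.
by rewrite ler_expR -ka.
Qed.

(** A bound on the energy bounds kappa of the conjugates h (f i) h^-1, hence
    their sizes: |h (f i) v| <= c0 |h v| for all v. This is a closed condition
    on h, and it makes sense for singular h as well, where it says that the
    kernel of h on column vectors is invariant under f i. By irreducibility
    such an h is 0 or invertible. So, once h is normalised to size 1, the
    condition cuts out a compact set Z of invertible matrices on which the
    energy is continuous. *)
Lemma conj_energy_min (I : finType) n (f : I -> 'M[C]_n) : (0 < n)%N ->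
  (forall i, f i \in unitmx) ->
  (forall h : 'M[C]_n, h != 0 -> (forall i, (h *m f i <= h)%MS) -> h \in unitmx) ->
  exists h, h \in unitmx /\ forall h', h' \in unitmx -> conj_energy f h <= conj_energy f h'.
Proof.
move=> n0 fu irr; pose E0 := conj_energy f 1%:M.
(* the bound of mxsize_le_kappa: y^2 <= E0 implies y <= 1 + E0 *)
pose c0 : R := (n * n)%:R * (n%:R * expR (1 + E0)) * (n * n)%:R.
pose X := 'rV[R]_(n * n + n * n).
pose cube : set X := [set x | forall k, `[-1, 1]%classic (x ord0 k)].
pose Z : set X := cube `&` [set x | mxsize (mx_of_rV x) = 1] `&`
  [set x | forall i (v : 'M[C]_n),
     mxsize (mx_of_rV x *m f i *m v) <= c0 * mxsize (mx_of_rV x *m v)].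
have mx_cont (v : 'M[C]_n) : continuous (fun x : X => mxsize (mx_of_rV x *m v)).
  apply: (@continuous_lipschitz _ _ _ (2 * (n * n)%:R * mxsize v)) => x y.
  have tri (a b : 'M[C]_n) : mxsize a - mxsize b <= mxsize (a - b).
    by rewrite lerBlDr (le_trans _ (mxsizeD _ _)) // subrK.
  have le (a b : X) : mxsize (mx_of_rV a *m v) - mxsize (mx_of_rV b *m v) <=
      2 * (n * n)%:R * mxsize v * `|a - b|.
    apply: le_trans (tri _ _) _; rewrite -mulmxBl mx_of_rVB.
    apply: le_trans (mxsizeM _ _) _; rewrite [leRHS]mulrAC.
    by rewrite ler_wpM2r ?mxsize_ge0 // mxsize_mx_of_rV.
  by rewrite ler_norml le lerNl opprB distrC le.
have c0Z x (v : 'M[C]_n) :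
    mxsize (mx_of_rV x *m (c0%:C *: v)) = c0 * mxsize (mx_of_rV x *m v).
  by rewrite -scalemxAr mxsizeZ cabs_real ger0_norm // !mulr_ge0 // expR_ge0.
have Zcompact : compact Z.
  apply: (@subclosed_compact _ _ cube); last by move=> x [[]].
    have -> : Z = cube `&` (fun x : X => mxsize (mx_of_rV x *m 1%:M)) @^-1` [set 1] `&`
       \bigcap_(iv : I * 'M[C]_n) (fun x : X => mxsize (mx_of_rV x *m (c0%:C *: iv.2))
         - mxsize (mx_of_rV x *m (f iv.1 *m iv.2))) @^-1` [set r | 0 <= r].
      apply/seteqP; split => [x [[xc x1] xZ]|x [[xc x1] xZ]].
        split; first by split=> //=; rewrite mulmx1.
        by move=> [i v] _ /=; rewrite subr_ge0 mulmxA c0Z; exact: xZ.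
      split; first by split=> //; move: x1 => /=; rewrite mulmx1.
      by move=> i v; have /= := xZ (i, v) Logic.I; rewrite subr_ge0 mulmxA c0Z.
    apply: closedI; first apply: closedI.
    - have -> : cube = \bigcap_(k in setT) ((fun x : X => x ord0 k) @^-1` `[-1, 1]%classic).
        by apply/seteqP; split=> x /= xc k; [move=> _|]; exact: xc.
      apply: closed_bigI => k _; apply: closed_comp; last exact: interval_closed.
      by move=> x _; exact: coord_continuous.
    - by apply: closed_comp; [move=> x _; exact: mx_cont|exact: closed_eq].
    - apply: closed_bigI => iv _; apply: closed_comp; last exact: closed_ge.
      move=> x _.
      exact: (@continuousB _ _ _ _ _ x (mx_cont (c0%:C *: iv.2) x) (mx_cont (f iv.1 *m iv.2) x)).
  apply: (@rV_compact R (n * n + n * n) (fun=> `[-1, 1]%classic : set R)) => k.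
  exact: segment_compact.
(* for v = cokermx h the condition gives h f v = 0, i.e. h f <= h *)
have Zu x : Z x -> mx_of_rV x \in unitmx.
  move=> [[_ x1] xZ]; apply: irr => [|i].
    apply/negP => /eqP x0; move: x1; rewrite /= x0 => /eqP; rewrite eq_sym.
    rewrite /mxsize big1 ?oner_eq0 // => i _; rewrite big1 // => j _.
    by rewrite mxE cabs0.
  rewrite submxE; apply/eqP/mxsize_eq0/eqP; rewrite eq_le mxsize_ge0 andbT.
  apply: le_trans (xZ i _) _; rewrite mulmx_coker.
  by rewrite /mxsize big1 ?mulr0 // => j _; rewrite big1 // => l _; rewrite mxE cabs0.
have ZE h : h \in unitmx -> mxsize h = 1 -> conj_energy f h <= E0 ->
    exists2 x, Z x & mx_of_rV x = h.
  move=> hu h1 hE; have [x [xh xb]] := mx_of_rV_surj h; exists x => //.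
  split; first split => /=; rewrite ?xh //.
    by move=> k /=; rewrite in_itv /= -ler_norml -h1.
  move=> i v; rewrite /= xh.
  have -> : h *m f i *m v = (h *m f i *m invmx h) *m (h *m v).
    by rewrite -[RHS]mulmxA mulKmx // mulmxA.
  apply: le_trans (mxsizeM _ _) _; rewrite ler_wpM2r ?mxsize_ge0 //.
  apply: mxsize_le_kappa; first by rewrite !unitmx_mul hu fu unitmx_inv.
  move=> k; set y := kappaC _ 0 k.
  have : y ^+ 2 <= E0.
    apply: le_trans hE; rewrite /conj_energy (bigD1 i) //= (bigD1 k) //= -addrA lerDl.
    rewrite addr_ge0 //; first by apply: sumr_ge0 => l _; exact: sqr_ge0.
    by apply: sumr_ge0 => j _; apply: sumr_ge0 => l _; exact: sqr_ge0.
  by have := sqr_ge0 (y - 1); rewrite sqrrB mulr1 expr1n; have := sqr_ge0 y; lra.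
have one_gt0 : 0 < mxsize (1%:M : 'M[C]_n).
  rewrite lt_def mxsize_ge0 andbT; apply/negP => /eqP/mxsize_eq0/matrixP.
  move/(_ (Ordinal n0) (Ordinal n0)); rewrite !mxE eqxx => /eqP.
  by rewrite oner_eq0.
have normalize h : h \in unitmx -> exists h1, [/\ h1 \in unitmx, mxsize h1 = 1 &
    conj_energy f h1 = conj_energy f h].
  move=> hu; have h0 : mxsize h != 0.
    apply/negP => /eqP/mxsize_eq0 h0; move: (mulmxV hu); rewrite h0 mul0mx => e.
    by move: one_gt0; rewrite -e /mxsize big1 ?ltxx // => i _; rewrite big1 // => j _; rewrite mxE cabs0.
  have c0' : ((mxsize h)^-1)%:C != 0.
    by rewrite -(rmorph0 (model_cplx C)) (inj_eq (@cplx_inj R C)) invr_eq0.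
  exists (((mxsize h)^-1)%:C *: h); split.
  - by rewrite unitmxZ ?unitfE.
  - by rewrite mxsizeZ cabs_real ger0_norm ?invr_ge0 ?mxsize_ge0 // mulVf.
  - exact: conj_energyZ.
have Z0 : Z !=set0.
  have [h [hu h1 hE]] := normalize _ (unitmx1 C n).
  have [x Zx _] : exists2 x, Z x & mx_of_rV x = h by apply: ZE => //; rewrite hE.
  by exists x.
have Econt : {within Z, continuous (fun x : X => conj_energy f (mx_of_rV x))}.
  have conv i k : {within Z, continuous (fun y : X =>
      kappaC (mx_of_rV y *m f i *m invmx (mx_of_rV y)) 0 k)}.
    apply: within_continuous_eps_delta => x Zx e e0; have xu := Zu x Zx.
    set h := mx_of_rV x in xu *; pose g := h *m f i *m invmx h.
    have gu : g \in unitmx by rewrite !unitmx_mul xu fu unitmx_inv.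
    have [d [d0 dP]] := kappa_eps_delta gu e0.
    pose L := (2 * (n * n)%:R) * mxsize (invmx h); have L0 : 0 <= L.
      by rewrite !mulr_ge0 // mxsize_ge0.
    pose r := Num.min (2^-1 / (1 + L)) (d / (4 * (1 + L) * (1 + mxsize g))).
    have g0 := mxsize_ge0 g.
    have r0 : 0 < r.
      by rewrite lt_min !divr_gt0 ?invr_gt0 // ?mulr_gt0 // ltr_pwDl.
    exists r; split => // y Zy xy.
    have yu := Zu y Zy; rewrite distrC; apply: dP.
      by rewrite !unitmx_mul yu fu unitmx_inv.
    have small : mxsize (mx_of_rV y - h) * mxsize (invmx h) <= (1 + L) * `|x - y|.
      apply: (@le_trans _ _ (L * `|x - y|)); last by rewrite ler_wpM2r // lerDr.
      rewrite /L mulrAC ler_wpM2r ?mxsize_ge0 // /h mx_of_rVB distrC.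
      exact: mxsize_mx_of_rV.
    have L1 : 0 < 1 + L by rewrite ltr_pwDl.
    have g1 : 0 < 1 + mxsize g by rewrite ltr_pwDl.
    move: xy; rewrite le_min => /andP[xy1 xy2].
    apply: le_trans (conj_perturbation _ xu yu _) _.
      apply: le_trans small _; by rewrite mulrC -ler_pdivlMr.
    rewrite -/g; apply: (@le_trans _ _ (4 * ((1 + L) * `|x - y|) * (1 + mxsize g))).
      by rewrite ler_pM ?mulr_ge0 ?mxsize_ge0 // ?ler_wpM2l // lerDr.
    have -> : 4 * ((1 + L) * `|x - y|) * (1 + mxsize g) =
      `|x - y| * (4 * (1 + L) * (1 + mxsize g)) by ring.
    by rewrite -ler_pdivlMr ?mulr_gt0.
  apply/subspace_continuousP => x Zx.
  apply: cvg_big => //; [exact: add_continuous | move=> i _].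
  apply: cvg_big => //; [exact: add_continuous | move=> k _].
  have /subspace_continuousP/(_ x Zx) c := conv i k.
  exact: (cvgM c c).
have [x Zx xmin] := compact_EVT_min Z0 Zcompact Econt.
rewrite inE in Zx; exists (mx_of_rV x); split; first exact: Zu.
move=> h' h'u; have [h [hu h1 <-]] := normalize _ h'u.
have [le|gt] := leP (conj_energy f h) E0.
  by have [y Zy <-] := ZE h hu h1 le; apply: xmin; rewrite inE.
apply: le_trans (ltW gt).
have [h2 [h2u h21 h2E]] := normalize _ (unitmx1 C n).
have [y Zy yE] : exists2 x, Z x & mx_of_rV x = h2 by apply: ZE => //; rewrite h2E.
by rewrite /E0 -h2E -yE; apply: xmin; rewrite inE.
Qed.

End Minimiser.

(** * Balanced conjugates *)

Section Balanced.
Variables (R : realType) (C : complexModel R).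
Local Notation "x %:C" := (model_cplx C x).
Local Notation re := (model_re C).
Local Notation rdiag := (@rdiag R C _).

(** Let D be the defect of balancedness at a minimum h of the energy. By
    kappa_sq_variation, replacing h by (1 - t D) h changes the energy by at
    most - 2 t |D|^2 + O(t^2), where |D|^2 is the sum tau of the squared
    moduli of the entries. Hence D = 0. *)
Lemma balanced_conjugate (I : finType) n (f : I -> 'M[C]_n) : (0 < n)%N ->
  (forall i, f i \in unitmx) ->
  (forall h : 'M[C]_n, h != 0 -> (forall i, (h *m f i <= h)%MS) -> h \in unitmx) ->
  exists h P Q (a : I -> 'rV[R]_n), [/\ h \in unitmx, balanced P Q a &
    forall i, h *m f i *m invmx h = P i *m rdiag (a i) *m Q i].
Proof.
move=> n0 fu irr; have [h [hu hmin]] := conj_energy_min n0 fu irr.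
pose g i := h *m f i *m invmx h.
have gu i : g i \in unitmx by rewrite !unitmx_mul hu fu unitmx_inv.
have /choice[P /choice[Q /choice[a PQa]]] : forall i, exists P Q (a : 'rV[R]_n),
    [/\ P \is unitarymx, Q \is unitarymx, g i = P *m rdiag a *m Q,
    (forall j, 0 < a 0 j) /\ (forall i j : 'I_n, (i <= j)%N -> a 0 j <= a 0 i) &
    forall j, kappaC (g i) 0 j = ln (a 0 j)].
  by move=> i; exact: singular_value_decomposition.
have {}PQa i : [/\ P i \is unitarymx, Q i \is unitarymx,
    g i = P i *m rdiag (a i) *m Q i, (forall j, 0 < a i 0 j) &
    forall j, kappaC (g i) 0 j = ln (a i 0 j)].
  by have [? ? ? [? _] ?] := PQa i.
exists h, P, Q, a; split => //; last by move=> i; have [] := PQa i.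
pose L i := rdiag (map_mx (@ln R) (a i)).
pose Di i := P i *m L i *m (P i) ^t* - (Q i) ^t* *m L i *m Q i.
pose D := \sum_i Di i.
have DH : D ^t* = D.
  have sumadj (F : I -> 'M[C]_n) : (\sum_i F i) ^t* = \sum_i (F i) ^t*.
    by apply/matrixP => k l; rewrite adjE !summxE rmorph_sum; apply: eq_bigr => i _; rewrite adjE.
  rewrite /D sumadj; apply: eq_bigr => i _; rewrite /Di.
  have adjB (A B : 'M[C]_n) : (A - B) ^t* = A ^t* - B ^t*.
    by apply/matrixP => k l; rewrite adjE !mxE rmorphB.
  by rewrite adjB !adjM rdiag_adj !trmxCK !mulmxA.
suff D0 : D = 0.
  split; try by move=> i; have [] := PQa i.
  apply/eqP; rewrite -subr_eq0 -sumrB; apply/eqP; exact: D0.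
have var i : exists K t0 : R, 0 < t0 /\ forall t, `|t| <= t0 ->
    let k := 1%:M + t%:C *: D in
    k \in unitmx /\
    \sum_j kappaC (k *m g i *m invmx k) 0 j ^+ 2 <= \sum_j kappaC (g i) 0 j ^+ 2
      + 2 * t * re (\tr (D *m Di i)) + K * t ^+ 2.
  by have [UP UQ gE a0 ka] := PQa i; apply: kappa_sq_variation.
have /choice[K /choice[t0 Kt0]] := var.
have h_conj k i : k \in unitmx ->
    (k *m h) *m f i *m invmx (k *m h) = k *m g i *m invmx k.
  move=> ku; have khu : k *m h \in unitmx by rewrite unitmx_mul ku hu.
  apply: (can_inj (mulmxK khu)); rewrite mulmxKV // mulmxA mulmxKV //.
  by rewrite /g !mulmxA mulmxKV.
have trD : \sum_i re (\tr (D *m Di i)) = \sum_i \sum_j cabs (D i j) ^+ 2.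
  rewrite -(raddf_sum re) -(raddf_sum (@mxtrace C n)) -mulmx_sumr -/D.
  rewrite -{2}DH /mxtrace raddf_sum; apply: eq_bigr => i _.
  rewrite mxE raddf_sum; apply: eq_bigr => j _.
  by rewrite adjE -normCK -cabsE -rmorphXn /= cplxK.
pose tau := \sum_i \sum_j cabs (D i j) ^+ 2.
have tau_ge0 : 0 <= tau.
  by apply: sumr_ge0 => i _; apply: sumr_ge0 => j _; exact: sqr_ge0.
suff tau0 : tau = 0.
  apply/matrixP => i j; rewrite mxE; apply/eqP; rewrite -cabs_eq0 -sqrf_eq0.
  rewrite eq_le sqr_ge0 andbT -tau0 /tau (bigD1 i) //= (bigD1 j) //= -addrA lerDl.
  rewrite addr_ge0 //; first by apply: sumr_ge0 => k _; exact: sqr_ge0.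
  by apply: sumr_ge0 => k _; apply: sumr_ge0 => l _; exact: sqr_ge0.
pose t1 := \big[Num.min/1]_i t0 i; pose K1 := \sum_i `|K i|.
have t1_gt0 : 0 < t1 by apply: lt_bigmin => // i _; case: (Kt0 i).
have t1_le i : t1 <= t0 i by exact: bigmin_le.
have K1_ge0 : 0 <= K1 by exact: sumr_ge0.
have ineq t : 0 < t -> t <= t1 -> 2 * tau <= K1 * t.
  move=> t_gt0 tt1.
  have tle i : `|- t| <= t0 i by rewrite normrN gtr0_norm // (le_trans tt1).
  have [I0|/card_gt0P[i0 _]] := posnP #|I|.
    have -> : tau = 0.
      rewrite /tau -trD big1 // => i _; have := fintype0 i I0; by [].
    by rewrite mulr0 mulr_ge0 // ltW.
  pose k := 1%:M + (- t)%:C *: D.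
  have ku : k \in unitmx by have [_ /(_ _ (tle i0))[]] := Kt0 i0.
  have khu : k *m h \in unitmx by rewrite unitmx_mul ku hu.
  have := hmin _ khu; rewrite /conj_energy.
  rewrite [leRHS](eq_bigr (fun i => \sum_j kappaC (k *m g i *m invmx k) 0 j ^+ 2)); last first.
    by move=> i _; rewrite h_conj.
  move=> le1.
  have le2 : \sum_i \sum_j kappaC (k *m g i *m invmx k) 0 j ^+ 2 <=
      \sum_i (\sum_j kappaC (g i) 0 j ^+ 2 + 2 * (- t) * re (\tr (D *m Di i))
        + `|K i| * t ^+ 2).
    apply: ler_sum => i _; have [_ /(_ _ (tle i))[_ le]] := Kt0 i.
    apply: le_trans le _; rewrite lerD2l sqrrN ler_wpM2r ?sqr_ge0 // ler_norm //.
  have := le_trans le1 le2; rewrite !big_split /= -mulr_sumr -mulr_suml trD -/tau -/K1.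
  rewrite -/(g _) -addrA lerDl => le3.
  rewrite -(ler_pM2l t_gt0); move: le3; rewrite expr2; lra.
apply/eqP; rewrite eq_le tau_ge0 andbT leNgt; apply/negP => tau_gt0.
(* for this t, 2 tau <= K1 t < tau, a contradiction *)
pose t := Num.min t1 (tau / (1 + K1)).
have t_gt0 : 0 < t by rewrite lt_min t1_gt0 divr_gt0 // ltr_pwDl.
have := ineq t t_gt0; rewrite ge_min lexx => /(_ isT).
have : t * (1 + K1) <= tau by rewrite -ler_pdivlMr ?ltr_pwDl // ge_min lexx orbT.
nra.
Qed.

End Balanced.

(** * Tensor powers and antisymmetrisation *)

Section Tensor.
Variables (F : numClosedFieldType) (I : finType) (d : nat).
Local Notation T := {ffun I -> 'I_d}.

Definition tensor (X : I -> 'M[F]_d) : 'M[F]_#|{: T}| :=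
  \matrix_(p, q) \prod_i X i ((enum_val p : T) i) ((enum_val q : T) i).

Lemma tensorM (X Y : I -> 'M[F]_d) :
  tensor X *m tensor Y = tensor (fun i => X i *m Y i).
Proof.
apply/matrixP => p q; rewrite !mxE.
rewrite [RHS](eq_bigr (fun i => \sum_j X i ((enum_val p : T) i) j *
    Y i j ((enum_val q : T) i))); last by move=> i _; rewrite mxE.
rewrite bigA_distr_bigA /= (reindex (fun r : 'I_#|{: T}| => enum_val r)) /=.
  by apply: eq_bigr => r _; rewrite !mxE -big_split.
by exists enum_rank => r _; [exact: enum_valK|exact: enum_rankK].
Qed.

Lemma tensor1 : tensor (fun=> 1%:M) = 1%:M.
Proof.
apply/matrixP => p q; rewrite !mxE.
have [->|pq] := eqVneq p q; first by rewrite big1 // => i _; rewrite mxE eqxx.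
have [i pqi] : exists i, (enum_val p : T) i != (enum_val q : T) i.
  apply/existsP; apply: contraNT pq; rewrite negb_exists => /forallP pq.
  by apply/eqP/enum_val_inj/ffunP => i; apply/eqP; rewrite -[_ == _]negbK pq.
by rewrite (bigD1 i) //= mxE (negbTE pqi) mul0r.
Qed.

Lemma tensor_adj (X : I -> 'M[F]_d) : (tensor X) ^t* = tensor (fun i => (X i) ^t*).
Proof.
apply/matrixP => p q; rewrite adjE !mxE rmorph_prod.
by apply: eq_bigr => i _; rewrite adjE.
Qed.

Lemma tensor_unitary (X : I -> 'M[F]_d) : (forall i, X i \is unitarymx) ->
  tensor X \is unitarymx.
Proof.
move=> UX; apply/unitarymxP; rewrite tensor_adj tensorM -tensor1; congr tensor.
by apply: funext => i; exact/unitarymxP.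
Qed.

Definition tensor_pow (g : 'M[F]_d) := tensor (fun=> g).

Lemma tensor_powM g h : tensor_pow (g *m h) = tensor_pow g *m tensor_pow h.
Proof. by rewrite [RHS]tensorM. Qed.

Lemma tensor_pow1 : tensor_pow 1%:M = 1%:M. Proof. exact: tensor1. Qed.

Lemma tensor_pow_adj g : (tensor_pow g) ^t* = tensor_pow (g ^t*).
Proof. exact: tensor_adj. Qed.

Lemma tensor_pow_unit g : g \in unitmx -> tensor_pow g \in unitmx.
Proof.
move=> gu; apply: (proj1 (mulmx1_unit (B := tensor_pow (invmx g)) _)).
by rewrite -tensor_powM mulmxV // tensor_pow1.
Qed.

Lemma tensor_pow_unitary g : g \is unitarymx -> tensor_pow g \is unitarymx.
Proof. by move=> Ug; exact: tensor_unitary. Qed.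

Lemma invmx_tensor_pow g : g \in unitmx -> invmx (tensor_pow g) = tensor_pow (invmx g).
Proof.
move=> gu; have tu := tensor_pow_unit gu.
apply: (can_inj (mulKmx tu)); rewrite mulmxV // -tensor_powM mulmxV //.
by rewrite tensor_pow1.
Qed.

Definition slot i (Z : 'M[F]_d) := tensor (fun j => if j == i then Z else 1%:M).

Lemma slot_conj i P Q Z : P *m Q = 1%:M ->
  tensor_pow P *m slot i Z *m tensor_pow Q = slot i (P *m Z *m Q).
Proof.
move=> PQ; rewrite !tensorM; congr tensor; apply: funext => j.
by case: ifP => // _; rewrite mulmx1.
Qed.

Lemma slot_sum i (J : finType) (Z : J -> 'M[F]_d) :
  slot i (\sum_j Z j) = \sum_j slot i (Z j).
Proof.
apply/matrixP => p q; rewrite summxE !mxE (bigD1 i) //= eqxx summxE mulr_suml.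
apply: eq_bigr => j _; rewrite mxE [RHS](bigD1 i) //= eqxx; congr (_ * _).
by apply: eq_bigr => k /negbTE ->.
Qed.

Variables (B : eqType) (b : I -> B).

Definition block_perm : {set {perm I}} := [set s : {perm I} | [forall i, b (s i) == b i]].

Lemma block_permP (s : {perm I}) : reflect (forall i, b (s i) = b i) (s \in block_perm).
Proof. by rewrite inE; apply: (iffP forallP) => bs i; exact/eqP. Qed.

Lemma block_permM (s t : {perm I}) : s \in block_perm -> t \in block_perm ->
  (s * t)%g \in block_perm.
Proof.
by move=> /block_permP bs /block_permP bt; apply/block_permP => i; rewrite permM bt bs.
Qed.

Lemma block_permV (s : {perm I}) : s \in block_perm -> (s^-1)%g \in block_perm.
Proof.
by move=> /block_permP bs; apply/block_permP => i; rewrite -{2}(permKV s i) bs.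
Qed.

Lemma block_perm1 : (1 : {perm I})%g \in block_perm.
Proof. by apply/block_permP => i; rewrite perm1. Qed.

Definition permute (s : {perm I}) (p : T) : T := [ffun i => p (s i)].

Definition permute_mx (s : {perm I}) : 'M[F]_#|{: T}| :=
  \matrix_(p, q) (enum_val q == permute s (enum_val p))%:R.

Lemma permute_mxl s (X : 'M[F]_#|{: T}|) p q :
  (permute_mx s *m X) p q = X (enum_rank (permute s (enum_val p))) q.
Proof.
rewrite mxE (bigD1 (enum_rank (permute s (enum_val p)))) //= mxE enum_rankK eqxx mul1r.
rewrite big1 ?addr0 // => r; rewrite mxE => rp.
have /negbTE -> : enum_val r != permute s (enum_val p).
  by apply: contraNneq rp => <-; rewrite enum_valK.
by rewrite mul0r.
Qed.

Lemma permuteM s t p : permute t (permute s p) = permute (t * s)%g p.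
Proof. by apply/ffunP => i; rewrite !ffunE permM. Qed.

Lemma permute1 p : permute 1%g p = p.
Proof. by apply/ffunP => i; rewrite ffunE perm1. Qed.

Lemma permute_mxM s t : permute_mx s *m permute_mx t = permute_mx (t * s)%g.
Proof. by apply/matrixP => p q; rewrite permute_mxl !mxE enum_rankK permuteM. Qed.

Lemma permute_eqV s p q : (q == permute s p) = (p == permute s^-1%g q).
Proof.
by apply/eqP/eqP => ->; rewrite permuteM ?mulVg ?mulgV permute1.
Qed.

Lemma permute_mxC s g : permute_mx s *m tensor_pow g = tensor_pow g *m permute_mx s.
Proof.
apply/matrixP => p q; rewrite permute_mxl !mxE enum_rankK.
rewrite (bigD1 (enum_rank (permute s^-1%g (enum_val q)))) //=.
rewrite [X in _ = _ + X]big1 => [|r].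
  rewrite addr0 !mxE enum_rankK permuteM mulgV permute1 eqxx mulr1.
  rewrite [RHS](reindex_inj (@perm_inj _ s)); apply: eq_bigr => i _.
  by rewrite !ffunE permK.
rewrite !mxE => rq; rewrite permute_eqV.
have /negbTE -> : enum_val r != permute s^-1%g (enum_val q).
  by apply: contraNneq rq => <-; rewrite enum_valK.
by rewrite mulr0.
Qed.

(** The projection onto the tensors that are alternating in the slots of each
    block {i | b i = y}: a tensor product of exterior powers. *)
Definition antisym : 'M[F]_#|{: T}| :=
  #|block_perm|%:R^-1 *: \sum_(s in block_perm) (-1) ^+ s *: permute_mx s.

Lemma antisymC g : antisym *m tensor_pow g = tensor_pow g *m antisym.
Proof.
rewrite /antisym -scalemxAl -scalemxAr mulmx_suml mulmx_sumr; congr (_ *: _).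
by apply: eq_bigr => s _; rewrite -scalemxAl -scalemxAr permute_mxC.
Qed.

Lemma antisym_adj : antisym ^t* = antisym.
Proof.
apply/matrixP => p q; rewrite adjE !mxE rmorphM fmorphV rmorph_nat; congr (_ * _).
rewrite !summxE rmorph_sum (reindex_inj invg_inj) /=.
apply: eq_big => [s|s _].
  by apply/idP/idP => [/block_permV|/block_permV]; rewrite ?invgK.
rewrite !mxE rmorphM rmorph_sign rmorph_nat odd_permV; congr (_ * _).
by rewrite permute_eqV invgK.
Qed.

Lemma permute_antisym s : s \in block_perm ->
  permute_mx s *m antisym = (-1) ^+ s *: antisym.
Proof.
move=> sG; rewrite /antisym -scalemxAr scalerA mulrC -scalerA; congr (_ *: _).
rewrite mulmx_sumr scaler_sumr [RHS](reindex_inj (mulIg s)) /=.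
apply: eq_big => [t|t _].
  apply/idP/idP => [tG|tsG]; first exact: block_permM.
  by rewrite -[t](mulgK s); apply: block_permM => //; exact: block_permV.
rewrite -scalemxAr permute_mxM scalerA odd_permM signr_addb mulrA.
by rewrite mulrAC -expr2 sqrr_sign mul1r.
Qed.

Lemma antisym_idem : antisym *m antisym = antisym.
Proof.
have G0 : #|block_perm|%:R != 0 :> F.
  by rewrite pnatr_eq0 -lt0n; apply/card_gt0P; exists 1%g; exact: block_perm1.
rewrite {1}/antisym -scalemxAl mulmx_suml.
rewrite (eq_bigr (fun=> antisym)) => [|s sG].
  by rewrite sumr_const -(scaler_nat _ antisym) scalerA mulVf // scale1r.
by rewrite -scalemxAl permute_antisym // scalerA -expr2 sqrr_sign scale1r.
Qed.

(** The transposition of the slots i and j fixes the basis tensor p and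
    changes the sign of antisym. *)
Lemma antisym_eq0 p q (i j : I) : i != j -> b i = b j ->
  (enum_val p : T) i = (enum_val p : T) j -> antisym p q = 0.
Proof.
move=> ij bij pij; pose t := tperm i j.
have tG : t \in block_perm.
  apply/block_permP => k; rewrite /t; case: tpermP => [->|->|] //.
have key : permute_mx t *m antisym = - antisym.
  by rewrite permute_antisym // odd_tperm ij expr1 scaleN1r.
have := congr1 (fun M : 'M[F]_(_, _) => M p q) key.
rewrite permute_mxl [RHS]mxE.
have -> : permute t (enum_val p) = enum_val p.
  by apply/ffunP => k; rewrite ffunE /t; case: tpermP => [->|->|].
rewrite enum_valK => /eqP; rewrite -subr_eq0 opprK -mulr2n mulrn_eq0 /=.
by move/eqP.
Qed.

(** Only the identity permutation fixes p and preserves the blocks. *)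
Lemma antisym_diag (p : T) :
  (forall i j, b i = b j -> p i = p j -> i = j) ->
  antisym (enum_rank p) (enum_rank p) = #|block_perm|%:R^-1.
Proof.
move=> pinj; rewrite mxE summxE (bigD1 1%g) ?block_perm1 //= big1 ?addr0.
  by rewrite !mxE odd_perm1 expr0 mul1r permute1 eqxx mulr1.
move=> s /andP[/block_permP bs s1]; rewrite !mxE enum_rankK.
have [psp|_] := eqVneq p (permute s p); last by rewrite mulr0.
case/negP: s1; apply/eqP/permP => i; rewrite perm1; apply: pinj => //.
by rewrite [in RHS]psp ffunE.
Qed.

End Tensor.

(** * Balanced families in tensor powers *)

Section TensorBalanced.
Variables (R : realType) (C : complexModel R) (I : finType) (d : nat).
Local Notation "x %:C" := (model_cplx C x).
Local Notation rdiag := (@rdiag R C _).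
Local Notation T := {ffun I -> 'I_d}.
Local Notation tensor_pow := (@tensor_pow C I d).

Definition row_prod (a : 'rV[R]_d) : 'rV[R]_#|{: T}| :=
  \row_p \prod_i a 0 ((enum_val p : T) i).

Lemma tensor_pow_rdiag a : tensor_pow (rdiag a) = rdiag (row_prod a).
Proof.
apply/matrixP => p q; rewrite rdiagE !mxE rmorph_prod.
have [->|pq] := eqVneq p q.
  by rewrite mulr1n; apply: eq_bigr => i _; rewrite rdiagE eqxx.
have [i pqi] : exists i, (enum_val p : T) i != (enum_val q : T) i.
  apply/existsP; apply: contraNT pq; rewrite negb_exists => /forallP pq.
  by apply/eqP/enum_val_inj/ffunP => i; apply/eqP; rewrite -[_ == _]negbK pq.
by rewrite (bigD1 i) //= rdiagE (negbTE pqi) mul0r.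
Qed.

(** The logarithm of a product is a sum, so the logarithm of a tensor power
    acts on one slot at a time, like a Lie algebra element. *)
Lemma ln_row_prod (a : 'rV[R]_d) : (forall k, 0 < a 0 k) ->
  rdiag (map_mx (@ln R) (row_prod a)) = \sum_i slot i (rdiag (map_mx (@ln R) a)).
Proof.
move=> a0; apply/matrixP => p q; rewrite rdiagE summxE.
have slotE i : slot i (rdiag (map_mx (@ln R) a)) p q =
    (ln (a 0 ((enum_val p : T) i)))%:C *+ (p == q).
  rewrite mxE (bigD1 i) //= eqxx rdiagE.
  have [->|pq] := eqVneq p q.
    rewrite eqxx mulr1n mxE big1 ?mulr1 // => j /negbTE ji.
    by rewrite ji mxE eqxx.
  have [j pqj] : exists i, (enum_val p : T) i != (enum_val q : T) i.
    apply/existsP; apply: contraNT pq; rewrite negb_exists => /forallP pq.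
    by apply/eqP/enum_val_inj/ffunP => j; apply/eqP; rewrite -[_ == _]negbK pq.
  have [ji|ji] := eqVneq j i; first by rewrite -ji (negbTE pqj) mul0r.
  rewrite (bigD1 j) //= [X in _ * (X * _)](_ : _ = 0) ?mul0r ?mulr0 //.
  by rewrite (negbTE ji) mxE (negbTE pqj).
rewrite (eq_bigr _ (fun i _ => slotE i)) sumrMnl -rmorph_sum mxE mxE.
by rewrite ln_prod.
Qed.

(** By ln_row_prod both sides of the equation for tensor powers are sums over
    the slots of the two sides of the original equation. *)
Lemma balanced_tensor (J : finType) (P Q : J -> 'M[C]_d) (a : J -> 'rV[R]_d) :
  balanced P Q a ->
  balanced (fun j => tensor_pow (P j)) (fun j => tensor_pow (Q j))
           (fun j => row_prod (a j)).
Proof.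
move=> [UP UQ a0 bal]; split.
- by move=> j; exact: tensor_pow_unitary.
- by move=> j; exact: tensor_pow_unitary.
- by move=> j k; rewrite mxE; apply: prodr_gt0 => i _.
pose L j := rdiag (map_mx (@ln R) (a j)).
transitivity (\sum_(i : I) slot i (\sum_j P j *m L j *m (P j) ^t*)).
  rewrite (eq_bigr (fun i : I => \sum_j slot i (P j *m L j *m (P j) ^t*))) => [|i _].
    rewrite exchange_big; apply: eq_bigr => j _ /=.
    rewrite ln_row_prod // mulmx_sumr mulmx_suml; apply: eq_bigr => i _.
    by rewrite tensor_pow_adj slot_conj //; exact/unitarymxP.
  exact: slot_sum.
rewrite bal (eq_bigr (fun i : I => \sum_j slot i ((Q j) ^t* *m L j *m Q j))) => [|i _].
  rewrite exchange_big; apply: eq_bigr => j _ /=.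
  rewrite ln_row_prod // mulmx_sumr mulmx_suml; apply: eq_bigr => i _.
  by rewrite tensor_pow_adj slot_conj // unitarymx_mulVmx.
exact: slot_sum.
Qed.

Definition mxconj n (h g : 'M[C]_n) := h *m g *m invmx h.

Lemma mxconjM n (h g g' : 'M[C]_n) : h \in unitmx ->
  mxconj h (g *m g') = mxconj h g *m mxconj h g'.
Proof. by move=> hu; rewrite /mxconj !mulmxA mulmxKV. Qed.

Lemma tensor_pow_conj h g : h \in unitmx ->
  tensor_pow (mxconj h g) = mxconj (tensor_pow h) (tensor_pow g).
Proof. by move=> hu; rewrite /mxconj invmx_tensor_pow // !tensor_powM. Qed.

Lemma mxconj_sum n (h : 'M[C]_n) (J : finType) (c : J -> C) (g : J -> 'M[C]_n) :
  mxconj h (\sum_j c j *: g j) = \sum_j c j *: mxconj h (g j).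
Proof.
rewrite /mxconj mulmx_sumr mulmx_suml; apply: eq_bigr => j _.
by rewrite -scalemxAr -scalemxAl.
Qed.

Variable S : set 'M[C]_d.
Hypothesis d0 : (0 < d)%N.
Hypothesis S_unit : forall g, S g -> g \in unitmx.
Hypothesis S_irr : forall h : 'M[C]_d, h != 0 ->
  (forall g, S g -> (h *m g <= h)%MS) -> h \in unitmx.

(** It suffices to balance finitely many elements of S: some that span the
    linear span of S, which keeps irreducibility, and some whose tensor powers
    span the tensor powers of S, through which the stability under adjoints
    extends to all of S. *)
Lemma tensor_pow_stable_adj : exists h, h \in unitmx /\
  forall W : 'M[C]_#|{: T}|,
    (forall g, S g -> (W *m tensor_pow (mxconj h g) <= W)%MS) ->
    forall g, S g -> (W *m (tensor_pow (mxconj h g)) ^t* <= W)%MS.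
Proof.
have [r1 [t1 [St1 t1P]]] := finite_spanning_matrices S (fun g : 'M[C]_d => g).
have [r2 [t2 [St2 t2P]]] := finite_spanning_matrices S tensor_pow.
pose f (i : 'I_r1 + 'I_r2) := match i with inl i => t1 i | inr i => t2 i end.
have Sf i : S (f i) by case: i.
have firr (h : 'M[C]_d) : h != 0 -> (forall i, (h *m f i <= h)%MS) -> h \in unitmx.
  move=> h0 hf; apply: S_irr => // g /t1P[c ->]; rewrite mulmx_sumr.
  by apply: summx_sub => i _; rewrite -scalemxAr scalemx_sub // (hf (inl i)).
have [h [P [Q [a [hu bal hE]]]]] := balanced_conjugate d0 (fun i => S_unit (Sf i)) firr.
exists h; split => // W WS g Sg.
have balT := balanced_tensor bal.
have hfE i : tensor_pow (P i) *m rdiag (row_prod (a i)) *m tensor_pow (Q i) =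
    tensor_pow (mxconj h (f i)).
  by rewrite -tensor_pow_rdiag -!tensor_powM -hE.
have adj i := balanced_stable_adj balT (W := W) _ i.
have {}adj i : (W *m (tensor_pow (mxconj h (f i))) ^t* <= W)%MS.
  by rewrite -hfE; apply: adj => j; rewrite hfE; exact: WS.
have [c gE] := t2P _ Sg.
have -> : (tensor_pow (mxconj h g)) ^t* =
    \sum_i ((c i)^*)%R *: (tensor_pow (mxconj h (t2 i))) ^t*.
  rewrite tensor_pow_conj // gE mxconj_sum.
  apply/matrixP => p q; rewrite adjE !summxE rmorph_sum; apply: eq_bigr => i _.
  by rewrite tensor_pow_conj // [in RHS]mxE adjE mxE rmorphM.
rewrite mulmx_sumr; apply: summx_sub => i _; rewrite -scalemxAr scalemx_sub //.
exact: (adj (inr i)).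
Qed.

End TensorBalanced.

(** * Traces control norms *)

Section TraceControl.
Variables (R : realType) (C : complexModel R) (I : finType) (d : nat).
Variables (B : eqType) (b : I -> B).
Local Notation "x %:C" := (model_cplx C x).
Local Notation T := {ffun I -> 'I_d}.
Local Notation tensor_pow := (@tensor_pow C I d).
Local Notation asym := (@antisym C I d B b).

Variable S : set 'M[C]_d.
Hypothesis d0 : (0 < d)%N.
Hypothesis S_unit : forall g, S g -> g \in unitmx.
Hypothesis S_irr : forall h : 'M[C]_d, h != 0 ->
  (forall g, S g -> (h *m g <= h)%MS) -> h \in unitmx.
Hypothesis S1 : S 1%:M.
Hypothesis SM : forall g h, S g -> S h -> S (g *m h).

(** The conjugate by h of the tensor powers of S, together with their products
    with antisym, form a monoid X to which trace_form_nondegenerate applies;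
    antisym is a hermitian idempotent that commutes with all of them. *)
Lemma antisym_trace_form (J : finType) (c : J -> C) (t : J -> 'M[C]_d) :
  (forall j, S (t j)) ->
  let a := \sum_j c j *: (tensor_pow (t j) *m asym) in
  (forall g, S g -> \tr (a *m tensor_pow g) = 0) -> a = 0.
Proof.
move=> St a tra.
have [h [hu hadj]] := tensor_pow_stable_adj I d0 S_unit S_irr.
pose H := tensor_pow h; have Hu : H \in unitmx by exact: tensor_pow_unit.
have aA : asym *m a = a.
  rewrite /a mulmx_sumr; apply: eq_bigr => j _.
  by rewrite -scalemxAr mulmxA antisymC -mulmxA antisym_idem.
have HA : mxconj H asym = asym.
  by rewrite /mxconj /H -antisymC mulmxK.
pose X : set 'M[C]_#|{: T}| := [set x | exists2 g, S g &
  x = tensor_pow (mxconj h g) \/ x = tensor_pow (mxconj h g) *m asym].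
have X1 : X 1%:M.
  by exists 1%:M => //; left; rewrite /mxconj mulmx1 mulmxV // tensor_pow1.
have AA x : x *m asym *m asym = x *m asym by rewrite -mulmxA antisym_idem.
have XM x y : X x -> X y -> X (x *m y).
  move=> [g Sg xE] [g' Sg' yE]; exists (g *m g'); first exact: SM.
  rewrite mxconjM // tensor_powM.
  case: xE => ->; case: yE => ->; [by left|right|right|right].
  - by rewrite mulmxA.
  - by rewrite -!mulmxA antisymC.
  - by rewrite -!mulmxA (mulmxA asym) antisymC -mulmxA antisym_idem.
have Xadj (W : 'M[C]_#|{: T}|) : (forall x, X x -> (W *m x <= W)%MS) ->
    forall x, X x -> (W *m x ^t* <= W)%MS.
  move=> WX; have WA : (W *m asym <= W)%MS.
    have := WX asym; apply; exists 1%:M => //; right.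
    by rewrite /mxconj mulmx1 mulmxV // tensor_pow1 mul1mx.
  have WT g : S g -> (W *m (tensor_pow (mxconj h g)) ^t* <= W)%MS.
    by apply: hadj => // g' Sg'; apply: WX; exists g' => //; left.
  move=> x [g Sg [->|->]]; first exact: WT.
  by rewrite adjM antisym_adj mulmxA (submx_trans (submxMr _ WA)) // WT.
have Xa : linear_span X (mxconj H a).
  rewrite /a mxconj_sum; have [X0 XD] := linear_set_linear_span X.
  apply: (big_ind (linear_span X)) => //.
    by move=> x y Xx Xy; rewrite -[x]scale1r; exact: XD.
  move=> j _; rewrite -[_ *: _]addr0; apply: XD => //.
  apply: sub_linear_span; exists (t j) => //; right.
  by rewrite mxconjM // HA tensor_pow_conj.
have := trace_form_nondegenerate X1 XM Xadj Xa.
have trconj x y : \tr (mxconj H x *m mxconj H y) = \tr (x *m y).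
  by rewrite -mxconjM // /mxconj mxtrace_mulC mulKmx.
move=> nd; have /nd : forall x, X x -> \tr (mxconj H a *m x) = 0.
  move=> x [g Sg [->|->]]; rewrite tensor_pow_conj // -?/H.
    by rewrite trconj tra.
  rewrite -HA -mxconjM // trconj mulmxA mxtrace_mulC mulmxA aA tra //.
have Hi : invmx H \in unitmx by rewrite unitmx_inv.
move=> Ha; apply: (can_inj (mulKmx Hu)); apply: (can_inj (mulmxK Hi)).
by rewrite -/(mxconj H a) Ha mulmx0 mul0mx.
Qed.

(** Let v i = tensor_pow (t i) *m antisym be a finite spanning family. By
    nondegeneracy a linear combination c of the v i vanishes as soon as its
    products with all tensor_pow (t l) have trace 0, i.e. as soon as c *m Z =
    0 for the matrix Z of these traces. So the map from coefficients to
    matrices factors linearly through Z. *)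
Lemma trace_controls_size : exists r (t : 'I_r -> 'M[C]_d) (K : R),
  (forall i, S (t i)) /\ forall g, S g ->
  mxsize (tensor_pow g *m asym) <=
    K * \sum_i cabs (\tr (tensor_pow (g *m t i) *m asym)).
Proof.
have [r [t [St tP]]] := finite_spanning_matrices S (fun g => tensor_pow g *m asym).
pose v i := tensor_pow (t i) *m asym.
pose Bm : 'M[C]_(r, _) := \matrix_i mxvec (v i).
pose Z : 'M[C]_r := \matrix_(i, l) \tr (v i *m tensor_pow (t l)).
have rowB (c : 'rV[C]_r) : vec_mx (c *m Bm) = \sum_i c 0 i *: v i.
  rewrite mulmx_sum_row linear_sum; apply: eq_bigr => i _.
  by rewrite rowK linearZ /= mxvecK.
have asymK x g : x *m asym *m (tensor_pow g *m asym) = x *m asym *m tensor_pow g.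
  by rewrite -antisymC -!mulmxA (mulmxA asym asym) antisym_idem.
have vA (c : 'I_r -> C) : (\sum_i c i *: v i) *m asym = \sum_i c i *: v i.
  rewrite mulmx_suml; apply: eq_bigr => i _.
  by rewrite -scalemxAl /v -mulmxA antisym_idem.
have trZ (c : 'rV[C]_r) l :
    \tr ((\sum_i c 0 i *: v i) *m tensor_pow (t l)) = (c *m Z) 0 l.
  rewrite mulmx_suml mxE [LHS]raddf_sum; apply: eq_bigr => i _.
  by rewrite mxE -mxtraceZ scalemxAl.
have ker0 (c : 'rV[C]_r) : c *m Z = 0 -> c *m Bm = 0.
  move=> cZ; apply: (can_inj vec_mxK); rewrite rowB linear0.
  apply: (antisym_trace_form St) => g Sg; set a := \sum_i _.
  have aA : a *m asym = a by exact: vA.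
  have [c' gE] := tP _ Sg.
  rewrite -aA -asymK gE mulmx_sumr [LHS]raddf_sum big1 // => l _ /=.
  by rewrite -scalemxAr asymK aA mxtraceZ trZ cZ mxE mulr0.
(* as ker Z is contained in ker Bm, the partial inverse factors Bm *)
pose Y := pinvmx Z *m Bm.
have BZ : Bm = Z *m Y.
  apply/eqP; rewrite -subr_eq0 -{1}[Bm]mul1mx /Y mulmxA -mulmxBl; apply/eqP.
  apply/row_matrixP => i; rewrite row0 row_mul; apply: ker0.
  by rewrite -row_mul mulmxBl mul1mx mulmxKpV // subrr row0.
exists r, t, (\sum_l mxsize (vec_mx (row l Y))); split => // g Sg.
have [c gE] := tP _ Sg; pose c1 := \row_i c i.
have gE1 : tensor_pow g *m asym = \sum_i c1 0 i *: v i.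
  by rewrite gE; apply: eq_bigr => i _; rewrite mxE.
have uE l : \tr (tensor_pow (g *m t l) *m asym) = (c1 *m Z) 0 l.
  by rewrite -trZ -gE1 tensor_powM -mulmxA -antisymC mulmxA.
rewrite gE1 -rowB BZ mulmxA mulmx_sum_row linear_sum.
apply: le_trans (mxsize_sum _ _) _; rewrite mulr_sumr; apply: ler_sum => l _.
rewrite linearZ mxsizeZ uE mulrC ler_wpM2r ?cabs_ge0 //.
rewrite (bigD1 l) //= lerDl; apply: sumr_ge0 => k _; exact: mxsize_ge0.
Qed.

End TraceControl.

(** * Singular values and exterior powers *)

Section TensorSize.
Variables (R : realType) (C : complexModel R) (d : nat).
Local Notation "x %:C" := (model_cplx C x).
Local Notation rdiag := (@rdiag R C _).

Lemma injective_sum_le (m : 'I_d) (l : 'I_d -> R) (f : 'I_m.+1 -> 'I_d) :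
  (forall i j : 'I_d, (i <= j)%N -> l j <= l i) -> injective f ->
  \sum_j l (f j) <= \sum_(i < d | (i < m.+1)%N) l i.
Proof.
move=> lmon finj; pose w i : R := (i \in (f @: [set: _])%SET)%:R.
have sumf (F : 'I_d -> R) : \sum_j F (f j) = \sum_i F i * w i.
  transitivity (\sum_(i in (f @: [set: _])%SET) F i).
    by rewrite big_imset /=; [apply: eq_bigl => j; rewrite inE|move=> ? ? _ _; exact: finj].
  rewrite big_mkcond; apply: eq_bigr => i _; rewrite /w.
  by case: (_ \in _); rewrite ?mulr1 ?mulr0.
rewrite sumf; apply: (@weighted_sum_le _ _ _ _ (l m)).
- by move=> i; rewrite /w; case: (_ \in _); rewrite ?lexx ?ler01.
- have := sumf (fun=> 1).
  rewrite (eq_bigr w) => [|i _]; last by rewrite mul1r.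
  move=> <-; rewrite (big_ord_narrow (ltn_ord m)) //.
- by move=> i im; exact: lmon.
- by move=> i; rewrite -leqNgt => im; apply: lmon; exact: ltnW.
Qed.

Variables (B : finType) (k : B -> 'I_d).
Local Notation I := {x : B & 'I_(k x).+1}.
Local Notation T := {ffun I -> 'I_d}.
Local Notation tensor_pow := (@tensor_pow C I d).
Local Notation asym := (@antisym C I d B (fun i => tag i)).

(** The logarithm of the norm of g on the m-th exterior power, up to a bounded
    error. *)
Definition kappa_sum (m : nat) (g : 'M[C]_d) : R := \sum_(j < d | (j < m)%N) kappaC g 0 j.

(** In the bases of a singular value decomposition, tensor_pow g multiplies a
    basis tensor p by the product of the singular values a (p i). If p takes a
    value twice in a block, antisym kills it (antisym_eq0); otherwise the
    product is at most the product of the first singular values in each block.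
    The tensor p0 attains this bound, and the diagonal entry of antisym there
    is not 0 (antisym_diag). *)
Lemma tensor_size : exists c1 c2 : R, [/\ 0 < c1, 0 < c2 & forall g, g \in unitmx ->
  c1 * expR (\sum_x kappa_sum (k x).+1 g) <= mxsize (tensor_pow g *m asym)
    <= c2 * expR (\sum_x kappa_sum (k x).+1 g)].
Proof.
(* in each block x, the indices 0, ..., k x, each once *)
pose p0 : T := [ffun i => widen_ord (ltn_ord (k (tag i))) (tagged i)].
have p0_inj i j : tag i = tag j -> p0 i = p0 j -> i = j.
  case: i j => [x i] [y j] /= xy; subst y; rewrite !ffunE /= => /(congr1 val) /= ij.
  by congr existT; exact: val_inj.
pose N : R := (#|{: T}| * #|{: T}|)%:R; have N0 : 0 <= N by [].
pose c : R := (#|block_perm (fun i : I => tag i)|%:R)^-1.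
have c0 : 0 < c.
  rewrite invr_gt0 ltr0n; apply/card_gt0P; exists 1%g; exact: block_perm1.
exists (c / (1 + N * N)), (1 + N * mxsize asym * N); split.
- by rewrite divr_gt0 // ltr_pwDl // mulr_ge0.
- by rewrite ltr_pwDl // !mulr_ge0 // mxsize_ge0.
move=> g gu; set M := expR _; have [P [Q [a [UP UQ gE [a0 amon] ka]]]] := singular_value_decomposition gu.
have UtP := tensor_pow_unitary I UP; have UtQ := tensor_pow_unitary I UQ.
have sumI (F : I -> R) : \sum_i F i = \sum_x \sum_(j < (k x).+1) F (Tagged (fun x => 'I_(k x).+1) j).
  by rewrite sig_big_dep /=; apply: eq_bigr => -[x j] _.
have prodE (p : T) : \prod_i a 0 (p i) = expR (\sum_i ln (a 0 (p i))).
  by rewrite -ln_prod // lnK // posrE prodr_gt0.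
have ME : \prod_i a 0 (p0 i) = M.
  rewrite prodE sumI; congr expR; apply: eq_bigr => x _.
  rewrite /kappa_sum (big_ord_narrow (ltn_ord (k x))) /=.
  by apply: eq_bigr => j _; rewrite ffunE ka.
have Mmax (p : T) : (forall i j, tag i = tag j -> p i = p j -> i = j) ->
    \prod_i a 0 (p i) <= M.
  move=> pinj; rewrite prodE ler_expR sumI; apply: ler_sum => x _.
  apply: (le_trans (@injective_sum_le (k x) (fun l => ln (a 0 l))
    (fun j => p (Tagged (fun x => 'I_(k x).+1) j)) _ _)).
  - by move=> i j ij; rewrite ler_ln ?posrE //; exact: amon.
  - move=> i j /pinj => /(_ erefl) /eqP; rewrite -tag_eqE /tag_eq /= eqxx /= tagged_asE.
    by move/eqP.
  - by apply: ler_sum => j _; rewrite ka.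
have M0 : 0 <= M by exact: expR_ge0.
pose D := rdiag (row_prod I a) *m asym.
have gD : tensor_pow g *m asym = tensor_pow P *m D *m tensor_pow Q.
  by rewrite gE !tensor_powM tensor_pow_rdiag /D -!mulmxA antisymC.
have Dg : D = (tensor_pow P) ^t* *m (tensor_pow g *m asym) *m (tensor_pow Q) ^t*.
  rewrite gD !mulmxA (unitarymx_mulVmx UtP) mul1mx -(mulmxA _ _ (_ ^t*)).
  by rewrite (unitarymxP UtQ) mulmx1.
have DE p q : D p q = (\prod_i a 0 ((enum_val p : T) i))%:C * asym p q.
  by rewrite /D mul_diag_mx mxE [(map_mx _ _) _ _]mxE [(row_prod I a) _ _]mxE.
have UPs : mxsize (tensor_pow P) <= N by exact: mxsize_unitary.
have UQs : mxsize (tensor_pow Q) <= N by exact: mxsize_unitary.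
clearbody D M N; apply/andP; split.
  have lo : c * M <= mxsize D.
    apply: le_trans (cabs_le_mxsize D (enum_rank p0) (enum_rank p0)).
    rewrite DE enum_rankK ME antisym_diag // cabsM !cabs_real ger0_norm // mulrC.
    rewrite -(rmorph_nat (model_cplx C)) -fmorphV cabs_real ger0_norm // invr_ge0 //.
  have up : mxsize D <= N * mxsize (tensor_pow g *m asym) * N.
    rewrite Dg; apply: le_trans (mxsizeM _ _) _.
    rewrite ler_pM ?mxsize_ge0 ?mxsize_adj //.
    by apply: le_trans (mxsizeM _ _) _; rewrite ler_pM ?mxsize_ge0 ?mxsize_adj.
  rewrite mulrAC ler_pdivrMr ?ltr_pwDl ?mulr_ge0 //.
  apply: le_trans lo _; apply: le_trans up _.
  have := mxsize_ge0 (tensor_pow g *m asym); move: (mxsize _) => y y0.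
  have -> : y * (1 + N * N) = N * y * N + y by ring.
  by rewrite lerDl.
rewrite gD; apply: le_trans (mxsizeM _ _) _.
apply: (@le_trans _ _ (N * (M * mxsize asym) * N)); last first.
  move: (mxsize asym) => y.
  have -> : (1 + N * y * N) * M = N * (M * y) * N + M by ring.
  by rewrite lerDl.
rewrite ler_pM ?mxsize_ge0 //; apply: le_trans (mxsizeM _ _) _.
rewrite ler_pM ?mxsize_ge0 // /mxsize mulr_sumr; apply: ler_sum => p _.
rewrite mulr_sumr; apply: ler_sum => q _; rewrite DE cabsM cabs_real.
have [pinj|] := pselect (forall i j : I, tag i = tag j ->
    (enum_val p : T) i = (enum_val p : T) j -> i = j).
  rewrite ler_wpM2r ?cabs_ge0 // ger0_norm; first exact: Mmax.
  by apply: prodr_ge0 => i _; exact: ltW.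
move=> /existsNP[i /existsNP[j /not_implyP[ij /not_implyP[pij /eqP nij]]]].
by rewrite (@antisym_eq0 C I d B _ p q i j nij ij pij) cabs0 !mulr0.
Qed.

End TensorSize.

(** * Growth of powers *)

Section Growth.
Variables (R : realType) (C : complexModel R).
Local Notation "x %:C" := (model_cplx C x).

(** The trace is the sum of the n eigenvalues; take l of largest modulus. *)
Lemma eigenvalue_ge_trace n (A : 'M[C]_n) : (0 < n)%N ->
  exists l (v : 'rV[C]_n), [/\ v != 0, v *m A = l *: v &
    cabs (\tr A) <= n%:R * cabs l].
Proof.
move=> n0; have [r rE] := closed_field_poly_normal (char_poly A).
rewrite (monicP (char_poly_monic A)) scale1r in rE.
have szr : size r = n.
  by have := size_char_poly A; rewrite rE size_prod_XsubC => -[].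
have trE : \tr A = \sum_(z <- r) z.
  apply: oppr_inj; rewrite -char_poly_trace // rE -szr coefPn_prod_XsubC //.
  by rewrite szr lt0n_neq0.
have [l lr lmax] : exists2 l, l \in r & forall z, z \in r -> cabs z <= cabs l.
  have : (0 < size r)%N by rewrite szr.
  elim: r {rE szr trE} => [//|x [|y s] IH] _.
    by exists x; rewrite ?mem_head // => z; rewrite inE => /eqP ->.
  have [l lr lmax] := IH isT; have [xl|lx] := leP (cabs x) (cabs l).
    exists l; first by rewrite in_cons lr orbT.
    by move=> z; rewrite in_cons => /orP[/eqP -> //|]; exact: lmax.
  exists x; first exact: mem_head.
  move=> z; rewrite in_cons => /orP[/eqP -> //|zs].
  by apply: le_trans (lmax _ zs) _; exact: ltW.
have trle : cabs (\tr A) <= n%:R * cabs l.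
  rewrite trE (le_trans (cabs_sum _ _ _)) // big_seq.
  apply: (@le_trans _ _ (\sum_(z <- r | z \in r) cabs l)); first exact: ler_sum.
  by rewrite -big_seq big_const_seq count_predT szr iter_addr_0 mulr_natl.
have : root (char_poly A) l by rewrite rE root_prod_XsubC.
rewrite -eigenvalue_root_char => /eigenvalueP[v vA v0].
by exists l, v.
Qed.

Lemma cabs_eigenvalue_pow n (A : 'M[C]_n) (l : C) (v : 'rV[C]_n) p :
  v != 0 -> v *m A = l *: v -> cabs l ^+ p <= mxsize (A ^+ p).
Proof.
move=> v0 vA; have vAp : v *m A ^+ p = l ^+ p *: v.
  elim: p => [|p IH]; first by rewrite !expr0 scale1r mulmx1.
  by rewrite exprS -mulmxE mulmxA vA -scalemxAl IH scalerA -exprS.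
have vs : 0 < mxsize v.
  rewrite lt_def mxsize_ge0 andbT; apply/negP => /eqP/mxsize_eq0 v0'.
  by rewrite v0' eqxx in v0.
rewrite -(ler_pM2r vs) -cabsX -mxsizeZ -vAp mulrC; exact: mxsizeM.
Qed.

Variable d : nat.
Local Notation ksum := (@kappa_sum R C d).

(** Apply tensor_size with a single block of m slots: the size of tensor_pow g
    *m antisym is submultiplicative in g, because antisym is an idempotent
    that commutes with tensor powers. *)
Lemma kappa_sum_submul : exists K, forall m (g h : 'M[C]_d), (m <= d)%N ->
  g \in unitmx -> h \in unitmx -> ksum m (g *m h) <= ksum m g + ksum m h + K.
Proof.
have step (k : 'I_d) : exists K, forall (g h : 'M[C]_d), g \in unitmx -> h \in unitmx ->
    ksum k.+1 (g *m h) <= ksum k.+1 g + ksum k.+1 h + K.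
  have [c1 [c2 [c1_gt0 c2_gt0 H]]] := tensor_size C (fun _ : unit => k).
  exists (ln (c2 ^+ 2 / c1)) => g h gu hu.
  have sumu (F : unit -> R) : \sum_x F x = F tt by rewrite (bigD1 tt) //= big1 ?addr0 // => -[].
  have Hg := H g gu; have Hh := H h hu; have ghu : g *m h \in unitmx by rewrite unitmx_mul gu.
  have Hgh := H _ ghu; rewrite !sumu in Hg Hh Hgh.
  move: Hg Hh Hgh => /andP[_ gle] /andP[_ hle] /andP[ghle _].
  have c0 : 0 < c2 ^+ 2 / c1 by rewrite divr_gt0 // exprn_gt0.
  rewrite -ler_expR !expRD lnK ?posrE //.
  rewrite -(ler_pM2l c1_gt0); apply: le_trans ghle _.
  rewrite tensor_powM -[X in _ *m X *m _]/(tensor_pow _ _).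
  rewrite -(antisym_idem C _ (fun i => tag i)) !mulmxA -(mulmxA (tensor_pow _ g)).
  rewrite -antisymC mulmxA -mulmxA; apply: le_trans (mxsizeM _ _) _.
  apply: le_trans (ler_pM (mxsize_ge0 _) (mxsize_ge0 _) gle hle) _.
  rewrite le_eqVlt; apply/orP; left; apply/eqP; field.
  by rewrite gt_eqF.
have /choice[K KP] := step.
exists (\sum_k `|K k|) => m g h; case: m => [|m] md gu hu.
  by rewrite /kappa_sum !big_pred0_eq !add0r sumr_ge0.
have := KP (Ordinal md) g h gu hu; rewrite /= => le; apply: le_trans le _.
rewrite lerD2l (le_trans (ler_norm _)) // (bigD1 (Ordinal md)) //= lerDl.
exact: sumr_ge0.
Qed.

(** The logarithm of the norm of g on the tensor product of all exterior
    powers, up to a bounded error. *)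
Definition kappa_total (g : 'M[C]_d) : R := \sum_(k < d) ksum k.+1 g.

Section Monoid.
Variable S : set 'M[C]_d.
Hypothesis d0 : (0 < d)%N.
Hypothesis S_unit : forall g, S g -> g \in unitmx.
Hypothesis S_irr : forall h : 'M[C]_d, h != 0 ->
  (forall g, S g -> (h *m g <= h)%MS) -> h \in unitmx.
Hypothesis S1 : S 1%:M.
Hypothesis SM : forall g h, S g -> S h -> S (g *m h).

(** Some trace of tensor_pow (g *m t i) *m antisym is of the order of the size
    of tensor_pow g *m antisym (trace_controls_size), so this matrix has an
    eigenvalue of that order (eigenvalue_ge_trace). The powers of the
    eigenvalue bound the sizes of the powers of the matrix from below. *)
Lemma kappa_total_pow : exists r (t : 'I_r -> 'M[C]_d) (K : R),
  (forall i, S (t i)) /\ forall g, S g -> exists i, forall p,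
    p.+1%:R * kappa_total g - p.+1%:R * K <= kappa_total ((g *m t i) ^+ p.+1).
Proof.
pose k (x : 'I_d) := x.
have [c1 [c2 [c1_gt0 c2_gt0 H]]] := tensor_size C k.
have [r [t [K [St tK]]]] := trace_controls_size
  (fun i : {x : 'I_d & 'I_(k x).+1} => tag i) d0 S_unit S_irr S1 SM.
pose I := {x : 'I_d & 'I_(k x).+1}; pose A := @antisym C I d _ (fun i => tag i).
pose N := #|{: {ffun I -> 'I_d}}|.
have N0 : (0 < N)%N.
  by apply/card_gt0P; exists [ffun=> Ordinal d0].
have AX (h : 'M[C]_d) p : (tensor_pow I h *m A) ^+ p.+1 = tensor_pow I (h ^+ p.+1) *m A.
  elim: p => [|p IH]; first by rewrite !expr1.
  rewrite exprS IH -mulmxE -!mulmxA (mulmxA A) antisymC -(mulmxA _ A) antisym_idem.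
  by rewrite mulmxA -tensor_powM [in RHS]exprS.
(* r comes from choosing one of the r traces, N from choosing one of the N
   eigenvalues, and 1 makes L positive *)
pose L := `|K| * r%:R * N%:R + 1.
have L0 : 0 < L by rewrite ltr_wpDl // !mulr_ge0.
exists r, t, (ln (L / c1) + `|ln c2|); split => // g Sg.
have gu := S_unit Sg; have /andP[glow _] := H g gu.
pose w i := cabs (\tr (tensor_pow I (g *m t i) *m A)).
have w0 i : 0 <= w i by exact: cabs_ge0.
have glow' : c1 * expR (kappa_total g) <= K * \sum_i w i.
  by apply: le_trans glow _; exact: tK.
have [i wi] : exists i, c1 * expR (kappa_total g) <= `|K| * r%:R * w i.
  apply: contrapT => noi; have lt i : `|K| * r%:R * w i < c1 * expR (kappa_total g).
    by rewrite ltNge; apply/negP => le; apply: noi; exists i.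
  case: r t St tK w w0 glow' noi lt {L L0} => [|r] t St tK w w0 glow' noi lt.
    by move: glow'; rewrite big_ord0 mulr0 leNgt mulr_gt0 // expR_gt0.
  have : \sum_(i < r.+1) `|K| * r.+1%:R * w i < \sum_(i < r.+1) c1 * expR (kappa_total g).
    apply: ltr_sum => //; apply/hasP; exists ord0; rewrite ?mem_index_enum //.
  rewrite -mulr_sumr sumr_const card_ord -[X in _ < X]mulr_natl => lt'.
  have {}lt' : `|K| * \sum_i w i < c1 * expR (kappa_total g).
    rewrite -(ltr_pM2l (ltr0Sn R r)); apply: le_lt_trans lt'.
    by rewrite le_eqVlt; apply/orP; left; apply/eqP; ring.
  suff : c1 * expR (kappa_total g) < c1 * expR (kappa_total g) by rewrite ltxx.
  apply: le_lt_trans glow' _; apply: le_lt_trans lt'.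
  rewrite ler_wpM2r ?ler_norm //.
  exact: sumr_ge0.
exists i => p; set h := g *m t i.
have hu : h \in unitmx by rewrite unitmx_mul gu S_unit.
have hpu : h ^+ p.+1 \in unitmx.
  by elim: p => [|p IH]; rewrite ?expr1 // exprS -mulmxE unitmx_mul hu.
have [l [v [v0 vA tr_le]]] := eigenvalue_ge_trace (tensor_pow I h *m A) N0.
have /andP[_ up] := H _ hpu.
have lp := cabs_eigenvalue_pow p.+1 v0 vA; rewrite AX in lp.
have base : c1 * expR (kappa_total g) / L <= cabs l.
  rewrite ler_pdivrMr //; apply: le_trans wi _.
  apply: (@le_trans _ _ (`|K| * r%:R * (N%:R * cabs l))); first by rewrite ler_wpM2l.
  by rewrite mulrA mulrC ler_wpM2l ?cabs_ge0 // lerDl.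
have : (c1 * expR (kappa_total g) / L) ^+ p.+1 <= c2 * expR (kappa_total (h ^+ p.+1)).
  apply: le_trans up; apply: le_trans lp.
  rewrite ler_pXn2r ?nnegrE ?cabs_ge0 // divr_ge0 ?mulr_ge0 ?expR_ge0 // ltW //.
have q0 : 0 < c1 * expR (kappa_total g) / L by rewrite divr_gt0 // mulr_gt0 // expR_gt0.
move=> le0; have : ln ((c1 * expR (kappa_total g) / L) ^+ p.+1) <=
    ln (c2 * expR (kappa_total (h ^+ p.+1))).
  by rewrite ler_ln ?posrE ?exprn_gt0 // mulr_gt0 // expR_gt0.
rewrite lnXn // (lnM (x := c2)) ?posrE ?expR_gt0 // ln_div ?posrE ?mulr_gt0 ?expR_gt0 //.
rewrite lnM ?posrE ?expR_gt0 // !expRK ln_div ?posrE // => le.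
rewrite -[X in X <= _]mulr_natl in le.
have p1 : 1 <= p.+1%:R :> R by rewrite ler1n.
have c2n := ler_norm (ln c2).
have : `|ln c2| <= p.+1%:R * `|ln c2| by rewrite ler_peMl.
move: le c2n; move: (kappa_total g) (kappa_total _) (ln c1) (ln c2) (ln L) `|_|.
by move: (p.+1%:R); clear=> q x y z e f v1; lra.
Qed.
End Monoid.
End Growth.

(** * Product sets *)

Section ProductSets.
Variables (R : realType) (C : complexModel R) (d : nat).
Local Notation ksum := (@kappa_sum R C d).
Implicit Types (S : set 'M[C]_d).

(** The same formula as product_set, for matrices over any model of the
    complex numbers. *)
Definition prodset S (n : nat) : set 'M[C]_d :=
  [set \prod_(j < n) s j | s in [set s : 'I_n -> 'M[C]_d | forall j, S (s j)]].

Lemma prodset0 S : prodset S 0 1%:M.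
Proof. by exists (fun=> 1%:M) => [[]//|]; rewrite big_ord0. Qed.

Lemma prodset1 S g : S g -> prodset S 1 g.
Proof. by move=> Sg; exists (fun=> g) => //; rewrite big_ord1. Qed.

Lemma prodsetM S m n g h : prodset S m g -> prodset S n h -> prodset S (m + n) (g *m h).
Proof.
move=> [s Ss <-] [t St <-].
exists (fun j => match fintype.split j with inl i => s i | inr i => t i end) => [j /=|].
  by case: (fintype.split j).
rewrite big_split_ord /= mulmxE; congr (_ * _); apply: eq_bigr => i _.
  by case: splitP => j /= ij; [congr s; exact: val_inj|have := ltn_ord i; rewrite ij ltnNge leq_addr].
case: splitP => j /= ij; first by have := ltn_ord j; rewrite -ij ltnNge leq_addr.
by congr t; apply: val_inj; move/eqP: ij; rewrite eqn_add2l => /eqP.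
Qed.

Lemma prodsetX S n g p : prodset S n g -> prodset S (p * n) (g ^+ p).
Proof.
move=> Sg; elim: p => [|p IH]; first by rewrite mul0n expr0; exact: prodset0.
by rewrite mulSn exprS -mulmxE; exact: prodsetM.
Qed.

Lemma prodset_ind S (P : nat -> 'M[C]_d -> Prop) : P 0%N 1%:M ->
  (forall n g s, prodset S n g -> P n g -> S s -> P n.+1 (g *m s)) ->
  forall n g, prodset S n g -> P n g.
Proof.
move=> P0 PS; elim=> [|n IH] g [s Ss <-]; first by rewrite big_ord0.
rewrite big_ord_recr /= -mulmxE; have Sn : prodset S n (\prod_(i < n) s (widen_ord (leqnSn n) i)).
  by exists (fun i => s (widen_ord (leqnSn n) i)) => // j; exact: Ss.
by apply: PS; [exact: Sn|exact: IH|exact: Ss].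
Qed.

Lemma kappa_sumS (k : 'I_d) g : ksum k.+1 g = ksum k g + kappaC g 0 k.
Proof.
rewrite /kappa_sum (bigD1 k) //= addrC; congr (_ + _); apply: eq_bigl => l.
by rewrite ltnS ltn_neqAle andbC.
Qed.

Lemma kappa_sum0 g : ksum 0 g = 0.
Proof. by rewrite /kappa_sum big_pred0_eq. Qed.

Lemma kappa_sum_le (c : R) m g : 0 <= c -> (forall k, `|kappaC g 0 k| <= c) ->
  `|ksum m g| <= d%:R * c.
Proof.
move=> c0 gc; rewrite /kappa_sum (le_trans (ler_norm_sum _ _ _)) //.
rewrite (@le_trans _ _ (\sum_(j < d) `|kappaC g 0 j|)) //.
  by rewrite [leRHS](bigID (fun j : 'I_d => (j < m)%N)) /= lerDl sumr_ge0.
rewrite (@le_trans _ _ (\sum_(j < d) c)) ?ler_sum //.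
by rewrite sumr_const card_ord mulr_natl.
Qed.

Lemma kappa_le_mxsize (b : R) (g : 'M[C]_d) k : g \in unitmx -> mxsize g <= b ->
  kappaC g 0 k <= ln (((d * d) ^ 2)%:R * b).
Proof.
move=> gu gb; have [P [Q [a [UP UQ gE [a0 _] ka]]]] := singular_value_decomposition gu.
have aE : P ^t* *m g *m Q ^t* = rdiag C a.
  rewrite gE !mulmxA (unitarymx_mulVmx UP) mul1mx -mulmxA (unitarymxP UQ) mulmx1 //.
have le : a 0 k <= ((d * d) ^ 2)%:R * b.
  apply: (@le_trans _ _ (((d * d) ^ 2)%:R * mxsize g)); last by rewrite ler_wpM2l.
  have := cabs_le_mxsize (P ^t* *m g *m Q ^t*) k k.
  rewrite {1}aE rdiagE eqxx mulr1n cabs_real gtr0_norm // => /le_trans; apply.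
  apply: le_trans (mxsizeM _ _) _; rewrite natrX expr2 mulrAC.
  rewrite ler_pM ?mxsize_ge0 ?mxsize_adj ?mxsize_unitary //.
  apply: le_trans (mxsizeM _ _) _; rewrite ler_wpM2r ?mxsize_ge0 //.
  by rewrite mxsize_adj mxsize_unitary.
by rewrite ka ler_ln ?posrE // (lt_le_trans (a0 k)).
Qed.

(** The singular values of the inverse are the inverses of the singular
    values. *)
Lemma kappa_inv_le (c : R) : exists c', 0 <= c' /\ forall g : 'M[C]_d, g \in unitmx ->
  (forall k, `|kappaC g 0 k| <= c) -> forall k, kappaC (invmx g) 0 k <= c'.
Proof.
exists `|ln (((d * d) ^ 2)%:R * ((d * d)%:R * (d%:R * expR c) * (d * d)%:R))|.
split=> // g gu gc k; have [P [Q [a [UP UQ gE [a0 _] ka]]]] := singular_value_decomposition gu.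
pose b := \row_j (a 0 j)^-1.
have ab : rdiag C b *m rdiag C a = 1%:M.
  rewrite rdiagM -[RHS](rdiag1 C d); congr (rdiag C _); apply/rowP => j.
  by rewrite !mxE mulVf // gt_eqF.
have giE : invmx g = Q ^t* *m rdiag C b *m P ^t*.
  apply: (can_inj (mulmxK gu)); rewrite mulVmx // gE.
  rewrite -!mulmxA (mulmxA (P ^t*)) (unitarymx_mulVmx UP) mul1mx.
  by rewrite (mulmxA (rdiag C b)) ab mul1mx (unitarymx_mulVmx UQ).
have giu : invmx g \in unitmx by rewrite unitmx_inv.
have gib : mxsize (invmx g) <= (d * d)%:R * (d%:R * expR c) * (d * d)%:R.
  rewrite giE; apply: le_trans (mxsizeM _ _) _.
  rewrite ler_pM ?mxsize_ge0 ?mxsize_adj ?mxsize_unitary //.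
  apply: le_trans (mxsizeM _ _) _.
  rewrite ler_pM ?mxsize_ge0 ?mxsize_adj ?mxsize_unitary //.
  rewrite /mxsize mulr_natl -[X in _ *+ X]card_ord -sumr_const; apply: ler_sum => i _.
  rewrite (bigD1 i) //= big1 => [|j ji]; last by rewrite rdiagE eq_sym (negbTE ji) cabs0.
  rewrite addr0 rdiagE eqxx mulr1n cabs_real mxE gtr0_norm ?invr_gt0 //.
  rewrite -[(a 0 i)^-1]lnK ?posrE ?invr_gt0 // ler_expR lnV ?posrE // -ka.
  by apply: le_trans (ler_norm _) _; rewrite normrN.
exact: le_trans (kappa_le_mxsize k giu gib) (ler_norm _).
Qed.

End ProductSets.

(** * The recurrence property *)

Section Dynamics.
Variables (R : realType) (C : complexModel R) (d : nat).
Local Notation ksum := (@kappa_sum R C d).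
Variables (S : set 'M[C]_d) (c : R).
Hypothesis d0 : (0 < d)%N.
Hypothesis S_unit : forall g, S g -> g \in unitmx.
Hypothesis S_irr : forall h : 'M[C]_d, h != 0 ->
  (forall g, S g -> (h *m g <= h)%MS) -> h \in unitmx.
Hypothesis S_kappa : forall g, S g -> forall k, `|kappaC g 0 k| <= c.
Hypothesis S0 : S !=set0.

Lemma prodset_unit n g : prodset S n g -> g \in unitmx.
Proof.
apply: (@prodset_ind _ _ _ S (fun _ g => g \in unitmx)); first exact: unitmx1.
by move=> {}n {}g s _ gu Ss; rewrite unitmx_mul gu S_unit.
Qed.

Lemma mulmxX_unit (g : 'M[C]_d) p : g \in unitmx -> g ^+ p \in unitmx.
Proof.
move=> gu; elim: p => [|p IH]; first by rewrite expr0; exact: unitmx1.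
by rewrite exprS -mulmxE unitmx_mul gu.
Qed.

(** Both multiplication by s and its undoing by the inverse of s are
    controlled by kappa_sum_submul, as kappa is bounded on S and on the
    inverses of its elements. *)
Lemma kappa_sum_step : exists K, 0 <= K /\ forall x s m, x \in unitmx -> S s ->
  (m <= d)%N -> `|ksum m (x *m s) - ksum m x| <= K /\ `|ksum m s| <= K.
Proof.
have [K1 K1P] := kappa_sum_submul C d; have [c' [c'0 c'P]] := kappa_inv_le C d c.
have c0 : 0 <= c.
  by have [s Ss] := S0; apply: le_trans (S_kappa Ss (Ordinal d0)).
have dc : 0 <= d%:R * c by rewrite mulr_ge0.
have dc' : 0 <= d%:R * c' by rewrite mulr_ge0.
exists (d%:R * c + d%:R * c' + `|K1|); split; first by rewrite !addr_ge0.
move=> x s m xu Ss md; have su := S_unit Ss.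
have s1 : `|ksum m s| <= d%:R * c by apply: kappa_sum_le => //; exact: S_kappa.
have s2 : ksum m (invmx s) <= d%:R * c'.
  rewrite /kappa_sum (@le_trans _ _ (\sum_(j < d | (j < m)%N) c')) //.
    by apply: ler_sum => j _; apply: c'P => //; exact: S_kappa.
  rewrite (@le_trans _ _ (\sum_(j < d) c')) //.
    by rewrite [leRHS](bigID (fun j : 'I_d => (j < m)%N)) /= lerDl sumr_ge0.
  by rewrite sumr_const card_ord mulr_natl.
have K1n := ler_norm K1; have K10 := normr_ge0 K1.
split; last lra.
have siu : invmx s \in unitmx by rewrite unitmx_inv.
have xsu : x *m s \in unitmx by rewrite unitmx_mul xu.
have le1 := K1P m x s md xu su.
have le2 := K1P m (x *m s) (invmx s) md xsu siu; rewrite mulmxK // in le2.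
by move: s1; rewrite !ler_norml => /andP[s3 s4]; apply/andP; split; lra.
Qed.

Lemma kappa_sum_pad K : (forall x s m, x \in unitmx -> S s ->
    (m <= d)%N -> `|ksum m (x *m s) - ksum m x| <= K /\ `|ksum m s| <= K) ->
  forall x s m r, x \in unitmx -> S s -> (m <= d)%N ->
    `|ksum m (x *m s ^+ r) - ksum m x| <= r%:R * K.
Proof.
move=> KP x s m r xu Ss md; elim: r => [|r IH].
  by rewrite expr0 mulmx1 subrr normr0 mul0r.
have xsu : x *m s ^+ r \in unitmx by rewrite unitmx_mul xu mulmxX_unit // S_unit.
have [le _] := KP _ _ m xsu Ss md.
rewrite exprSr -mulmxE mulmxA -natr1 mulrDl mul1r.
rewrite -(subrK (ksum m (x *m s ^+ r)) (ksum m (x *m s ^+ r *m s))) -addrA addrC.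
by rewrite (le_trans (ler_normD _ _)) // lerD.
Qed.

Lemma kappa_sum_bounded K : (forall x s m, x \in unitmx -> S s ->
    (m <= d)%N -> `|ksum m (x *m s) - ksum m x| <= K /\ `|ksum m s| <= K) ->
  forall n g m, (0 < n)%N -> prodset S n g -> (m <= d)%N -> `|ksum m g| <= n%:R * K.
Proof.
move=> KP n g m n0 Sg md; move: n g Sg n0.
apply: (@prodset_ind _ _ _ S (fun n g => (0 < n)%N -> `|ksum m g| <= n%:R * K)) => //.
move=> [|n] g s Sg IH Ss _.
  case: Sg => t _; rewrite big_ord0 => <-; rewrite mul1mx mul1r.
  by have [] := KP 1%:M s m (unitmx1 _ _) Ss md.
have [le _] := KP g s m (prodset_unit Sg) Ss md.
rewrite -natr1 mulrDl mul1r -(subrK (ksum m g) (ksum m (g *m s))) addrC.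
by rewrite (le_trans (ler_normD _ _)) // lerD // IH.
Qed.

Lemma kappa_sum_pow_le K : (forall m (g h : 'M[C]_d), (m <= d)%N ->
    g \in unitmx -> h \in unitmx -> ksum m (g *m h) <= ksum m g + ksum m h + K) ->
  forall m g p, (m <= d)%N -> g \in unitmx ->
    ksum m (g ^+ p.+1) <= p.+1%:R * (ksum m g + `|K|).
Proof.
move=> KP m g p md gu; elim: p => [|p IH].
  by rewrite expr1 mul1r lerDl.
rewrite exprS -mulmxE; apply: le_trans (KP _ _ _ md gu (mulmxX_unit _ gu)) _.
rewrite -[X in _ <= X * _]natr1 mulrDl mul1r.
have := ler_norm K; lra.
Qed.

(** The upper bounds are subadditivity. The lower bound for one partial sum
    follows from the lower bound of kappa_total_pow for their total, by
    subtracting the upper bounds for all the others. *)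
Lemma kappa_sum_growth : exists K l, 0 <= K /\ forall n g, prodset S n g ->
  exists q t, [/\ (q <= l)%N, prodset S q t & forall p m, (m <= d)%N ->
    `|ksum m ((g *m t) ^+ p.+1) - p.+1%:R * ksum m g| <= p.+1%:R * K].
Proof.
have [K1 K1P] := kappa_sum_submul C d.
pose T : set 'M[C]_d := [set g | exists n, prodset S n g].
have T_unit g : T g -> g \in unitmx by move=> [n]; exact: prodset_unit.
have T_irr h : h != 0 -> (forall g, T g -> (h *m g <= h)%MS) -> h \in unitmx.
  by move=> h0 hT; apply: S_irr => // g Sg; apply: hT; exists 1%N; exact: prodset1.
have T1 : T 1%:M by exists 0%N; exact: prodset0.
have TM g h : T g -> T h -> T (g *m h).
  by move=> [m Tg] [n Th]; exists (m + n)%N; exact: prodsetM.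
have [r [t [K [Tt tP]]]] := kappa_total_pow d0 T_unit T_irr T1 TM.
have /choice[q qP] := Tt.
pose A := \sum_i \sum_(m < d.+1) `|ksum m (t i)|.
have AP i m : (m <= d)%N -> ksum m (t i) <= A.
  move=> md; apply: le_trans (ler_norm _) _.
  rewrite /A (bigD1 i) //= (bigD1 (Ordinal (md : (m < d.+1)%N))) //= -addrA lerDl.
  by rewrite addr_ge0 // sumr_ge0 // => j _; exact: sumr_ge0.
have A0 : 0 <= A by apply: sumr_ge0 => i _; exact: sumr_ge0.
pose U := A + 2 * `|K1|; have U0 : 0 <= U by rewrite addr_ge0 // mulr_ge0.
exists (`|K| + d%:R * U + U), (\max_i q i); split; first by rewrite !addr_ge0 // mulr_ge0.
move=> n g Sg; have Tg : T g by exists n.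
have [i iP] := tP g Tg; exists (q i), (t i); split => //.
  exact: (leq_bigmax i).
move=> p m md; have gu := T_unit g Tg; have tu := T_unit _ (Tt i).
have gtu : g *m t i \in unitmx by rewrite unitmx_mul gu.
have up m' : (m' <= d)%N ->
    ksum m' ((g *m t i) ^+ p.+1) <= p.+1%:R * ksum m' g + p.+1%:R * U.
  move=> md'; apply: le_trans (kappa_sum_pow_le K1P p md' gtu) _.
  rewrite -mulrDr ler_wpM2l // /U; have := K1P m' g (t i) md' gu tu.
  have := AP i m' md'; have := ler_norm K1; lra.
have p0 : 0 <= p.+1%:R :> R by [].
have pU : 0 <= p.+1%:R * U by rewrite mulr_ge0.
have pK : 0 <= p.+1%:R * `|K| by rewrite mulr_ge0.
have pdU : 0 <= p.+1%:R * (d%:R * U) by rewrite !mulr_ge0.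
have KK : p.+1%:R * K <= p.+1%:R * `|K| by rewrite ler_wpM2l // ler_norm.
rewrite (_ : p.+1%:R * (_ + U) = p.+1%:R * `|K| + p.+1%:R * (d%:R * U) + p.+1%:R * U);
  last by rewrite !mulrDr.
have low : p.+1%:R * ksum m g - p.+1%:R * `|K| - p.+1%:R * (d%:R * U) <=
    ksum m ((g *m t i) ^+ p.+1).
  case: m md => [|k] kd; first by rewrite !kappa_sum0 mulr0; move: pK pdU; clear; lra.
  have := iP p; rewrite /kappa_total (bigD1 (Ordinal kd)) //= [X in _ <= X](bigD1 (Ordinal kd)) //=.
  have others : \sum_(j < d | j != Ordinal kd) ksum j.+1 ((g *m t i) ^+ p.+1) <=
      p.+1%:R * (\sum_(j < d | j != Ordinal kd) ksum j.+1 g) + p.+1%:R * (d%:R * U).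
    rewrite mulr_sumr; apply: (@le_trans _ _
      (\sum_(j < d | j != Ordinal kd) (p.+1%:R * ksum j.+1 g + p.+1%:R * U))).
      by apply: ler_sum => j _; apply: up.
    rewrite big_split /= lerD2l (@le_trans _ _ (\sum_(j < d) p.+1%:R * U)) //.
        rewrite [leRHS](bigD1 (Ordinal kd)) //= lerDr; exact: pU.
    by rewrite sumr_const card_ord -mulrnAr (mulr_natl U).
  move: others; set X := \sum_(_ < _ | _) _; set Y := \sum_(_ < _ | _) _.
  rewrite ?mulrBr ?mulrDr; move: KK; clear => KK.
  lra.
move: (up m md) low pU pK pdU; clear; move: (ksum m _) (p.+1%:R * _) (_ * U) (_ * (_ * U)) (_ * `|K|) => a b u v w.
move=> h1 h2 h3 h4 h5; rewrite ler_norml; apply/andP; split; lra.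
Qed.

(** With t of length q given by kappa_sum_growth, divide m by n + q: m = p (n
    + q) + r, and take g' = (g t)^p s^r. The p factors g t contribute p
    kappa(g) up to p K2, the r factors s at most r K1, and |m - p n| = p q + r
    times the partial sums of g, which are at most n K1, accounts for the
    rest. *)
Lemma kappa_sum_recurrent : exists K, 0 <= K /\
  (forall n g m, (0 < n)%N -> prodset S n g -> (m <= d)%N -> `|ksum m g| <= n%:R * K) /\
  forall n, (0 < n)%N -> exists N, forall m, (N <= m)%N ->
    forall g, prodset S n g -> exists2 g', prodset S m g' & forall k, (k <= d)%N ->
      `|n%:R * ksum k g' - m%:R * ksum k g| <= m%:R * K.
Proof.
have [K1 [K10 K1P]] := kappa_sum_step; have [K2 [l [K20 K2P]]] := kappa_sum_growth.
have lK1 : 0 <= l%:R * K1 by rewrite mulr_ge0.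
exists (K2 + K1 + K1 + l%:R * K1); split; first by rewrite !addr_ge0.
split=> [n g m n0 Sg md|n n0].
  apply: le_trans (kappa_sum_bounded K1P n0 Sg md) _.
  by rewrite ler_wpM2l // -addrA addrAC lerDr addr_ge0 // addr_ge0.
(* beyond this bound n r <= n (n + l) <= m *)
exists (n * (n + l))%N => m Nm g Sg; have [s Ss] := S0.
have [q [t [ql St tP]]] := K2P n g Sg.
have nq0 : (0 < n + q)%N by rewrite addn_gt0 n0.
have nqm : (n + q <= m)%N.
  apply: leq_trans Nm; rewrite (@leq_trans (n + l)) ?leq_add2l //.
  by rewrite leq_pmull.
have := divn_eq m (n + q); have : (0 < m %/ (n + q))%N by rewrite divn_gt0.
have := ltn_pmod m nq0; set r := (m %% _)%N.
case: (m %/ (n + q))%N => // p rl _ mE.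
exists ((g *m t) ^+ p.+1 *m s ^+ r).
  rewrite mE; apply: prodsetM; first by apply: prodsetX; exact: prodsetM.
  by have := prodsetX r (prodset1 Ss); rewrite muln1.
move=> k kd; have gu := prodset_unit Sg; have tu := prodset_unit St.
have gtu : (g *m t) ^+ p.+1 \in unitmx by rewrite mulmxX_unit // unitmx_mul gu.
have h1 := kappa_sum_pad K1P r gtu Ss kd; have h2 := tP p k kd.
have h3 := kappa_sum_bounded K1P n0 Sg kd.
have pnm : p.+1%:R * n%:R <= m%:R :> R.
  by rewrite -natrM ler_nat mE mulnDr -addnA leq_addr.
have rnm : r%:R * n%:R <= m%:R :> R.
  rewrite -natrM ler_nat mulnC; apply: leq_trans Nm.
  by rewrite leq_pmul2l // (leq_trans (ltnW rl)) // leq_add2l.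
have mR : m%:R = p.+1%:R * (n%:R + q%:R) + r%:R :> R by rewrite mE natrD natrM natrD.
have qR : q%:R <= l%:R :> R by rewrite ler_nat.
have nR : 0 <= n%:R :> R by [].
have pR : 0 <= p.+1%:R :> R by [].
have q0R : 0 <= q%:R :> R by [].
have rR : 0 <= r%:R :> R by [].
move: h1 h2 h3 K10 K20 pnm rnm mR qR nR pR q0R rR.
move: (ksum k g) (ksum k _) (ksum k _) (n%:R : R) (p.+1%:R : R) (q%:R : R) (r%:R : R)
  (m%:R : R) (l%:R : R).
clear -R K1 K2 => x y z n p q r m l h1 h2 h3 K10 K20 pnm rnm mR ql n0 p0 q0 r0.
rewrite (_ : n * z - m * x = n * (z - y) + n * (y - p * x) - (p * q + r) * x); last first.
  by rewrite mR; ring.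
have e1 : `|n * (z - y)| <= n * (r * K1) by rewrite normrM ger0_norm // ler_wpM2l.
have e2 : `|n * (y - p * x)| <= n * (p * K2) by rewrite normrM ger0_norm // ler_wpM2l.
have e3 : `|(p * q + r) * x| <= (p * q + r) * (n * K1).
  by rewrite normrM ger0_norm ?ler_wpM2l ?addr_ge0 ?mulr_ge0.
have f1 : n * (r * K1) <= m * K1 by rewrite mulrA ler_wpM2r // mulrC.
have f2 : n * (p * K2) <= m * K2 by rewrite mulrA ler_wpM2r // mulrC.
have f3 : p * q * (n * K1) <= m * (l * K1).
  rewrite (_ : p * q * _ = (p * n) * (q * K1)); last by ring.
  by rewrite ler_pM ?mulr_ge0 // ler_wpM2r.
apply: le_trans (ler_normB _ _) _; apply: le_trans (lerD (ler_normD _ _) (lexx _)) _.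
have e4 : (p * q + r) * (n * K1) = p * q * (n * K1) + n * (r * K1) by ring.
have e5 : m * (K2 + K1 + K1 + l * K1) = m * K2 + m * K1 + m * K1 + m * (l * K1) by ring.
rewrite e4 in e3; rewrite e5; move: e1 e2 e3 f1 f2 f3; clear.
move: (n * (r * K1)) (n * (p * K2)) (p * q * (n * K1)) (m * K1) (m * K2) (m * (l * K1)).
move=> ? ? ? ? ? ?; lra.
Qed.

Lemma kappa_recurrent : exists K, 0 <= K /\
  (forall n g, (0 < n)%N -> prodset S n g -> forall k, `|kappaC g 0 k| <= n%:R * K) /\
  forall n, (0 < n)%N -> exists N, forall m, (N <= m)%N ->
    forall g, prodset S n g -> exists2 g', prodset S m g' & forall k,
      `|n%:R * kappaC g' 0 k - m%:R * kappaC g 0 k| <= m%:R * K.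
Proof.
have kE (g : 'M[C]_d) (k : 'I_d) : kappaC g 0 k = ksum k.+1 g - ksum k g.
  by rewrite kappa_sumS addrC addKr.
have kd (k : 'I_d) : (k <= d)%N by exact: ltnW.
have [K [K0 [bnd rec]]] := kappa_sum_recurrent; exists (K + K); split; first exact: addr_ge0.
split=> [n g n0 Sg k|n n0].
  by rewrite kE mulrDr; apply: le_trans (ler_normB _ _) _; apply: lerD; apply: bnd => //; exact: kd.
have [N NP] := rec n n0; exists N => m Nm g Sg; have [g' Sg' g'P] := NP m Nm g Sg.
exists g' => // k; rewrite !kE.
rewrite (_ : _ - _ = n%:R * ksum k.+1 g' - m%:R * ksum k.+1 g
  - (n%:R * ksum k g' - m%:R * ksum k g)); last by ring.
by rewrite (mulrDr _ K K); apply: le_trans (ler_normB _ _) _; apply: lerD; apply: g'P => //; exact: kd.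
Qed.

End Dynamics.

(** * Convergence in the Hausdorff metric *)

Section HausdorffLimit.
Variables (R : realType) (d : nat).
Implicit Types (A B : set 'rV[R]_d).

(** A closed ball of row vectors is compact. *)
Lemma bounded_sequence_cluster (u : nat -> 'rV[R]_d) (c : R) :
  (forall n, `|u n| <= c) ->
  exists y, forall e, 0 < e -> forall N, exists2 n, (N <= n)%N & `|u n - y| < e.
Proof.
move=> uc; pose A : set 'rV[R]_d := [set x | `|x| <= c].
have cA : compact A.
  apply: bounded_closed_compact.
    exists c; split; first by rewrite num_real.
    by move=> M cM x /= xc; apply: le_trans xc (ltW cM).
  by apply: (closed_comp _ (@closed_le R c)) => x _; exact: norm_continuous.
have uA : (u @ \oo) A by exists 0%N => // n _; exact: uc.
have [y [_ yc]] := cA (u @ \oo) _ uA.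
exists y => e e0 N.
have uN : (u @ \oo) [set u n | n in [set n | (N <= n)%N]].
  by exists N => // n Nn; exists n.
have [_ [[n Nn <-] yn]] := yc _ _ uN (nbhsx_ballx y e e0).
by exists n => //; rewrite distrC; move: yn; rewrite -ball_normE.
Qed.

Lemma euclidean_dist_ge0 (u v : 'rV[R]_d) : 0 <= euclidean_dist u v.
Proof. exact: sqrtr_ge0. Qed.

Lemma euclidean_dist_le (u v : 'rV[R]_d) e : 0 <= e -> `|u - v| <= e ->
  euclidean_dist u v <= d%:R * e.
Proof.
move=> e0 uve; rewrite -(ger0_norm (mulr_ge0 (ler0n R d) e0)) -sqrtr_sqr.
apply: ler_wsqrtr; apply: (@le_trans _ _ (\sum_(j < d) e ^+ 2)).
  apply: ler_sum => j _; rewrite -real_normK ?num_real // lerXn2r ?nnegrE //.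
  by have := rV_entry_le (u - v) j; rewrite !mxE => /le_trans; apply.
rewrite sumr_const card_ord -[X in X <= _]mulr_natl exprMn ler_wpM2r ?sqr_ge0 //.
by rewrite -natrX ler_nat; case: (d) => // k; rewrite leq_pmulr.
Qed.

Lemma dist_to_set_le (u v : 'rV[R]_d) A : A v -> dist_to_set u A <= euclidean_dist u v.
Proof.
move=> Av; apply: ge_inf; last by exists v.
by exists 0 => _ [w _ <-]; exact: euclidean_dist_ge0.
Qed.

Lemma dist_to_set_ge0 (u : 'rV[R]_d) A : A !=set0 -> 0 <= dist_to_set u A.
Proof.
move=> [v Av]; apply: lb_le_inf; first by exists (euclidean_dist u v), v.
by move=> _ [w _ <-]; exact: euclidean_dist_ge0.
Qed.

Lemma hausdorff_dist_le A B e : 0 <= e -> A !=set0 -> B !=set0 ->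
  (forall u, A u -> exists2 v, B v & `|u - v| <= e) ->
  (forall v, B v -> exists2 u, A u & `|v - u| <= e) ->
  `|hausdorff_dist A B| <= d%:R * e.
Proof.
suff half A' B' : 0 <= e -> A' !=set0 -> B' !=set0 ->
    (forall u, A' u -> exists2 v, B' v & `|u - v| <= e) ->
    0 <= sup [set dist_to_set u B' | u in A'] <= d%:R * e.
  move=> e0 A0 B0 AB BA.
  have /andP[h1 h2] := half _ _ e0 A0 B0 AB; have /andP[h3 h4] := half _ _ e0 B0 A0 BA.
  by rewrite ger0_norm /hausdorff_dist ?le_max ?h1 // ge_max h2.
move=> e0 [a Aa] B0 AB.
have ub : ubound [set dist_to_set u B' | u in A'] (d%:R * e).
  move=> _ [u Au <-]; have [v Bv uv] := AB u Au.
  exact: le_trans (dist_to_set_le u Bv) (euclidean_dist_le e0 uv).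
apply/andP; split; last by apply: ge_sup => //; exists (dist_to_set a B'), a.
apply: le_trans (dist_to_set_ge0 a B0) _; apply: ub_le_sup; last by exists a.
by exists (d%:R * e).
Qed.

(** Let J be the set of limit points of sequences with values in the sets K m
    with m unbounded. By recurrence a point of K n has approximations in all
    later sets, and a cluster point of these lies in J (near_J). Also by
    recurrence, a point of J, being close to some K n with n large, is close
    to all later sets (eventually_near); as J is compact, this holds uniformly
    on J (uniform). *)
Lemma hausdorff_convergence (K : nat -> set 'rV[R]_d) (c : R) : 0 <= c ->
  (forall n, (0 < n)%N -> K n !=set0) ->
  (forall n x, (0 < n)%N -> K n x -> `|x| <= c) ->
  (forall n, (0 < n)%N -> exists N, forall m, (N <= m)%N ->
     forall x, K n x -> exists2 y, K m y & `|y - x| <= c / n%:R) ->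
  exists J : set 'rV[R]_d, [/\ compact J, J !=set0
    & hausdorff_dist (K n) J @[n --> \oo] --> (0 : R)].
Proof.
move=> c0 K0 Kc rec.
pose J : set 'rV[R]_d :=
  [set y | forall e, 0 < e -> forall N, exists2 m, (N <= m)%N &
     exists2 x, K m x & `|x - y| < e].
have eps e : 0 < e -> exists n0, forall n, (n0 < n)%N -> c / n%:R <= e.
  move=> e0; exists (Num.bound (c / e)) => n nb.
  have n0 : 0 < n%:R :> R by rewrite ltr0n; exact: leq_ltn_trans nb.
  rewrite ler_pdivrMr // mulrC -ler_pdivrMr // ltW //.
  apply: lt_trans (archi_boundP _) _; first by rewrite divr_ge0 // ltW.
  by rewrite ltr_nat.
have near_J n x : (0 < n)%N -> K n x -> forall e, 0 < e ->
    exists2 y, J y & `|x - y| <= c / n%:R + e.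
  move=> n0 Kx e e0; have [N NP] := rec n n0.
  have /choice[u uP] m : exists y, K (N + m).+1 y /\ `|y - x| <= c / n%:R.
    by have [|y] := NP (N + m).+1 _ x Kx; [rewrite leqW // leq_addr|exists y].
  have [y yP] : exists y, forall e, 0 < e -> forall N, exists2 n, (N <= n)%N & `|u n - y| < e.
    by apply: (@bounded_sequence_cluster u c) => m; have [Ku _] := uP m; apply: Kc Ku.
  exists y => [e' e'0 M|].
    have [m Mm um] := yP e' e'0 M; exists (N + m).+1.
      by rewrite leqW // (leq_trans Mm) // leq_addl.
    by exists (u m); have [] := uP m.
  have [m _ um] := yP e e0 0%N; have [_ ux] := uP m.
  rewrite -(subrK (u m) x) -addrA (le_trans (ler_normD _ _)) //.
  by rewrite lerD // ?(ltW um) // distrC.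
have eventually_near y e : J y -> 0 < e -> exists N, forall m, (N <= m)%N ->
    exists2 x, K m x & `|y - x| <= e.
  move=> Jy e0; have e2 : 0 < e / 2 by rewrite divr_gt0.
  have [n0 n0P] := eps _ e2; have [n n0n [x Kx xy]] := Jy _ e2 n0.+1.
  have [N NP] := rec n (leq_ltn_trans (leq0n _) n0n).
  exists N => m Nm; have [z Kz zx] := NP m Nm x Kx; exists z => //.
  rewrite -(subrK x y) -addrA (le_trans (ler_normD _ _)) // (splitr e) lerD //.
    by rewrite distrC ltW.
  by rewrite distrC (le_trans zx) // n0P.
have Jc y : J y -> `|y| <= c.
  move=> Jy; apply/ler_addgt0Pr => e e0; have [m m0 [x Kx xy]] := Jy e e0 1%N.
  rewrite -(subrK x y) (le_trans (ler_normD _ _)) // addrC.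
  by rewrite lerD ?(Kc m) // distrC ltW.
have J_closed (u : nat -> 'rV[R]_d) y : (forall n, J (u n)) ->
    (forall e, 0 < e -> forall N, exists2 n, (N <= n)%N & `|u n - y| < e) -> J y.
  move=> Ju uy e e0 N; have e2 : 0 < e / 2 by rewrite divr_gt0.
  have [n _ un] := uy _ e2 0%N; have [m Nm [x Kx xu]] := Ju n _ e2 N.
  exists m => //; exists x => //; rewrite -(subrK (u n) x) -addrA.
  by rewrite (le_lt_trans (ler_normD _ _)) // (splitr e) ltrD.
have cJ : compact J.
  apply: bounded_closed_compact.
    exists c; split; first by rewrite num_real.
    by move=> M cM x /Jc /le_trans; apply; exact: ltW.
  move=> y Jy e e0 N; have e2 : 0 < e / 2 by rewrite divr_gt0.
  have [z [Jz yz]] := Jy _ (nbhsx_ballx y _ e2).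
  have [m Nm [x Kx xz]] := Jz _ e2 N; exists m => //; exists x => //.
  rewrite -(subrK z x) -addrA (le_lt_trans (ler_normD _ _)) // (splitr e) ltrD //.
  by rewrite distrC; move: yz; rewrite -ball_normE.
have J0 : J !=set0.
  by have [x Kx] := K0 1%N isT; have [y Jy _] := near_J 1%N x isT Kx 1 ltr01; exists y.
have uniform e : 0 < e -> exists N, forall m, (N <= m)%N -> forall y, J y ->
    exists2 x, K m x & `|y - x| <= e.
  move=> e0; apply: contrapT => H.
  have /choice[u uP] N : exists y, J y /\ exists2 m, (N <= m)%N &
      forall x, K m x -> e < `|y - x|.
    apply: contrapT => HN; apply: H; exists N => m Nm y Jy; apply: contrapT => Hx.
    apply: HN; exists y; split => //; exists m => // x Kx.
    by rewrite ltNge; apply/negP => xy; apply: Hx; exists x.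
  have [y yP] : exists y, forall e, 0 < e -> forall N, exists2 n, (N <= n)%N & `|u n - y| < e.
    by apply: (@bounded_sequence_cluster u c) => m; have [/Jc] := uP m.
  have Jy : J y by apply: (J_closed u) => // n; have [] := uP n.
  have e2 : 0 < e / 2 by rewrite divr_gt0.
  have [N NP] := eventually_near y _ Jy e2; have [n Nn un] := yP _ e2 N.
  have [_ [m nm far]] := uP n; have [x Kx yx] := NP m (leq_trans Nn nm).
  have := far x Kx; rewrite ltNge => /negP; apply.
  by rewrite -(subrK y (u n)) -addrA (le_trans (ler_normD _ _)) // (splitr e) lerD // ltW.
exists J; split=> //; apply/cvgrPdist_le => e e0.
have d1 : 0 < d%:R + 1 :> R by rewrite ltr_wpDl.
have e' : 0 < e / (d%:R + 1) / 2 by rewrite !divr_gt0.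
have [N1 N1P] := eps _ e'; have [N2 N2P] := uniform _ e'.
exists (maxn N1.+1 N2) => // n /=; rewrite geq_max => /andP[n1 n2].
have n0 : (0 < n)%N by exact: leq_ltn_trans n1.
rewrite sub0r normrN.
have de : d%:R * (e / (d%:R + 1)) <= e.
  by rewrite mulrCA ler_piMr ?(ltW e0) // ler_pdivrMr // mul1r lerDl.
apply: le_trans de; apply: hausdorff_dist_le => //.
- by rewrite divr_ge0 ?ltW.
- exact: K0.
- move=> x Kx; have [y Jy xy] := near_J n x n0 Kx _ e'; exists y => //.
  by apply: le_trans xy _; rewrite [leRHS]splitr lerD // N1P.
- move=> y Jy; have [x Kx xy] := N2P n n2 y Jy; exists x => //.
  by apply: le_trans xy _; rewrite ler_pdivrMr // ler_peMr ?ler1n // divr_ge0 ?ltW.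
Qed.

End HausdorffLimit.

(** * The standard complex numbers *)

Section Instance.
Variable R : realType.

Lemma real_complex_le (x y : R) : (x%:C <= y%:C)%C = (x <= y).
Proof. by rewrite ler0c || rewrite lecE /= eqxx. Qed.

Lemma complex_reE (z : R[i]) : (complex.Re z)%:C%C = 'Re z.
Proof. by rewrite -complexRe. Qed.

Lemma singular_values_char_poly n (g : 'M[R[i]]_n) (s : seq R) :
  char_poly (g ^t* *m g) = \prod_(x <- s) ('X - (x%:C)%C%:P) ->
  singular_values g = sort >=%R [seq Num.sqrt x | x <- s].
Proof.
move=> sE; rewrite /singular_values.
apply/perm_sortP => //; [exact: ge_total|exact: ge_trans|exact: ge_anti|].
have -> : [seq Num.sqrt x | x <- s] =
    [seq Num.sqrt (complex.Re z) | z <- [seq (x%:C)%C | x <- s]].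
  by rewrite -[RHS]map_comp.
apply: perm_map; apply: prod_XsubC_eq.
rewrite /eigenvalues; case: closed_field_poly_normal => r /= rE.
by move: rE; rewrite (monicP (char_poly_monic _)) scale1r sE => <-; rewrite big_map.
Qed.

Definition standard_complex : complexModel R :=
  @ComplexModel R R[i] (real_complex R) (@complex.Re R)
    (fun n g => singular_values g) real_complex_le complex_reE
    singular_values_char_poly.

End Instance.

(** * Irreducibility in terms of row spaces *)

Section Irreducibility.
Variables (R : realType) (d : nat).
Implicit Types (S : set 'M[R[i]]_d).

(** The elements of GL that map the row space of h into itself form a
    subgroup: for inverses, compare dimensions. *)
Lemma row_stable_generated S (h : 'M[R[i]]_d) : S `<=` @GL R d ->
  (forall g, S g -> (h *m g <= h)%MS) ->
  forall g, generated_subgroup S g -> (h *m g <= h)%MS.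
Proof.
move=> SGL hS g Sg; pose G : set 'M[R[i]]_d := [set g | g \in unitmx /\ (h *m g <= h)%MS].
suff [] : G g by [].
apply: Sg; split=> [|x Sx]; last by split; [exact: SGL|exact: hS].
split.
- by move=> x [].
- by split; [exact: unitmx1|rewrite mulmx1].
- move=> x y [xu hx] [yu hy]; split; first by rewrite unitmx_mul xu.
  by rewrite mulmxA (submx_trans _ hy) // submxMr.
move=> x [xu hx]; split; first by rewrite unitmx_inv.
have : (h *m x == h)%MS by rewrite -(geq_leqif (mxrank_leqif_eq hx)) mxrankMfree // row_free_unit.
by move=> /eqmxP/(eqmxMr (invmx x)); rewrite mulmxK // => ->.
Qed.

(** The column vectors killed by h form an invariant subspace, because h *m g
    = D *m h for some D. It is not everything as h is not 0, so it is 0. *)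
Lemma irreducible_row_stable S (h : 'M[R[i]]_d) : S `<=` @GL R d ->
  acts_irreducibly (generated_subgroup S) -> h != 0 ->
  (forall g, S g -> (h *m g <= h)%MS) -> h \in unitmx.
Proof.
move=> SGL [_ irr] h0 hS; have hG := row_stable_generated SGL hS.
pose U := lker (linfun (mulmx h : 'cV[R[i]]_d -> 'cV[R[i]]_d)).
have UP v : (v \in U) = (h *m v == 0) by rewrite memv_ker lfunE.
have [g Sg v|U0|UT] := irr U.
- rewrite !UP mulmxA => /eqP hv; have /submxP[D ->] := hG g Sg.
  by rewrite -mulmxA hv mulmx0.
- rewrite -unitmx_tr -row_free_unit -kermx_eq0; apply/eqP/row_matrixP => i.
  rewrite row0; apply: trmx_inj; rewrite trmx0; apply/eqP.
  rewrite -memv0 -U0 UP -[X in X *m _]trmxK -trmx_mul.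
  by rewrite -row_mul mulmx_ker row0 trmx0.
- case/eqP: h0; apply: (trmx_inj); apply/row_matrixP => i; rewrite trmx0 row0 -tr_col.
  apply: trmx_inj; rewrite trmx0 trmxK colE.
  by apply/eqP; rewrite -UP UT memvf.
Qed.

End Irreducibility.

(** * Compactness of the sets of singular values *)

Section Topology.
Variables (R : realType) (d : nat).
Local Notation size := (@mxsize R (standard_complex R) d d).
Local Notation M := 'M[R[i]]_d.

Lemma cabs_norm (z : R[i]) : (@cabs R (standard_complex R) z)%:C%C = `|z|.
Proof. exact: (@cabsE R (standard_complex R) z). Qed.

Lemma nbhs_mxsize (g : M) (A : set M) : nbhs g A ->
  exists2 e, 0 < e & forall g', size (g' - g) < e -> A g'.
Proof.
move=> [P gP PA].
have /choice[e eP] (ij : 'I_d * 'I_d) : exists e : R, 0 < e /\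
    forall z, `|z - g ij.1 ij.2| < e%:C%C -> P ij.1 ij.2 z.
  have /nbhs_normP[e /= e0 eP] := gP ij.1 ij.2.
  have eE : (complex.Re e)%:C%C = e by rewrite RRe_real // gtr0_real.
  exists (complex.Re e); split; first by rewrite -(ltcR) eE.
  by move=> z ze; apply: eP; rewrite /= distrC -eE.
pose m := \big[Num.min/1]_ij e ij.
have m0 : 0 < m by apply: lt_bigmin => // ij _; have [] := eP ij.
exists m => // g' g'm; apply: PA => i j; have [_] := eP (i, j); apply.
rewrite -cabs_norm ltcR /=; apply: lt_le_trans (bigmin_le_cond 1 (j := (i, j)) e isT).
apply: le_lt_trans g'm; have := @cabs_le_mxsize R (standard_complex R) d d (g' - g) i j.
by rewrite !mxE.
Qed.

Lemma mxsize_nbhs (g : M) (e : R) : 0 < e -> nbhs g [set g' | size (g' - g) <= e].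
Proof.
move=> e0; pose b := e / (d * d).+1%:R.
have b0 : 0 < b by rewrite divr_gt0.
have bC : 0 < b%:C%C by rewrite ltcR.
exists (fun i j => [set z | `|g i j - z| < b%:C%C]).
  by move=> i j; apply/nbhs_normP; exists b%:C%C.
move=> g' /= g'P; apply: (@le_trans _ _ (b *+ (d * d))).
  apply: mxsize_le => i j; rewrite !mxE -lecR cabs_norm distrC.
  exact: ltW (g'P i j).
by rewrite -mulr_natr /b mulrAC ler_pdivrMr // ler_wpM2l ?(ltW e0) // ler_nat.
Qed.

Lemma mulmx_continuous : continuous (fun x : M * M => x.1 *m x.2).
Proof.
move=> [g h] A /nbhs_mxsize[e e0 eA] /=.
pose K := 1 + size g + size h.
have K0 : 0 < K by rewrite /K -addrA ltr_pwDl // addr_ge0 // mxsize_ge0.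
pose r := Num.min 1 (e / K / 2).
have r0 : 0 < r by rewrite lt_min ltr01 !divr_gt0.
exists ([set x | size (x - g) <= r], [set y | size (y - h) <= r]).
  by split; exact: mxsize_nbhs.
move=> [x y] [/= xr yr]; apply: eA.
have gE : x *m y - g *m h = (x - g) *m (y - h) + (x - g) *m h + g *m (y - h).
  by rewrite -mulmxDr subrK mulmxBl mulmxBr addrA subrK.
rewrite gE; apply: le_lt_trans (mxsizeD _ _) _.
have h1 : size ((x - g) *m (y - h) + (x - g) *m h) <= r * 1 + r * size h.
  apply: le_trans (mxsizeD _ _) _; apply: lerD.
    apply: le_trans (mxsizeM _ _) _; rewrite ler_pM ?mxsize_ge0 //.
    by apply: le_trans yr _; rewrite ge_min lexx.
  by apply: le_trans (mxsizeM _ _) _; rewrite ler_wpM2r ?mxsize_ge0.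
have h2 : size (g *m (y - h)) <= r * size g.
  by apply: le_trans (mxsizeM _ _) _; rewrite mulrC ler_wpM2r ?mxsize_ge0.
apply: le_lt_trans (lerD h1 h2) _.
have KE : r * 1 + r * size h + r * size g = r * K.
  by rewrite /K -!mulrDr addrAC.
rewrite KE.
apply: (@le_lt_trans _ _ (e / K / 2 * K)); first by rewrite ler_wpM2r ?(ltW K0) // ge_min lexx orbT.
by rewrite mulrAC divfK ?gt_eqF // ltr_pdivrMr // ltr_pMr // ltr1n.
Qed.

Lemma product_set_compact (S : set M) n : compact S -> compact (product_set S n).
Proof.
move=> cS; elim: n => [|n IH].
  rewrite (_ : product_set S 0 = [set 1%:M]); first exact: compact_set1.
  apply/seteqP; split=> [_ [s _ <-]|_ ->]; first by rewrite big_ord0.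
  exact: (@prodset0 R (standard_complex R)).
rewrite (_ : product_set S n.+1 =
    (fun x : M * M => x.1 *m x.2) @` (product_set S n `*` S)).
  apply: continuous_compact; last exact: compact_setX.
  by apply: continuous_subspaceT; exact: mulmx_continuous.
apply/seteqP; split=> [_ [s Ss <-]|_ [[g s] [Sg Ss] <-]].
  rewrite big_ord_recr /=; exists (\prod_(i < n) s (widen_ord (leqnSn n) i), s ord_max) => //.
  by split; [exists (fun i => s (widen_ord (leqnSn n) i)) => // j|]; exact: Ss.
rewrite -addn1; apply: (@prodsetM R (standard_complex R)) => //.
exact: (@prodset1 R (standard_complex R)).
Qed.

Lemma rV_norm_le (x : 'rV[R]_d) e : 0 <= e -> (forall k, `|x 0 k| <= e) -> `|x| <= e.
Proof.
move=> e0 xe; rewrite [`|x|]mx_normrE; apply: bigmax_le => // -[i k] _ /=.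
by rewrite ord1.
Qed.

Lemma kappa_continuous : {within @GL R d, continuous (@kappa R d)}.
Proof.
apply/subspace_continuousP => g gu; apply/cvgrPdist_le => e e0.
have [b [b0 bP]] := @kappa_eps_delta R (standard_complex R) d g e gu e0.
apply: filterS (mxsize_nbhs g b0) => g' /= g'b g'u.
apply: rV_norm_le; first exact: ltW.
move=> k; have entryB (u v : 'rV[R]_d) : (u - v) 0 k = u 0 k - v 0 k by rewrite !mxE.
rewrite entryB distrC; exact: (bP g' g'u g'b k).
Qed.

Lemma scaled_kappa_compact (S : set M) n : S `<=` @GL R d -> compact S ->
  compact (scaled_kappa S n).
Proof.
move=> SGL cS.
have -> : scaled_kappa S n = ( *:%R n%:R^-1) @` (@kappa R d @` product_set S n).
  by rewrite image_comp.
apply: continuous_compact; first by apply: continuous_subspaceT; exact: scaler_continuous.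
apply: continuous_compact; last exact: product_set_compact.
apply: continuous_subspaceW kappa_continuous => g Sg.
exact: (@prodset_unit R (standard_complex R) d S SGL n g Sg).
Qed.

End Topology.

(** * The joint spectrum *)

Lemma scaled_kappa_neq0 (R : realType) d (S : set 'M[R[i]]_d) n : S !=set0 ->
  scaled_kappa S n !=set0.
Proof.
move=> [s Ss]; exists (n%:R^-1 *: kappa (\prod_(j < n) s)); exists (\prod_(j < n) s) => //.
by exists (fun=> s).
Qed.

Lemma kappa_bounded (R : realType) d (S : set 'M[R[i]]_d) : S `<=` @GL R d ->
  compact S -> exists c, forall g, S g -> forall k, `|kappa g 0 k| <= c.
Proof.
move=> SGL cS; have [M [_ MP]] : bounded_set (scaled_kappa S 1).
  exact: compact_bounded (scaled_kappa_compact SGL cS).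
exists (M + 1) => g Sg k; apply: le_trans (rV_entry_le _ k) _.
apply: (MP (M + 1)); first by rewrite ltrDl.
exists g; last by rewrite invr1 scale1r.
exact: (@prodset1 R (standard_complex R)).
Qed.

Theorem theorem1p1 (R : realType) (d : nat) (S : set 'M[R[i]]_d)
    (S_GL : S `<=` @GL R d)
    (S_neq0 : S !=set0)
    (S_compact : compact S)
    (S_irr : acts_irreducibly (generated_subgroup S)) :
  (forall n : nat, (0 < n)%N ->
     compact (scaled_kappa S n) /\ scaled_kappa S n !=set0) /\
  exists J : set 'rV[R]_d,
    [/\ compact J,
        J !=set0
      & hausdorff_dist (scaled_kappa S n) J @[n --> \oo] --> (0 : R)].
Proof.
split=> [n n0|].
  by split; [exact: scaled_kappa_compact|exact: scaled_kappa_neq0].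
have [c cP] := kappa_bounded S_GL S_compact.
have [d0 _] := S_irr.
have irr := irreducible_row_stable S_GL S_irr.
have [K [K0 [bnd rec]]] :=
  @kappa_recurrent R (standard_complex R) d S c d0 S_GL irr cP S_neq0.
apply: (hausdorff_convergence K0) => [n n0|n x n0 [g Sg <-]|n n0].
- exact: scaled_kappa_neq0.
- apply: rV_norm_le => // k; have nR : 0 < n%:R :> R by rewrite ltr0n.
  rewrite mxE normrM gtr0_norm ?invr_gt0 // mulrC ler_pdivrMr // mulrC.
  exact: bnd n0 Sg k.
have [N NP] := rec n n0; exists N.+1 => m Nm _ [g Sg <-].
have [g' Sg' g'P] := NP m (ltnW Nm) g Sg.
have nR : 0 < n%:R :> R by rewrite ltr0n.
have mR : 0 < m%:R :> R by rewrite ltr0n; exact: leq_ltn_trans Nm.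
exists (m%:R^-1 *: kappa g'); first by exists g'.
apply: rV_norm_le => [|k]; first exact: divr_ge0 K0 (ltW nR).
have entryE (u v : 'rV[R]_d) :
    (m%:R^-1 *: u - n%:R^-1 *: v) 0 k = (n%:R * u 0 k - m%:R * v 0 k) / (m%:R * n%:R).
  by rewrite !mxE; field; rewrite !gt_eqF.
rewrite entryE normrM (gtr0_norm (_ : 0 < (m%:R * n%:R)^-1)) ?invr_gt0 ?mulr_gt0 //.
rewrite ler_pdivrMr ?mulr_gt0 //.
have -> : K / n%:R * (m%:R * n%:R) = m%:R * K by field; rewrite gt_eqF.
exact: g'P k.
Qed.
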